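(* Let $E\subset\mathbb R^2$ be compact with $\dim_{\mathcal H}(E)>5/3$. Then: (i) the set of areas of triangles determined by triples of points of $E$, $$\left\{\tfrac12\left|\det\left[x-z,\,y-z\right]\right| : x,y,z\in E\right\}\subset\mathbb R,$$ contains an open interval; and (ii) the set of radii of circles determined by triples of points of $E$ (i.e., the circumradii of the triangles with vertices $x,y,z\in E$, $x,y,z$ non-collinear) contains an open interval.
   Context: $\dim_{\mathcal H}$ denotes Hausdorff dimension. For $u,v\in\mathbb R^2$, $\det[u,v]$ is the determinant of the $2\times2$ matrix with columns $u,v$. *)

(* Defs.v *)
(* Points of R^2 are pairs (R * R) over an arbitrary
   R : realType; the topology on R * R is the product topology (= Euclidean).
   Hausdorff measure / dimension are not in the library; they are defined here
   following the standard textbook definition. *)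
From HB Require Import structures.
From mathcomp Require Import all_boot all_order all_algebra.
From mathcomp Require Import all_classical all_reals all_analysis.
Set Implicit Arguments. Unset Strict Implicit. Unset Printing Implicit Defensive.
Import Order.TTheory GRing.Theory Num.Theory.
Import numFieldNormedType.Exports.
Local Open Scope classical_set_scope.
Local Open Scope ring_scope.

Section Defs.
Variable R : realType.
Local Notation P := (R * R)%type.

Definition edist (x y : P) : R :=
  Num.sqrt ((x.1 - y.1) ^+ 2 + (x.2 - y.2) ^+ 2).

Definition det2 (u v : P) : R := u.1 * v.2 - u.2 * v.1.

Definition psub (x y : P) : P := (x.1 - y.1, x.2 - y.2).

(* diameter (with diam of the empty set = 0), possibly +oo *)
Definition diam (A : set P) : \bar R :=
  ereal_sup ([set 0%:E] `|` [set (edist x y)%:E | x in A & y in A]).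

Definition hausdorff_approx (s delta : R) (E : set P) : \bar R :=
  ereal_inf [set (\sum_(0 <= i <oo) ((fine (diam (F i))) `^ s)%:E)%E
            | F in [set F : nat -> set P |
                     E `<=` \bigcup_i F i /\ forall i, (diam (F i) <= delta%:E)%E]].

(* s-dimensional Hausdorff outer measure: limit (= sup) as delta -> 0+ *)
Definition hausdorff_measure (s : R) (E : set P) : \bar R :=
  ereal_sup [set hausdorff_approx s delta E | delta in [set d : R | 0 < d]].

Definition hausdorff_dim (E : set P) : \bar R :=
  ereal_inf [set s%:E | s in [set s : R | 0 <= s /\ hausdorff_measure s E = 0%E]].

Definition triangle_areas (E : set P) : set R :=
  [set t | exists x y z, [/\ E x, E y, E z &
             t = 2^-1 * `|det2 (psub x z) (psub y z)|]].

Definition circle_radii (E : set P) : set R :=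
  [set r | exists x y z, [/\ E x, E y, E z,
             det2 (psub x z) (psub y z) != 0 &
             exists c : P, [/\ edist c x = r, edist c y = r & edist c z = r]]].

Definition contains_open_interval (S : set R) : Prop :=
  exists a b : R, a < b /\ [set t | a < t < b] `<=` S.

End Defs.

(* Main.v *)
(* A compact set of dimension > 5/3 carries, near three non-collinear points, finite measures
   giving mass O(lam^k) to boxes of side 2^-k, where 32 lam^3 < 1. Attach to each point p a
   curve u(p, .): an arc of the circle of radius t about p, or the line dual to p. Let avg_k be
   the function on the (v, b) plane equal to 2^k times the mass of the points whose curve
   passes at height at most 2^-k above (v, b).

   avg_(k+1) - avg_k is 2^k times a Haar coefficient. Expanding the square of the latter gives
   a sum over pairs (p, q) of the fourth difference of |x|, at step 2^-k, evaluated along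
   u(p, v) - u(q, v). As two curves cross transversally, with speed comparable to |p - q|, and
   that kernel has mean zero, the L^2 norm of avg_(k+1) - avg_k is O((2 lam)^(k/2)). Together
   with the trivial bound avg_k = O((4 lam)^k), the integral of a product of three averages
   changes by O((4 lam)^k (2 lam)^(k/2)) from scale k to scale k + 1: a convergent series, since
   32 lam^3 < 1. At a large fixed scale the pigeonhole principle bounds the integral from below
   for all t in some interval; so it stays positive at all finer scales, and in the limit
   compactness gives three points of E at distance t from a common point.

   For areas one vertex is moved to the origin. The triangle 0, x, y has area t/2 when the line
   dual to x passes through a point determined by y and t; the average of avg_k over these
   points is controlled in the same way, by comparing it with an average over the plane. *)

(* Everything stays finite: measures are lists of weighted points, each Frostman only down to a
   scale [N], and integrals are sums over a grid of mesh [1 / M] with [8 ^ N <= M]. No limit of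
   measures is taken. All constants are independent of [N], of the grid and of the lists, and only
   points are passed to a limit. The price is that the interval of parameters found by the
   pigeonhole principle may vary with [N]. It belongs to a finite list of intervals fixed together
   with the starting scale, so a second pigeonhole argument selects one that serves for every [N].

   The obstacle is that the supremum of an average grows like [(4 * lam) ^ k], since the dimension
   is taken below 2. Its L^2 norm stays bounded because [2 * lam < 1]. In the trilinear form the
   increment is therefore taken in L^2, one average in L^2 and only one in the supremum norm. The
   square of [(4 * lam) * sqrt (2 * lam)] is [32 * lam ^ 3]; with [lam = 2 ^ (- s)] this is less
   than 1 exactly when [s > 5/3]. *)
Require Import Defs.
From HB Require Import structures.
From mathcomp Require Import all_boot all_order all_algebra.
From mathcomp Require Import all_classical all_reals all_analysis.
From mathcomp Require Import ring lra zify.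
Import Order.TTheory GRing.Theory Num.Theory.
Import numFieldNormedType.Exports.
Local Open Scope classical_set_scope.
Local Open Scope ring_scope.
Set Implicit Arguments.
Unset Strict Implicit.
Unset Printing Implicit Defensive.

(** * Fourth differences of the absolute value *)

Section Kernel.
Variable R : realType.
Implicit Types (d x y : R).

(* [- abs4 d (u - x) / 2] is the inner product of the Haar steps [eta d] translated to [u]
   and [x], see [eta_lattice]. *)
Definition abs4 d y : R :=
  `|y + 2 * d| - 4 * `|y + d| + 6 * `|y| - 4 * `|y - d| + `|y - 2 * d|.
(* An antiderivative of the absolute value, so that [sq4 d] is one of [abs4 d]. *)
Definition sq y : R := y * `|y| / 2.
Definition sq4 d y : R :=
  sq (y + 2 * d) - 4 * sq (y + d) + 6 * sq y - 4 * sq (y - d) + sq (y - 2 * d).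

Lemma sq_taylor x y : `|sq y - sq x - `|x| * (y - x)| <= (y - x) ^+ 2.
Proof.
rewrite /sq ler_norml; case: (lerP 0 x) => hx; case: (lerP 0 y) => hy;
  rewrite ?(ger0_norm hx) ?(ltr0_norm hx) ?(ger0_norm hy) ?(ltr0_norm hy);
  have := sqr_ge0 (y - x); rewrite expr2 => ?; apply/andP; split; nra.
Qed.

(** The factor 16 is the sum 1 + 4 + 6 + 4 + 1 of the binomial weights. *)
Lemma sq4_taylor d x y :
  `|sq4 d y - sq4 d x - abs4 d x * (y - x)| <= 16 * (y - x) ^+ 2.
Proof.
have h c : `|sq (y + c) - sq (x + c) - `|x + c| * (y - x)| <= (y - x) ^+ 2.
  have := sq_taylor (x + c) (y + c).
  by rewrite (_ : y + c - (x + c) = y - x) //; ring.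
have h1 := h (2 * d); have h2 := h d; have h3 := h 0.
have h4 := h (- d); have h5 := h (- (2 * d)).
rewrite !addr0 in h3.
move: h1 h2 h3 h4 h5; rewrite /sq4 /abs4 !ler_norml.
move=> /andP[? ?] /andP[? ?] /andP[? ?] /andP[? ?] /andP[? ?].
by apply/andP; split; lra.
Qed.

Lemma abs4_eq0 d y : 0 <= d -> 2 * d <= `|y| -> abs4 d y = 0.
Proof.
move=> hd; rewrite /abs4; case: (lerP 0 y) => hy.
  by rewrite (ger0_norm hy) => h; rewrite !ger0_norm; lra.
by rewrite (ltr0_norm hy) => h; rewrite !ler0_norm; lra.
Qed.

(** On each side of 0 the function [sq] is a quadratic polynomial, and fourth differences kill
    those. That the antiderivative of [abs4 d] also has bounded support expresses that [abs4 d] has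
    mean zero. *)
Lemma sq4_eq0 d y : 0 <= d -> 2 * d <= `|y| -> sq4 d y = 0.
Proof.
move=> hd; rewrite /sq4 /sq; case: (lerP 0 y) => hy.
  by rewrite (ger0_norm hy) => h; rewrite !ger0_norm; [field|lra..].
by rewrite (ltr0_norm hy) => h; rewrite !ler0_norm; [field|lra..].
Qed.

Lemma abs4_le d y : 0 <= d -> `|abs4 d y| <= 64 * d.
Proof.
move=> hd; have [h|h] := leP (2 * d) `|y|.
  by rewrite abs4_eq0 // normr0; lra.
have b c : `|c| <= 2 * d -> 0 <= `|y + c| <= 4 * d.
  move=> hc; rewrite normr_ge0 /=; apply: (le_trans (ler_normD _ _)); lra.
have /andP[? ?] : 0 <= `|y + 2 * d| <= 4 * d by apply: b; rewrite ger0_norm; lra.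
have /andP[? ?] : 0 <= `|y + d| <= 4 * d by apply: b; rewrite ger0_norm; lra.
have /andP[? ?] : 0 <= `|y - d| <= 4 * d by apply: b; rewrite normrN ger0_norm; lra.
have /andP[? ?] : 0 <= `|y - 2 * d| <= 4 * d by apply: b; rewrite normrN ger0_norm; lra.
have ? := normr_ge0 y.
by rewrite /abs4 ler_norml; apply/andP; split; lra.
Qed.

Lemma sq4_le d y : 0 <= d -> `|sq4 d y| <= 128 * d ^+ 2.
Proof.
move=> hd; have [h|h] := leP (2 * d) `|y|.
  by rewrite sq4_eq0 // normr0; nra.
have b c : `|c| <= 2 * d -> - (8 * d ^+ 2) <= sq (y + c) <= 8 * d ^+ 2.
  move=> hc; have h4 : `|y + c| <= 4 * d by apply: (le_trans (ler_normD _ _)); lra.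
  rewrite /sq -ler_norml normrM normrM normr_id [`|2^-1|]gtr0_norm; last by rewrite invr_gt0.
  have := normr_ge0 (y + c); set z := `|y + c| in h4 * => hz.
  nra.
have /andP[? ?] := b (2 * d) ltac:(by rewrite ger0_norm; lra).
have /andP[? ?] := b d ltac:(by rewrite ger0_norm; lra).
have /andP[? ?] := b (- d) ltac:(by rewrite normrN ger0_norm; lra).
have /andP[? ?] := b (- (2 * d)) ltac:(by rewrite normrN ger0_norm; lra).
have := b 0 ltac:(by rewrite normr0; lra); rewrite addr0 => /andP[? ?].
by rewrite /sq4 ler_norml; apply/andP; split; lra.
Qed.

Lemma abs4N d y : abs4 d (- y) = abs4 d y.
Proof.
rewrite /abs4 normrN.
rewrite (_ : - y + 2 * d = - (y - 2 * d)); last ring.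
rewrite (_ : - y + d = - (y - d)); last ring.
rewrite (_ : - y - d = - (y + d)); last ring.
rewrite (_ : - y - 2 * d = - (y + 2 * d)); last ring.
rewrite !normrN; ring.
Qed.

Lemma window_count (M : nat) (P : pred nat) (q : R) : 0 <= q ->
  (forall i j, (i <= j)%N -> P i -> P j -> (j - i)%:R <= q) ->
  \sum_(i < M) (P i)%:R <= q + 1.
Proof.
move=> q0 Pq.
(* Induction on [M] keeps track of the first hit [i] and the last hit [j]. *)
suff [->|[i [j [ij jM Pi Pj]]]] : \sum_(i < M) (P i)%:R = 0 :> R \/
    exists i j, [/\ (i <= j)%N, (j < M)%N, P i, P j &
      \sum_(i < M) (P i)%:R <= (j - i)%:R + 1 :> R].
- by lra.
- move/le_trans; apply; rewrite lerD2r; exact: Pq.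
elim: M => [|M [IH|[i [j [ij jM Pi Pj IH]]]]]; first by left; rewrite big_ord0.
  rewrite big_ord_recr /= IH add0r; case: (boolP (P M)) => PM; last by left.
  by right; exists M, M; split=> //; rewrite subnn add0r.
rewrite big_ord_recr /=; case: (boolP (P M)) => PM; right.
  exists i, M; split=> //; first exact: leq_trans ij (ltnW jM).
  rewrite lerD2r; apply: (le_trans IH).
  by rewrite natr1 ler_nat ltn_sub2r // (leq_ltn_trans ij).
by exists i, j; split=> //; [exact: ltnW | rewrite addr0].
Qed.

Lemma abel_sum (g L : nat -> R) (M : nat) : g 0 = 0 -> g M = 0 ->
  \sum_(i < M) g i * (L i.+1 - L i) = - \sum_(i < M) (g i.+1 - g i) * L i.+1.
Proof.
move=> g0 gM; apply/eqP; rewrite -subr_eq0 opprK; apply/eqP.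
have -> : \sum_(i < M) g i * (L i.+1 - L i) + \sum_(i < M) (g i.+1 - g i) * L i.+1
    = g M * L M - g 0 * L 0.
  elim: M {gM} => [|M IH]; first by rewrite !big_ord0; ring.
  rewrite !big_ord_recr /=; move: IH.
  move: (\sum_(_ < _) _) (\sum_(_ < _) _) => a b IH.
  rewrite (_ : g M.+1 * L M.+1 - g 0 * L 0 =
    (b + a) + (g M.+1 * L M.+1 - g M * L M)); last by rewrite IH; ring.
  ring.
by rewrite g0 gM !mul0r subr0.
Qed.

(* A quadrature weight that vanishes at both endpoints: summation by parts leaves no boundary
   terms. *)
Definition chi (M i : nat) : R := i%:R / M%:R * (1 - i%:R / M%:R).

Lemma chi_bound M i : (i <= M)%N -> 0 <= chi M i <= 1.
Proof.
move=> iM; rewrite /chi; set v := _ / _.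
have v0 : 0 <= v by rewrite divr_ge0.
have v1 : v <= 1.
  case: M iM @v v0 => [|M] iM v v0; first by rewrite /v invr0 mulr0.
  by rewrite /v ler_pdivrMr ?ltr0Sn // mul1r ler_nat.
nra.
Qed.

Lemma chi_lip M i : (i < M)%N -> `|chi M i.+1 - chi M i| <= M%:R^-1.
Proof.
move=> iM; have M0 : 0 < M%:R :> R by rewrite ltr0n; case: M iM.
have t0 : 0 < M%:R^-1 :> R by rewrite invr_gt0.
rewrite /chi -natr1; set x : R := i%:R; set t := M%:R^-1.
have x0 : 0 <= x * t by rewrite mulr_ge0 ?ler0n // ltW.
have x1 : (x + 1) * t <= 1.
  by rewrite ler_pdivrMr // mul1r natr1 ler_nat.
rewrite mulrDl mul1r in x1 *; move: (x * t) x0 x1 => w w0 w1.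
have h1 : 0 <= w * t by rewrite mulr_ge0 // ltW.
have h2 : 0 <= t * (1 - w - t) by rewrite mulr_ge0 ?(ltW t0) //; lra.
have h3 : 0 <= t * t by rewrite mulr_ge0 ?ltW.
by rewrite ler_norml; apply/andP; split; nra.
Qed.

(** [D] samples the difference of two curves crossing with speed about [s]. Counting the nodes in
    the support of [abs4 d] would give only [d ^ 2 / s]. Instead [abs4 d (D i)] is written as an
    increment of [sq4 d] divided by the increment of [D], and summed by parts. Then [sq4 d] is
    O([d ^ 2]), it lives on O([d * M / s]) nodes up to one, and the weight [g] changes by
    O([1 / (s * M)]) from node to node: this yields the first two terms. The third is the Taylor
    error. *)
Lemma kernel_sum (M : nat) (D : nat -> R) (s A d : R) :
  (0 < M)%N -> 0 < s -> 1 <= A -> 0 <= d ->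
  (forall i, (i <= M)%N -> s / M%:R <= D i.+1 - D i <= A * (s / M%:R)) ->
  (forall i, (i < M)%N ->
     `|D i.+2 - 2 * D i.+1 + D i| <= A * (s / M%:R) / M%:R) ->
  `|\sum_(i < M) chi M i * abs4 d (D i)| / M%:R <=
     1024 * A * (d ^+ 3 / s ^+ 2 + d ^+ 2 / (s * M%:R) + s / M%:R).
Proof.
move=> M0 s0 A1 d0 H1 H2.
have Mr0 : 0 < M%:R :> R by rewrite ltr0n.
have chi0 : chi M 0 = 0 by rewrite /chi !mul0r.
have chiM : chi M M = 0 by rewrite /chi divff ?gt_eqF // subrr mulr0.
have := @chi_lip M; have := @chi_bound M.
move: (chi M) chi0 chiM => ch ch0 chM ch_bound ch_lip.
set t := M%:R^-1; have t0 : 0 < t by rewrite invr_gt0.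
have A0 : 0 <= A by lra.
have t0' : 0 <= t by exact: ltW.
have s0' : 0 <= s by exact: ltW.
have st0 : 0 < s * t by rewrite mulr_gt0.
pose De i := D i.+1 - D i.
have De0 i : (i <= M)%N -> 0 < De i by move=> /H1/andP[+ _]; exact: lt_le_trans.
pose g i := ch i * t / De i.
pose e i := sq4 d (D i.+1) - sq4 d (D i) - abs4 d (D i) * De i.
have key : (\sum_(i < M) ch i * abs4 d (D i)) * t =
    \sum_(i < M) g i * (sq4 d (D i.+1) - sq4 d (D i)) - \sum_(i < M) g i * e i.
  rewrite -sumrB mulr_suml; apply: eq_bigr => i _.
  have := De0 i (ltnW (ltn_ord i)); rewrite /g /e => h.
  by field; rewrite gt_eqF.
rewrite -[leLHS](ger0_norm (mulr_ge0 (normr_ge0 _) (ltW t0))) normrM normr_id -normrM key.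
have g0 : g 0%N = 0 by rewrite /g ch0 !mul0r.
have gM : g M = 0 by rewrite /g chM !mul0r.
rewrite (@abel_sum g (fun i => sq4 d (D i))) //.
rewrite -opprD normrN; apply: (le_trans (ler_normD _ _)).
have e_le : `|\sum_(i < M) g i * e i| <= 16 * A * (s * t).
  apply: (le_trans (ler_norm_sum _ _ _)).
  apply: (@le_trans _ _ (\sum_(i < M) 16 * A * (s * t) * t)).
    apply: ler_sum => i _; have iM := ltnW (ltn_ord i).
    have D0 := De0 i iM; have /andP[c0 c1] := ch_bound _ iM.
    have /andP[_ D1] := H1 i iM.
    rewrite normrM /g normrM normfV [`|_ * t|]normrM (ger0_norm c0) (gtr0_norm t0) (gtr0_norm D0).
    apply: (@le_trans _ _ (1 * t / De i * (16 * De i ^+ 2))).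
      apply: ler_pM => //.
        by rewrite !mulr_ge0 ?invr_ge0 ?(ltW t0) ?(ltW D0).
        by rewrite ler_pM2r ?invr_gt0 // ler_pM2r.
      exact: sq4_taylor.
    rewrite (_ : 1 * t / De i * (16 * De i ^+ 2) = 16 * De i * t); last first.
      by field; rewrite gt_eqF.
    by rewrite ler_pM2r // -mulrA ler_pM2l // ltr0n.
  rewrite sumr_const card_ord -[_ *+ M]mulr_natr -mulrA mulVf ?gt_eqF //.
  by rewrite mulr1.
have a_le : `|\sum_(i < M) (g i.+1 - g i) * sq4 d (D i.+1)| <=
    2 * A * (t / s) * (128 * d ^+ 2) * (4 * d / (s * t) + 1).
  apply: (le_trans (ler_norm_sum _ _ _)).
  apply: (@le_trans _ _ (\sum_(i < M) 2 * A * (t / s) * (128 * d ^+ 2) *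
      ((i < M)%N && (`|D i.+1| < 2 * d))%:R)).
    apply: ler_sum => i _; have iM := ltn_ord i.
    have C0 : 0 <= 2 * A * (t / s).
      by rewrite !mulr_ge0 ?invr_ge0 ?ler0n.
    have [h|h] := leP (2 * d) `|D i.+1|.
      by rewrite sq4_eq0 // mulr0 normr0 andbF mulr0.
    rewrite iM /= mulr1 normrM; apply: ler_pM => //; last exact: sq4_le.
    have D0 := De0 i (ltnW iM); have D1 := De0 i.+1 iM.
    have /andP[L0 _] := H1 i (ltnW iM); have /andP[L1 _] := H1 i.+1 iM.
    have -> : g i.+1 - g i = t * ((ch i.+1 - ch i) / De i.+1 -
        ch i * (D i.+2 - 2 * D i.+1 + D i) / (De i * De i.+1)).
      rewrite /g.
      rewrite (_ : D i.+2 - 2 * D i.+1 + D i = De i.+1 - De i); last by rewrite /De; ring.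
      by field; rewrite !gt_eqF.
    rewrite normrM gtr0_norm // (_ : 2 * A * (t / s) = t * (A / s + A / s)); last first.
      by field; rewrite gt_eqF.
    rewrite ler_pM2l //; apply: (le_trans (ler_normB _ _)); apply: lerD.
      rewrite normrM normfV (gtr0_norm D1).
      apply: (@le_trans _ _ (t / (s * t))).
        apply: ler_pM => //; first by rewrite invr_ge0 ltW.
          exact: ch_lip.
        by rewrite lef_pV2.
      rewrite (_ : t / (s * t) = s^-1); last by field; rewrite !gt_eqF.
      by rewrite ler_peMl // invr_ge0 ltW.
    rewrite normrM [`|ch i * _|]normrM normfV [`|De i * _|]normrM (gtr0_norm D0) (gtr0_norm D1).
    have /andP[c0 c1] := ch_bound _ (ltnW iM).
    rewrite (ger0_norm c0).
    apply: (@le_trans _ _ (1 * (A * (s * t) * t) / ((s * t) * (s * t)))).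
      apply: ler_pM => //.
      + by rewrite mulr_ge0.
      + by rewrite invr_ge0 mulr_ge0 ?ltW.
      + by apply: ler_pM => //; exact: H2.
      + rewrite lef_pV2 ?posrE ?mulr_gt0 //.
        by apply: ler_pM => //; rewrite ltW.
    rewrite (_ : _ / _ = A / s) //; by field; rewrite !gt_eqF.
  rewrite -mulr_sumr ler_wpM2l //.
    by rewrite !mulr_ge0 ?invr_ge0 ?sqr_ge0 ?ler0n.
  (* [D] advances by at least [s * t] at each step, so its visits to the window of length [4 * d]
     spread over at most [4 * d / (s * t)] indices. *)
  apply: (@window_count M (fun i => (i < M)%N && (`|D i.+1| < 2 * d))).
    by rewrite divr_ge0 ?mulr_ge0 ?ler0n.
  move=> i j ij /andP[iM hi] /andP[jM hj]; rewrite ler_pdivlMr //.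
  have : (j - i)%:R * (s * t) <= D j.+1 - D i.+1.
    move: {hj} jM; rewrite -(subnK ij) addnK; elim: (j - i)%N => [|n IH].
      by rewrite add0n mul0r subrr.
    rewrite addSn => h; have := IH (ltnW h); have /andP[+ _] := H1 _ (ltnW h).
    rewrite -natr1 -/t; lra.
  move=> /le_trans; apply; rewrite !ltr_norml in hi hj.
  by case/andP: hi => ? ?; case/andP: hj => ? ?; lra.
apply: (le_trans (lerD a_le e_le)).
have -> : 2 * A * (t / s) * (128 * d ^+ 2) * (4 * d / (s * t) + 1) =
   1024 * A * (d ^+ 3 / s ^+ 2) + 256 * A * (d ^+ 2 * t / s).
  by field; rewrite !gt_eqF.
rewrite [d ^+ 2 / (s * _)](_ : _ = d ^+ 2 * t / s); last by rewrite invfM mulrA mulrAC.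
have : 0 <= A * (d ^+ 2 * t / s).
  by rewrite !mulr_ge0 ?invr_ge0 ?sqr_ge0.
have : 0 <= A * (s * t) by rewrite !mulr_ge0.
rewrite !mulrDr -!(mulrA 1024 A) -!(mulrA 256 A) -!(mulrA 16 A); lra.
Qed.

End Kernel.

(** * Inner products of Haar steps on a lattice *)

Section Lattice.
Variable R : realType.
Implicit Types (d u x y : R).

Lemma count_ltn J x : 0 <= x <= J%:R ->
  `|\sum_(j < J) (j%:R < x)%R%:R - x| <= 1 :> R.
Proof.
elim: J => [|J IH] /andP[x0 xJ].
  by rewrite big_ord0 sub0r normrN ger0_norm // (le_trans xJ).
rewrite big_ord_recr /=; have [h|h] := leP x J%:R.
  by rewrite addr0 IH // x0.
rewrite (eq_bigr (fun=> 1)); last first.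
  by move=> j _; rewrite (lt_trans _ h) // ltr_nat.
rewrite sumr_const card_ord; rewrite -natr1 in xJ.
by rewrite ler_norml; apply/andP; split; rewrite /=; lra.
Qed.

Lemma count_lattice M J u : (0 < M)%N -> 0 <= u <= J%:R / M%:R ->
  `|(\sum_(j < J) (j%:R / M%:R < u)%R%:R) / M%:R - u| <= M%:R^-1.
Proof.
move=> M0 /andP[u0 uJ]; have Mr : 0 < M%:R :> R by rewrite ltr0n.
have h : 0 <= u * M%:R <= J%:R.
  by rewrite mulr_ge0 //= -ler_pdivlMr.
have := count_ltn h.
under eq_bigr do rewrite -ltr_pdivrMr //.
move: (\sum_(_ < _) _) => S hS.
have -> : S / M%:R - u = (S - u * M%:R) / M%:R by field; rewrite gt_eqF.
by rewrite normrM normfV (gtr0_norm Mr) ler_pdivrMr // mulVf ?gt_eqF.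
Qed.

Definition eta d y : R := (0 < y)%R%:R - 2 * (d < y)%R%:R + (2 * d < y)%R%:R.

(** The product of the indicators of [j / M < y] and [j / M < z] is the indicator for
    [min y z = (y + z - |y - z|) / 2]. In the nine products the terms [y + z] cancel, and the two
    second differences of [|y - z|] combine into a fourth difference. Each of the nine counts is off
    by at most [1 / M], with weights (1 + 2 + 1)^2 = 16. *)
Lemma eta_lattice M J d u x : (0 < M)%N -> 0 <= d ->
  2 * d <= u <= J%:R / M%:R -> 2 * d <= x <= J%:R / M%:R ->
  `|(\sum_(j < J) eta d (u - j%:R / M%:R) * eta d (x - j%:R / M%:R)) / M%:R
     + abs4 d (u - x) / 2| <= 16 / M%:R.
Proof.
move=> M0 d0 /andP[u1 u2] /andP[x1 x2].
pose th y (j : 'I_J) : R := (j%:R / M%:R < y)%R%:R.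
pose S y z := (\sum_(j < J) th y j * th z j) / M%:R.
have HS y z : 0 <= y <= J%:R / M%:R -> 0 <= z <= J%:R / M%:R ->
    `|S y z - (y + z - `|y - z|) / 2| <= M%:R^-1.
  move=> /andP[y0 y1] /andP[z0 z1].
  have -> : (y + z - `|y - z|) / 2 = Num.min y z.
    by case: (lerP y z) => h; lra.
  rewrite /S (eq_bigr (fun j : 'I_J => (j%:R / M%:R < Num.min y z)%R%:R)).
    by apply: count_lattice => //; rewrite le_min ge_min y0 z0 y1.
  by move=> j _; rewrite /th -natrM mulnb lt_min.
have -> : (\sum_(j < J) eta d (u - j%:R / M%:R) * eta d (x - j%:R / M%:R)) / M%:R =
   S u x - 2 * S u (x - d) + S u (x - 2 * d)
   - 2 * S (u - d) x + 4 * S (u - d) (x - d) - 2 * S (u - d) (x - 2 * d)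
   + S (u - 2 * d) x - 2 * S (u - 2 * d) (x - d) + S (u - 2 * d) (x - 2 * d).
  have etaE y (j : 'I_J) : eta d (y - j%:R / M%:R) = th y j - 2 * th (y - d) j + th (y - 2 * d) j.
    rewrite /eta /th; congr (_ - 2 * _ + _); congr (_ %:R).
    - by rewrite subr_gt0.
    - by rewrite !ltrBrDr addrC.
    - by rewrite !ltrBrDr addrC.
  under eq_bigr do rewrite !etaE.
  rewrite /S !mulr_suml !mulr_sumr -!sumrN -!big_split /=.
  by apply: eq_bigr => j _; ring.
have := HS u x ltac:(lra) ltac:(lra).
have := HS u (x - d) ltac:(lra) ltac:(lra).
have := HS u (x - 2 * d) ltac:(lra) ltac:(lra).
have := HS (u - d) x ltac:(lra) ltac:(lra).
have := HS (u - d) (x - d) ltac:(lra) ltac:(lra).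
have := HS (u - d) (x - 2 * d) ltac:(lra) ltac:(lra).
have := HS (u - 2 * d) x ltac:(lra) ltac:(lra).
have := HS (u - 2 * d) (x - d) ltac:(lra) ltac:(lra).
have := HS (u - 2 * d) (x - 2 * d) ltac:(lra) ltac:(lra).
rewrite (_ : u - (x - d) = u - x + d); last ring.
rewrite (_ : u - (x - 2 * d) = u - x + 2 * d); last ring.
rewrite (_ : u - d - x = u - x - d); last ring.
rewrite (_ : u - d - (x - d) = u - x); last ring.
rewrite (_ : u - d - (x - 2 * d) = u - x + d); last ring.
rewrite (_ : u - 2 * d - x = u - x - 2 * d); last ring.
rewrite (_ : u - 2 * d - (x - d) = u - x - d); last ring.
rewrite (_ : u - 2 * d - (x - 2 * d) = u - x); last ring.
rewrite !(ler_norml (_ - _)) !(ler_norml (_ + _)) /abs4.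
move=> /andP[? ?] /andP[? ?] /andP[? ?] /andP[? ?] /andP[? ?].
move=> /andP[? ?] /andP[? ?] /andP[? ?] /andP[? ?].
by apply/andP; split; lra.
Qed.

End Lattice.

(** * Discrete measures and families of curves *)

Section Boxes.
Variable R : realType.
Local Notation P := (R * R)%type.

Definition dyadic (k : nat) : R := 2^-1 ^+ k.
Local Notation dy := dyadic.
Definition inbox (p q : P) (r : R) : bool := (`|p.1 - q.1| <= r) && (`|p.2 - q.2| <= r).
(* A finite measure is a list of (weight, point) pairs. *)
Definition mass (mu : seq (R * P)) (A : pred P) : R :=
  \sum_(e <- mu) e.1 * (A e.2)%:R.

(** The cutoff [N] is forced for [lam < 1]: an atom of positive weight violates the bound at fine
    scales. *)
Definition frostman (lam C : R) (N : nat) (mu : seq (R * P)) : Prop :=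
  (forall e, e \in mu -> 0 <= e.1) /\
  (forall k q, (k <= N)%N -> mass mu (fun p => inbox p q (dy k)) <= C * lam ^+ k).

(* The third clause is transversality: [u p - u q] has slope comparable to [p.1 - q.1] with a
   fixed sign, so two graphs cross at most once, and quickly. *)
Definition curves (kap A sg : R) (X : P -> Prop) (u : P -> R -> R) : Prop :=
  [/\ forall p v, X p -> 0 <= v <= 2 -> 2^-1 <= u p v <= 2,
      forall p q v, X p -> X q -> 0 <= v <= 2 ->
        `|u p v - u q v - (p.2 - q.2)| <= A * `|p.1 - q.1|,
      forall p q v t, X p -> X q -> q.1 <= p.1 -> 0 <= v -> 0 <= t -> v + t <= 2 ->
        kap * (p.1 - q.1) * t <= sg * ((u p (v + t) - u q (v + t)) - (u p v - u q v))
          <= A * (p.1 - q.1) * t &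
      forall p q v t, X p -> X q -> 0 <= v -> 0 <= t -> v + 2 * t <= 2 ->
        `|(u p (v + 2 * t) - u q (v + 2 * t)) - 2 * (u p (v + t) - u q (v + t))
           + (u p v - u q v)| <= A * `|p.1 - q.1| * t ^+ 2].

Lemma dy_gt0 k : 0 < dy k. Proof. by rewrite exprn_gt0 // invr_gt0. Qed.
Lemma dyS k : dy k.+1 = dy k / 2. Proof. by rewrite /dyadic exprSr. Qed.
Lemma dyD k l : dy (k + l) = dy k * dy l. Proof. by rewrite /dyadic exprD. Qed.
Lemma dy_le1 k : dy k <= 1.
Proof. by rewrite exprn_ile1 //; lra. Qed.
Lemma dy_le k l : (k <= l)%N -> dy l <= dy k.
Proof.
by move=> kl; rewrite -(subnK kl) dyD ler_piMl ?dy_le1 // ltW ?dy_gt0.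
Qed.
Lemma inboxC p q r : inbox p q r = inbox q p r.
Proof. by rewrite /inbox (distrC p.1) (distrC p.2). Qed.
Lemma inbox_le p q r s : r <= s -> inbox p q r -> inbox p q s.
Proof. by move=> rs /andP[h1 h2]; apply/andP; split; exact: le_trans rs. Qed.

Lemma dy_small (x : R) : 0 < x -> exists k, dy k <= x.
Proof.
move=> x0; have [n hn] : exists n, x^-1 <= n%:R.
  by exists (Num.bound x^-1); rewrite ltW // archi_boundP // invr_ge0 ltW.
exists n; have x1 : 0 < x^-1 by rewrite invr_gt0.
rewrite /dyadic exprVn -[leRHS]invrK lef_pV2 ?posrE ?exprn_gt0 //.
by apply: (le_trans hn); rewrite -natrX ler_nat ltnW // ltn_expl.
Qed.

(** Used to find the dyadic scale at which two points separate, or to learn that they are still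
    together at scale [k]. *)
Lemma max_level (Q : pred nat) k : Q 0 ->
  exists l, [/\ (l <= k)%N, Q l & l = k \/ ~~ Q l.+1].
Proof.
move=> Q0; elim: k => [|k [l [lk Ql]]]; first by exists 0%N; split=> //; left.
case=> [lE|nQ]; last by exists l; split=> //; [exact: leqW|right].
case: (boolP (Q k.+1)) => h; first by exists k.+1; split=> //; left.
by exists k; split=> //; [rewrite -lE | right].
Qed.

End Boxes.

Ltac positivity := repeat first [assumption | (apply: ltW; assumption) | match goal with
 | |- is_true (0 <= _ * _) => apply: mulr_ge0
 | |- is_true (0 < _ * _) => apply: mulr_gt0
 | |- is_true (0 <= _ + _) => apply: addr_ge0
 | |- is_true (0 <= _^-1) => rewrite invr_ge0
 | |- is_true (0 < _^-1) => rewrite invr_gt0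
 | |- is_true (0 <= _ ^+ _) => apply: exprn_ge0
 | |- is_true (0 < _ ^+ _) => apply: exprn_gt0
 | |- is_true (0 <= _%:R) => exact: ler0n
 | |- is_true (0 < _.+1%:R) => exact: ltr0Sn
 | |- is_true (0 <= 1) => exact: ler01
 | |- is_true (0 < 1) => exact: ltr01
 | |- is_true (0 <= dyadic _ _) => exact: (ltW (dy_gt0 _ _))
 | |- is_true (0 < dyadic _ _) => exact: dy_gt0
 | |- is_true (0 <= `|_|) => exact: normr_ge0
 end].

(** * Haar coefficients in L^2 *)

Section Pair.
Variable R : realType.
Local Notation P := (R * R)%type.
Local Notation dy := (@dyadic R).

Lemma dy4 l : 4 ^+ l * dy l ^+ 2 = 1.
Proof.
elim: l => [|l IH]; first by rewrite /dyadic !expr0; ring.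
by rewrite dyS exprS -[RHS]IH; field.
Qed.

Definition node (M i : nat) : R := i%:R / M%:R.

Lemma node_bound M i : (i <= M)%N -> 0 <= node M i <= 1.
Proof.
move=> iM; rewrite /node divr_ge0 //=.
case: M iM => [|M] iM; first by rewrite invr0 mulr0.
by rewrite ler_pdivrMr ?ltr0Sn // mul1r ler_nat.
Qed.

Lemma node_diff M i : node M i.+1 = node M i + M%:R^-1.
Proof. by rewrite /node -natr1 mulrDl mul1r. Qed.

(** The weighted inner product of the Haar steps carried by the curves of [p] and [q]. The heights
    [j / M] with [j < 2 * M] fill [0, 2], which contains the values of the curves. *)
Definition gram (M k : nat) (u : P -> R -> R) (p q : P) : R :=
  (\sum_(i < M) chi R M i * ((\sum_(j < 2 * M)
     eta (dy k.+1) (u p (node M i) - j%:R / M%:R) *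
     eta (dy k.+1) (u q (node M i) - j%:R / M%:R)) / M%:R)) / M%:R.

Lemma gramC M k u p q : gram M k u p q = gram M k u q p.
Proof.
congr (_ / _); apply: eq_bigr => i _; congr (_ * (_ / _)).
by apply: eq_bigr => j _; rewrite mulrC.
Qed.

Lemma dyM8 k M : (8 ^ k <= M)%N -> M%:R^-1 <= dy k ^+ 3.
Proof.
move=> h; rewrite /dyadic -exprM mulnC exprM.
have -> : (2^-1 : R) ^+ 3 = 8%:R^-1 by rewrite exprVn -natrX.
have M0 : (0 < M)%N by apply: leq_trans h; rewrite expn_gt0.
by rewrite exprVn -natrX lef_pV2 ?posrE ?ltr0n ?expn_gt0 ?ler_nat.
Qed.

Lemma chi_mean_le (M : nat) (f : nat -> R) B : (0 < M)%N ->
  (forall i, (i < M)%N -> `|f i| <= B) ->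
  `|\sum_(i < M) chi R M i * f i| / M%:R <= B.
Proof.
move=> M0 fB; have Mr : 0 < M%:R :> R by rewrite ltr0n.
rewrite ler_pdivrMr // mulrC mulr_natl.
apply: (le_trans (ler_norm_sum _ _ _)).
rewrite -[X in _ *+ X]card_ord -sumr_const; apply: ler_sum => i _.
have /andP[c0 c1] := chi_bound R (ltnW (ltn_ord i)).
by rewrite normrM (ger0_norm c0) -[B]mul1r ler_pM // fB.
Qed.

(** [eta_lattice] is applied in each column. The fineness [8 ^ k <= M] makes its error as small as
    [dy k ^+ 3], the size of the gain expected from cancellation. The curves stay above 1/2, which
    leaves room for the shift [2 * dy k.+1 = dy k] as soon as [0 < k]. *)
Lemma gram_abs4 kap A sg X u M k p q : curves kap A sg X u -> X p -> X q ->
  (0 < k)%N -> (8 ^ k <= M)%N ->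
  `|gram M k u p q| <= 16 * dy k ^+ 3 +
    `|\sum_(i < M) chi R M i * abs4 (dy k.+1) (u p (node M i) - u q (node M i))| / M%:R.
Proof.
move=> [Hr _ _ _] Xp Xq k0 kM.
have M0 : (0 < M)%N by apply: leq_trans kM; rewrite expn_gt0.
have Mr : 0 < M%:R :> R by rewrite ltr0n.
pose a i := abs4 (dy k.+1) (u p (node M i) - u q (node M i)).
pose b i := (\sum_(j < 2 * M)
     eta (dy k.+1) (u p (node M i) - j%:R / M%:R) *
     eta (dy k.+1) (u q (node M i) - j%:R / M%:R)) / M%:R.
rewrite -/(\sum_(i < M) chi R M i * a i).
have -> : gram M k u p q = (\sum_(i < M) chi R M i * (b i + a i / 2)) / M%:R -
   (\sum_(i < M) chi R M i * a i) / 2 / M%:R.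
  rewrite /gram -mulrBl; congr (_ / _); rewrite mulr_suml -sumrB.
  by apply: eq_bigr => i _; rewrite -/(b i); field.
apply: (le_trans (ler_normB _ _)); apply: lerD.
  rewrite normrM [`|M%:R^-1|]ger0_norm ?invr_ge0 ?ler0n //.
  apply: (@chi_mean_le M (fun i => b i + a i / 2)) => // i iM.
  have v2 : 0 <= node M i <= 2.
    by have /andP[-> /= h] := node_bound (ltnW iM); lra.
  have JM : (2 * M)%:R / M%:R = 2 :> R by rewrite natrM mulfK // gt_eqF.
  have d1 : 2 * dy k.+1 <= 2^-1.
    have -> : 2 * dy k.+1 = dy k by rewrite dyS; field.
    apply: (le_trans (dy_le R k0)); by rewrite /dyadic expr1.
  have /andP[up1 up2] := Hr p _ Xp v2; have /andP[uq1 uq2] := Hr q _ Xq v2.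
  apply: (le_trans (eta_lattice _ _ _ _)) => //.
  - by rewrite ltW ?dy_gt0.
  - by rewrite JM; lra.
  - by rewrite JM; lra.
  - by rewrite ler_pM2l ?ltr0n // dyM8.
rewrite !normrM [`|M%:R^-1|]ger0_norm ?invr_ge0 ?ler0n // ler_pM2r ?invr_gt0 //.
rewrite [`|2^-1|]ger0_norm ?invr_ge0 ?ler0n //.
by have := normr_ge0 (\sum_(i < M) chi R M i * a i); lra.
Qed.

Lemma abs4_sign d (y s : R) : s = 1 \/ s = -1 -> abs4 d (s * y) = abs4 d y.
Proof. by case=> ->; rewrite ?mul1r // mulN1r abs4N. Qed.

(* The transversality H1 makes the difference of two curves cross zero with speed
   comparable to the separation of the points, so the mean-zero kernel gains. *)
Lemma far_pair kap A sg X u M k l p q : curves kap A sg X u -> X p -> X q ->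
  sg = 1 \/ sg = -1 -> 0 < kap -> kap <= A ->
  (8 ^ k <= M)%N -> q.1 <= p.1 -> dy l.+1 <= p.1 - q.1 <= 1 ->
  `|\sum_(i < M) chi R M i * abs4 (dy k.+1) (u p (node M i) - u q (node M i))| / M%:R
   <= 1024 * (A / kap) * (4 / kap ^+ 2 + 2 / kap + kap) * (dy k ^+ 3 * 4 ^+ l).
Proof.
move=> [_ _ H1 H2] Xp Xq sgE kap0 kapA kM qp /andP[r1 r2].
have M0 : (0 < M)%N by apply: leq_trans kM; rewrite expn_gt0.
have Mr : 0 < M%:R :> R by rewrite ltr0n.
set r := p.1 - q.1 in r1 r2.
have r0 : 0 < r by apply: lt_le_trans r1; exact: dy_gt0.
pose D i := sg * (u p (node M i) - u q (node M i)).
rewrite (eq_bigr (fun i : 'I_M => chi R M i * abs4 (dy k.+1) (D i))); last first.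
  by move=> i _; rewrite /D abs4_sign.
have t0 : 0 <= M%:R^-1 :> R by rewrite invr_ge0 ltW.
have t1 : M%:R^-1 <= 1 :> R by rewrite invf_le1 // ler1n.
have nD := dyM8 kM; set t := M%:R^-1 in t0 t1 nD.
have Ak : 1 <= A / kap by rewrite ler_pdivlMr // mul1r.
have d0 : 0 <= dy k.+1 by rewrite ltW ?dy_gt0.
have AkE : A / kap * (kap * r * t) = A * r * t by field; rewrite gt_eqF.
apply: (le_trans (@kernel_sum R M D (kap * r) (A / kap) (dy k.+1) M0 (mulr_gt0 kap0 r0) Ak d0 _ _)).
- move=> i iM; rewrite -/t AkE /D !node_diff -/t -mulrBr.
  have /andP[n0 n1] := node_bound iM.
  by apply: H1 => //; lra.
- move=> i iM; rewrite -/t AkE /D !node_diff -/t.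
  have /andP[n0 n1] := node_bound (ltnW iM).
  have t2 : node M i + 2 * t <= 2.
    by move: (node_bound iM); rewrite node_diff -/t => /andP[_ ?]; lra.
  have := H2 p q (node M i) t Xp Xq n0 t0 t2.
  rewrite (_ : node M i + 2 * t = node M i + t + t); last ring.
  rewrite -/r (ger0_norm (ltW r0)) expr2 (mulrA (A * r)).
  move=> hh. apply: le_trans hh; rewrite le_eqVlt; apply/orP; left; apply/eqP.
  case: sgE => ->; first by congr (Num.norm _); ring.
  by rewrite -normrN; congr (Num.norm _); ring.
rewrite -!(mulrA (1024 * _)) ler_pM2l; last by rewrite mulr_gt0 ?ltr0n //; lra.
have e0 := dy_gt0 R k; have f0 := dy_gt0 R l.
have q0 : 0 < 4 ^+ l :> R by rewrite exprn_gt0.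
have q1 : 1 <= 4 ^+ l :> R by rewrite exprn_ege1 //; lra.
have qf : 4 ^+ l * (dy l) ^+ 2 = 1.
  exact: dy4.
have rl : dy l / 2 <= r by rewrite -dyS.
have ir2 : r ^- 2 <= 4 * 4 ^+ l.
  rewrite -[leLHS]mul1r ler_pdivrMr ?exprn_gt0 // -[X in X <= _]qf (mulrC 4) -mulrA ler_pM2l //.
  rewrite -[4 : R](_ : 2 ^+ 2 = 4); last by ring.
  by rewrite -exprMn lerXn2r ?nnegrE ?mulr_ge0 ?(ltW f0) ?(ltW r0) //; lra.
have ir : r^-1 <= 2 * 4 ^+ l.
  rewrite -[leLHS]mul1r ler_pdivrMr // -[X in X <= _]qf (mulrC 2) -mulrA ler_pM2l //.
  by apply: (@le_trans _ _ (dy l)); [rewrite expr2 ler_piMl ?dy_le1 // ltW | lra].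
(* The three terms of [kernel_sum] with [s = kap * r]: the first is bounded by
   [r ^- 2 <= 4 * 4 ^ l], the other two by [1 / M <= dy k ^+ 3]. *)
rewrite [(_ + kap) * _]mulrDl [(_ + 2 / kap) * _]mulrDl; apply: lerD; first apply: lerD.
- rewrite (_ : dy k.+1 ^+ 3 / (kap * r) ^+ 2 = (dy k.+1 ^+ 3 * r ^- 2) / kap ^+ 2); last by field; rewrite !gt_eqF.
  rewrite (_ : 4 / kap ^+ 2 * (dy k ^+ 3 * 4 ^+ l) = (dy k ^+ 3 * (4 * 4 ^+ l)) / kap ^+ 2); last by field; rewrite gt_eqF.
  rewrite ler_pM2r ?invr_gt0 ?exprn_gt0 //.
  apply: ler_pM => //; rewrite ?exprn_ge0 ?invr_ge0 ?exprn_ge0 ?(ltW r0) //.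
  by apply: lerXn2r; rewrite ?nnegrE ?(ltW e0) // dy_le.
- rewrite (_ : 2 / kap * (dy k ^+ 3 * 4 ^+ l) = dy k ^+ 3 * (2 * 4 ^+ l) / kap); last by field; rewrite gt_eqF.
  rewrite (_ : dy k.+1 ^+ 2 / (kap * r * M%:R) = (dy k.+1 ^+ 2 * t) * r^-1 / kap); last first.
    by rewrite /t; field; rewrite !gt_eqF.
  rewrite ler_pM2r ?invr_gt0 //; apply: ler_pM => //.
  + by apply: mulr_ge0 => //; exact: exprn_ge0.
  + by rewrite invr_ge0 ltW.
  + apply: le_trans nD; rewrite ler_piMl //; apply: exprn_ile1 => //.
    exact: dy_le1.
- rewrite -mulrA ler_pM2l //; apply: (@le_trans _ _ t).
    by rewrite -[leRHS]mul1r ler_wpM2r.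
  by apply: (le_trans nD); rewrite ler_peMr // exprn_ge0 // ltW.
Qed.

(** Let [l] be a level at which the two points are still together but not at the next one. If
    [l = k], the trivial bound [64 * dy k] is [64 * dy k ^+ 3 * 4 ^ k]. If the horizontal distance
    is at least [dy l.+1], then [far_pair] applies. Otherwise the points are separated vertically
    and the kernel vanishes. The sum over [l] merely contains the term in question; the isolated
    [dy k ^+ 3] pays for the lattice error. *)
Lemma pair_bound (kap A : R) : 0 < kap -> kap <= A ->
  exists K, 0 <= K /\ forall sg X u M k p q, curves kap A sg X u -> X p -> X q ->
  sg = 1 \/ sg = -1 -> (0 < k)%N -> (8 ^ k <= M)%N -> inbox p q 1 ->
  `|gram M k u p q| <= K * (dy k ^+ 3 +
     \sum_(l < k.+1) dy k ^+ 3 * 4 ^+ l * (inbox p q ((A + 1) * dy l))%:R).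
Proof.
move=> kap0 kapA.
pose K1 := 1024 * (A / kap) * (4 / kap ^+ 2 + 2 / kap + kap).
have A0 : 0 < A by apply: lt_le_trans kapA.
have K10 : 0 <= K1.
  by rewrite /K1; positivity.
exists (64 + K1); split; first by lra.
move=> sg X u M k p q; wlog qp : p q / q.1 <= p.1.
  move=> H Hc Xp Xq sgE k0 kM npq; have [h|h] := leP q.1 p.1; first exact: H.
  rewrite gramC; apply: (le_trans (H q p (ltW h) Hc Xq Xp sgE k0 kM _)).
    by rewrite inboxC.
  rewrite le_eqVlt; apply/orP; left; apply/eqP; congr (_ * (_ + _)).
  by apply: eq_bigr => l _; rewrite inboxC.
move=> Hc Xp Xq sgE k0 kM npq.
apply: (le_trans (gram_abs4 Hc Xp Xq k0 kM)).
set Z := _ / _.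
have d3 : 0 < dy k ^+ 3 by rewrite exprn_gt0 ?dy_gt0.
set S := \sum_(l < k.+1) _.
have Sl l : (l <= k)%N -> inbox p q ((A + 1) * dy l) -> dy k ^+ 3 * 4 ^+ l <= S.
  move=> lk npl; rewrite /S; have lk' : (l < k.+1)%N by [].
  rewrite (bigD1 (Ordinal lk')) //= npl mulr1 lerDl sumr_ge0 // => i _.
  by positivity.
have S0 : 0 <= S.
  by apply: sumr_ge0 => i _; positivity.
suff ZS : Z <= (64 + K1) * S.
  rewrite mulrDr; apply: lerD => //; rewrite ler_pM2r //; lra.
have M0 : (0 < M)%N by apply: leq_trans kM; rewrite expn_gt0.
have [|l [lk npl lE]] := @max_level (fun l => inbox p q ((A + 1) * dy l)) k.
  by apply: inbox_le npq; rewrite /dyadic expr0 mulr1; lra.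
have le64 : 64 * S <= (64 + K1) * S by rewrite ler_wpM2r //; lra.
have leK1 : K1 * S <= (64 + K1) * S by rewrite ler_wpM2r //; lra.
have SL := Sl l lk npl.
have [lk'|lneq] := eqVneq l k.
  apply: le_trans le64; apply: (@le_trans _ _ (64 * dy k)).
    apply: (@chi_mean_le M (fun i => abs4 (dy k.+1) (u p (node M i) - u q (node M i)))) => // i _.
    apply: (le_trans (abs4_le _ _)); first by rewrite ltW ?dy_gt0.
    by rewrite ler_pM2l ?ltr0n // dy_le.
  rewrite ler_pM2l ?ltr0n //; apply: le_trans SL.
  rewrite lk' le_eqVlt; apply/orP; left; apply/eqP.
  rewrite exprSr -mulrA [dy k ^+ 2]expr2 -mulrA.
  have -> : (dy k * (dy k * 4 ^+ k)) = 1.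
    by rewrite mulrA -expr2 mulrC dy4.
  by rewrite mulr1.
have /andP[n1 n2] := npq.
have [h|h] := leP (dy l.+1) (p.1 - q.1).
  apply: le_trans leK1; apply: (le_trans (@far_pair kap A sg X u M k l p q Hc Xp Xq sgE kap0 kapA kM qp _)).
    by rewrite h /=; apply: le_trans n1; exact: ler_norm.
  by rewrite -/K1 ler_wpM2l.
have lek : (l < k)%N by rewrite ltn_neqAle lneq.
case: lE => [/eqP|nl]; first by rewrite (negPf lneq).
(* The vertical distance exceeds [(A + 1) * dy l.+1], while the horizontal one moves the curves by
   at most [A * dy l.+1]. The curves thus remain at least [dy l.+1 >= dy k = 2 * dy k.+1] apart,
   outside the support of the kernel. *)
rewrite /Z big1 ?normr0 ?mul0r ?mulr_ge0 //; first by lra.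
move=> i _; rewrite abs4_eq0 ?mulr0 ?(ltW (dy_gt0 _ _)) //.
have [_ H0 _ _] := Hc.
have v2 : 0 <= node M i <= 2.
  by have /andP[-> /= h'] := node_bound (ltnW (ltn_ord i)); lra.
have := H0 p q _ Xp Xq v2; rewrite [`|p.1 - q.1|]ger0_norm ?subr_ge0 //.
set D := u p _ - _; set r := p.1 - q.1 in h *; set w := p.2 - q.2.
have r0 : 0 <= r by rewrite subr_ge0.
have -> : 2 * dy k.+1 = dy k by rewrite dyS; field.
have dk := @dy_le R _ _ lek.
have wl : (A + 1) * dy l.+1 < `|w|.
  move: nl; rewrite /inbox negb_and -!ltNge -/r -/w => /orP[|//].
  rewrite (ger0_norm r0) => /lt_trans/(_ h).
  by rewrite -subr_lt0 -{2}[dy l.+1]mul1r -mulrBl addrK pmulr_rlt0 // ltNge (ltW (dy_gt0 _ _)).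
have Ar : A * r <= A * dy l.+1 by rewrite ler_pM2l // ltW.
rewrite distrC => /(le_trans (ler_dist_dist _ _)); rewrite ler_norml => /andP[_ h2].
by apply: le_trans dk _; lra.
Qed.

End Pair.

(** * Masses of boxes and strips *)

Section Mass.
Variable R : realType.
Local Notation P := (R * R)%type.
Local Notation dy := (@dyadic R).
Implicit Types (mu : seq (R * P)) (A B : pred P).

Lemma mass_ge0 mu A : (forall e, e \in mu -> 0 <= e.1) -> 0 <= mass mu A.
Proof. by move=> h; rewrite /mass big_seq sumr_ge0 // => e /h h'; rewrite mulr_ge0. Qed.

Lemma mass_le mu A B : (forall e, e \in mu -> 0 <= e.1) ->
  (forall e, e \in mu -> A e.2 -> B e.2) -> mass mu A <= mass mu B.
Proof.
move=> h AB; rewrite /mass big_seq [leRHS]big_seq; apply: ler_sum => e eM.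
apply: ler_wpM2l; first exact: h.
by case: (boolP (A e.2)) => a; rewrite ?ler0n // AB.
Qed.

Lemma mass_union mu A (n : nat) (B : nat -> pred P) : (forall e, e \in mu -> 0 <= e.1) ->
  (forall e, e \in mu -> A e.2 -> exists2 l, (l < n)%N & B l e.2) ->
  mass mu A <= \sum_(l < n) mass mu (B l).
Proof.
move=> h AB; rewrite /mass exchange_big /= big_seq [leRHS]big_seq.
apply: ler_sum => e eM; rewrite -mulr_sumr; apply: ler_wpM2l; first exact: h.
case: (boolP (A e.2)) => a; last by apply: sumr_ge0.
have [l ln Bl] := AB e eM a.
by rewrite (bigD1 (Ordinal ln)) //= Bl lerDl sumr_ge0.
Qed.

Lemma mass_total mu : mass mu predT = \sum_(e <- mu) e.1.
Proof. by apply: eq_bigr => e _; rewrite mulr1. Qed.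

Definition diam1 (X : P -> Prop) := forall p q, X p -> X q -> inbox p q 1.
Definition on (X : P -> Prop) mu := forall e, e \in mu -> X e.2.

Lemma total_le lam C N mu X : frostman lam C N mu -> on X mu -> diam1 X -> 0 <= C ->
  \sum_(e <- mu) e.1 <= C.
Proof.
move=> [h0 hf] hX hd C0; case: mu h0 hf hX => [|e mu] h0 hf hX; first by rewrite big_nil.
rewrite -mass_total -[C]mulr1; apply: le_trans (hf 0%N e.2 _) => //.
apply: mass_le => // e' e'M _; apply: hd; apply: hX => //; exact: mem_head.
Qed.

Lemma two_pow_ge (B : R) : exists c : nat, B * dy c <= 1.
Proof.
have B0 : 0 < `|B| + 1 by have := normr_ge0 B; lra.
have [c hc] := @dy_small R (`|B| + 1)^-1 ltac:(by rewrite invr_gt0).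
exists c; apply: (@le_trans _ _ ((`|B| + 1) * dy c)).
  by rewrite ler_wpM2r ?(ltW (dy_gt0 _ _)) //; have := ler_norm B; lra.
by rewrite -ler_pdivlMl // mulr1.
Qed.

(** Enlarging a box by [2 ^ c] moves it [c] levels up, at the cost of [lam ^- c]. On the first [c]
    levels the total mass, at most [C], is enough. *)
Lemma scale_box (lam C B : R) : 0 < lam -> lam <= 1 -> 0 <= C ->
  exists C', 0 <= C' /\ forall N mu X, frostman lam C N mu -> on X mu -> diam1 X ->
  forall l q, (l <= N)%N -> mass mu (fun p => inbox p q (B * dy l)) <= C' * lam ^+ l.
Proof.
move=> l0 l1 C0; have [c hc] := two_pow_ge B.
exists (C * lam ^- c); split; first by rewrite mulr_ge0 // invr_ge0 exprn_ge0 // ltW.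
move=> N mu X hf hX hd l q lN; have [h0 hm] := hf.
have [cl|lc] := leqP c l.
  apply: (@le_trans _ _ (mass mu (fun p => inbox p q (dy (l - c))))).
    apply: mass_le => // e _; apply: inbox_le.
    rewrite -{1}(subnK cl) dyD mulrA mulrAC -[leRHS]mul1r.
    by rewrite ler_wpM2r // ltW // dy_gt0.
  apply: (le_trans (hm _ _ (leq_trans (leq_subr _ _) lN))).
  rewrite -mulrA ler_wpM2l // -[in leRHS](subnK cl) exprD mulrCA mulVf ?mulr1 //.
  by rewrite expf_neq0 // gt_eqF.
apply: (@le_trans _ _ (mass mu predT)); first exact: mass_le.
rewrite mass_total; apply: (le_trans (total_le hf hX hd C0)).
rewrite -mulrA ler_peMr // mulrC ler_pdivlMr ?exprn_gt0 // mul1r.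
by rewrite ler_wiXn2l // ?ltW // ltnW.
Qed.

(* The strip around a curve meets O(2^m) boxes of side 2^-m. *)
Lemma strip_mass (lam C A B : R) : 0 < lam -> lam <= 1 -> 0 <= C -> 0 <= A -> 0 <= B ->
  exists K, 0 <= K /\ forall N mu X (w : P -> R), frostman lam C N mu -> on X mu -> diam1 X ->
  (forall p q, X p -> X q -> `|w p - w q - (p.2 - q.2)| <= A * `|p.1 - q.1|) ->
  forall m b, (m <= N)%N ->
    mass mu (fun p => `|w p - b| <= B * dy m) <= K * (2 * lam) ^+ m.
Proof.
move=> l0 l1 C0 A0 B0.
(* Two points of the strip in the same column of width [dy m] differ vertically by at most
   [(A + 2 * B) * dy m]. *)
have [C' [C'0 hC']] := @scale_box lam C (A + 2 * B + 1) l0 l1 C0.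
exists (3 * C'); split; first by positivity.
move=> N mu X w hf hX hd hw m b mN; have [h0 hm] := hf.
have K0 : 0 <= 3 * C' * (2 * lam) ^+ m by positivity.
case: mu hf hX h0 hm => [|e0 mu] hf hX h0 hm; first by rewrite /mass big_nil.
set mu' := e0 :: mu in hf hX h0 hm *.
have e0M : e0 \in mu' by exact: mem_head.
pose x0 := e0.2.1 - 1.
pose cell (l : nat) (p : P) := l%:R * dy m <= p.1 - x0 <= l.+1%:R * dy m.
pose S (p : P) := `|w p - b| <= B * dy m.
(* By [diam1] the abscissae lie in [[x0, x0 + 2]]; the extra column catches the right endpoint. *)
pose n := (2 * 2 ^ m + 1)%N.
have d0 := dy_gt0 R m.
have two : (2 ^ m)%:R * dy m = 1 :> R.
  by rewrite /dyadic natrX -exprMn divff ?expr1n // gt_eqF.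
have : mass mu' S <= \sum_(l < n) mass mu' (fun p => S p && cell l p).
  apply: (@mass_union mu' S n (fun l p => S p && cell l p)) => // e eM Se.
  have := hd _ _ (hX e eM) (hX e0 e0M); rewrite /inbox => /andP[+ _].
  rewrite ler_norml => /andP[y0 y1].
  have z0 : 0 <= (e.2.1 - x0) / dy m by rewrite divr_ge0 ?(ltW d0) // /x0; lra.
  exists (Num.truncn ((e.2.1 - x0) / dy m)).
    rewrite /n addn1 ltnS -(ler_nat R); apply: (@le_trans _ _ ((e.2.1 - x0) / dy m)); first by rewrite truncn_le.
    rewrite ler_pdivrMr // natrM -mulrA two /x0; lra.
  rewrite Se /= /cell; have /andP[t1 t2] := truncn_itv z0.
  by rewrite -ler_pdivlMr // t1 /= -ler_pdivrMr // ltW.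
move=> /le_trans; apply.
apply: (@le_trans _ _ (\sum_(l < n) C' * lam ^+ m)).
  apply: ler_sum => l _.
  have [/hasP[e eM /andP[Se ce]]|/hasPn no] := boolP (has (fun e => S e.2 && cell l e.2) mu').
    apply: le_trans (hC' N mu' X hf hX hd m e.2 mN).
    apply: mass_le => // e' e'M /andP[Se' ce'].
    move: ce ce'; rewrite /cell -natr1 => /andP[c1 c2] /andP[c3 c4].
    have n1 : `|e'.2.1 - e.2.1| <= dy m.
      by rewrite ler_norml; apply/andP; split; lra.
    have := hw _ _ (hX _ e'M) (hX _ eM).
    have An : A * `|e'.2.1 - e.2.1| <= A * dy m by rewrite ler_wpM2l.
    move: Se Se'; rewrite /S /inbox !ler_norml.
    move=> /andP[? ?] /andP[? ?] /andP[? ?]; apply/andP; split.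
      move: n1; rewrite ler_norml => /andP[? ?].
      have : 0 <= (A + 2 * B) * dy m by positivity.
      by move=> ?; apply/andP; split; lra.
    by apply/andP; split; lra.
  rewrite /mass big_seq big1 ?mulr_ge0 ?exprn_ge0 ?(ltW l0) // => e /no.
  by move/negPf => ->; rewrite mulr0.
rewrite sumr_const card_ord -[_ *+ n]mulr_natr exprMn.
have -> : 3 * C' * (2 ^+ m * lam ^+ m) = C' * lam ^+ m * (3 * 2 ^+ m) by ring.
rewrite ler_wpM2l ?mulr_ge0 ?exprn_ge0 ?(ltW l0) //.
rewrite /n natrD natrM natrX; have : 1 <= 2 ^+ m :> R by rewrite exprn_ege1 //; lra.
by lra.
Qed.

End Mass.

Section Haar.
Variable R : realType.
Local Notation P := (R * R)%type.
Local Notation dy := (@dyadic R).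
Implicit Types (mu : seq (R * P)).

Definition grid (M : nat) := ('I_M * 'I_(2 * M))%type.
Definition wt (M : nat) (t : grid M) : R := chi R M t.1 / M%:R / M%:R.
Definition ord2 (M : nat) (t : grid M) : R := (t.2 : nat)%:R / M%:R.

Definition haar mu (u : P -> R -> R) k v b : R :=
  \sum_(e <- mu) e.1 * eta (dy k.+1) (u e.2 v - b).
Definition avg mu (u : P -> R -> R) k v b : R :=
  (dy k)^-1 * mass mu (fun p => 0 < u p v - b <= dy k).

Lemma wt_ge0 M (t : grid M) : 0 <= wt t.
Proof.
have /andP[h _] := chi_bound R (ltnW (ltn_ord t.1)).
by apply: mulr_ge0; [apply: mulr_ge0 => // |]; rewrite invr_ge0.
Qed.

Lemma ind_itv (y c : R) : 0 < c -> (0 < y <= c)%R%:R = (0 < y)%R%:R - (c < y)%R%:R :> R.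
Proof.
move=> c0; have [h|h] := ltP c y; first by rewrite (lt_trans c0 h) /= subrr.
by rewrite andbT subr0.
Qed.

Lemma avg_haar mu u k v b : avg mu u k v b - avg mu u k.+1 v b = - (dy k)^-1 * haar mu u k v b.
Proof.
have d0 := dy_gt0 R k; have d1 := dy_gt0 R k.+1.
rewrite /avg (_ : (dy k.+1)^-1 = 2 * (dy k)^-1); last first.
  by rewrite dyS; field; rewrite gt_eqF.
rewrite /haar /mass !mulr_sumr -sumrB; apply: eq_bigr => e _.
rewrite /= !ind_itv // /eta (_ : 2 * dy k.+1 = dy k); first by ring.
by rewrite dyS; field.
Qed.

Lemma avg_ge0 mu u k v b : (forall e, e \in mu -> 0 <= e.1) -> 0 <= avg mu u k v b.
Proof. by move=> h; rewrite mulr_ge0 ?mass_ge0 // invr_ge0 ltW ?dy_gt0. Qed.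

Lemma gramE M k u (p q : P) : gram M k u p q =
  \sum_(t : grid M) wt t * (eta (dy k.+1) (u p (node R M t.1) - ord2 t) *
     eta (dy k.+1) (u q (node R M t.1) - ord2 t)).
Proof.
rewrite -(pair_bigA _ (fun i j => @wt M (i, j) * (eta (dy k.+1) (u p (node R M i) - @ord2 M (i, j)) *
     eta (dy k.+1) (u q (node R M i) - @ord2 M (i, j))))) /=.
rewrite /gram mulr_suml; apply: eq_bigr => i _.
rewrite mulr_suml mulr_sumr mulr_suml; apply: eq_bigr => j _.
by rewrite /wt /ord2 /=; ring.
Qed.

Lemma haar_gram M k u mu : \sum_(t : grid M) wt t * haar mu u k (node R M t.1) (ord2 t) ^+ 2 =
  \sum_(e <- mu) \sum_(f <- mu) e.1 * f.1 * gram M k u e.2 f.2.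
Proof.
under [RHS]eq_bigr do under eq_bigr do rewrite gramE mulr_sumr.
under [RHS]eq_bigr do rewrite exchange_big.
rewrite [RHS]exchange_big /=; apply: eq_bigr => t _.
rewrite expr2 /haar big_distrlr /= mulr_sumr; apply: eq_bigr => e _.
by rewrite mulr_sumr; apply: eq_bigr => f _; ring.
Qed.

Lemma geo_le (x : R) k : 1 < x -> \sum_(l < k.+1) x ^+ l <= x / (x - 1) * x ^+ k.
Proof.
move=> x1; have x0 : 0 < x - 1 by rewrite subr_gt0.
rewrite mulrAC ler_pdivlMr // -[leRHS]subr0 -exprS.
rewrite [leLHS]mulrC -subrX1; lra.
Qed.

(** Integrating [pair_bound] in one of the two points turns level [l] into
    [dy k ^+ 3 * (4 * lam) ^ l]. As [4 * lam > 1], the geometric sum is governed by [l = k], and [dy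
    k ^+ 3 * (4 * lam) ^ k = (lam / 2) ^ k]. *)
Theorem haar_l2 (lam C kap A : R) : 1 / 4 < lam -> lam < 1 -> 0 <= C ->
  0 < kap -> kap <= A ->
  exists K, 0 <= K /\ forall N mu X sg u k M, frostman lam C N mu -> on X mu -> diam1 X ->
    curves kap A sg X u -> sg = 1 \/ sg = -1 -> (0 < k <= N)%N -> (8 ^ k <= M)%N ->
    \sum_(t : grid M) wt t * haar mu u k (node R M t.1) (ord2 t) ^+ 2 <= K * (lam / 2) ^+ k.
Proof.
move=> l4 l1 C0 kap0 kapA; have l0 : 0 < lam by lra.
have [K [K0 hK]] := pair_bound kap0 kapA.
have [C' [C'0 hC']] := scale_box (A + 1) l0 (ltW l1) C0.
pose G := 4 * lam / (4 * lam - 1).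
have G0 : 0 <= G by rewrite /G divr_ge0 //; lra.
exists (C * (K * (C + C' * G))); split; first by positivity.
move=> N mu X sg u k M hf hX hd hc sgE /andP[k0 kN] kM.
have [h0 hm] := hf.
have W0 : 0 <= \sum_(e <- mu) e.1 by rewrite big_seq sumr_ge0.
have WC := total_le hf hX hd C0.
have d3 : 0 < dy k ^+ 3 by rewrite exprn_gt0 ?dy_gt0.
have lk0 : 0 <= (lam / 2) ^+ k by rewrite exprn_ge0 // divr_ge0 // ltW.
have d3l : dy k ^+ 3 <= (lam / 2) ^+ k.
  rewrite /dyadic -exprM mulnC exprM; apply: lerXn2r; rewrite ?nnegrE; [positivity|positivity|].
  by rewrite (_ : 2^-1 ^+ 3 = 8^-1 :> R); [lra|field].
have d3k : dy k ^+ 3 * (4 * lam) ^+ k = (lam / 2) ^+ k.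
  by rewrite /dyadic -exprM mulnC exprM -exprMn; congr (_ ^+ _); field.
rewrite haar_gram.
apply: (@le_trans _ _ (\sum_(e <- mu) e.1 * (K * (C + C' * G) * (lam / 2) ^+ k))); last first.
  by rewrite -mulr_suml -(mulrA C) ler_wpM2r //; positivity.
rewrite big_seq [leRHS]big_seq; apply: ler_sum => e eM.
apply: (@le_trans _ _ (e.1 * (\sum_(f <- mu) f.1 * `|gram M k u e.2 f.2|))).
  rewrite mulr_sumr big_seq [leRHS]big_seq; apply: ler_sum => f fM.
  rewrite -mulrA ler_wpM2l ?h0 // ler_wpM2l ?h0 //; exact: ler_norm.
rewrite ler_wpM2l ?h0 //.
apply: (@le_trans _ _ (\sum_(f <- mu) f.1 * (K * (dy k ^+ 3 +
     \sum_(l < k.+1) dy k ^+ 3 * 4 ^+ l * (inbox e.2 f.2 ((A + 1) * dy l))%:R)))).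
  rewrite big_seq [leRHS]big_seq; apply: ler_sum => f fM.
  by rewrite ler_wpM2l ?h0 //; apply: (hK sg X) => //; try exact: hX; apply: hd; exact: hX.
have -> : \sum_(f <- mu) f.1 * (K * (dy k ^+ 3 +
     \sum_(l < k.+1) dy k ^+ 3 * 4 ^+ l * (inbox e.2 f.2 ((A + 1) * dy l))%:R)) =
   K * (dy k ^+ 3 * (\sum_(f <- mu) f.1) + dy k ^+ 3 *
     \sum_(l < k.+1) 4 ^+ l * mass mu (fun p => inbox p e.2 ((A + 1) * dy l))).
  transitivity (\sum_(f <- mu) (K * dy k ^+ 3 * f.1 + K * dy k ^+ 3 *
      \sum_(l < k.+1) 4 ^+ l * (f.1 * (inbox f.2 e.2 ((A + 1) * dy l))%:R))).
    apply: eq_bigr => f _.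
    have -> : \sum_(l < k.+1) dy k ^+ 3 * 4 ^+ l * (inbox e.2 f.2 ((A + 1) * dy l))%:R =
        dy k ^+ 3 * \sum_(l < k.+1) 4 ^+ l * (inbox f.2 e.2 ((A + 1) * dy l))%:R.
      by rewrite mulr_sumr; apply: eq_bigr => l _; rewrite inboxC mulrA.
    have -> : \sum_(l < k.+1) 4 ^+ l * (f.1 * (inbox f.2 e.2 ((A + 1) * dy l))%:R) =
        f.1 * \sum_(l < k.+1) 4 ^+ l * (inbox f.2 e.2 ((A + 1) * dy l))%:R.
      by rewrite mulr_sumr; apply: eq_bigr => l _; rewrite mulrCA.
    by ring.
  rewrite big_split /= -!mulr_sumr exchange_big /=.
  rewrite (eq_bigr (fun l : 'I_k.+1 => 4 ^+ l * mass mu (fun p => inbox p e.2 ((A + 1) * dy l)))).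
    by ring.
  by move=> l _; rewrite /mass mulr_sumr.
rewrite -[leRHS]mulrA ler_wpM2l // [leRHS]mulrDl; apply: lerD.
  by rewrite mulrC ler_pM // ltW.
rewrite -d3k (mulrC (dy k ^+ 3) (_ ^+ k)) mulrA [leRHS]mulrC ler_wpM2l ?(ltW d3) //.
apply: (@le_trans _ _ (\sum_(l < k.+1) C' * (4 * lam) ^+ l)).
  apply: ler_sum => l _; rewrite exprMn mulrCA ler_wpM2l ?exprn_ge0 //.
  by apply: (hC' N mu X) => //; apply: leq_trans kN; rewrite -ltnS.
by rewrite -mulr_sumr -mulrA ler_wpM2l // geo_le //; lra.
Qed.

End Haar.

(** * Weighted Cauchy-Schwarz inequalities *)

Section Weighted.
Variables (R : realType) (T : finType) (c : T -> R).
Hypothesis c0 : forall t, 0 <= c t.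
Implicit Types f g : T -> R.

Definition nrm2 f : R := \sum_t c t * f t ^+ 2.

Lemma nrm2_ge0 f : 0 <= nrm2 f.
Proof. by apply: sumr_ge0 => t _; rewrite mulr_ge0 ?sqr_ge0. Qed.

Lemma cauchy_schwarz f g : \sum_t c t * (f t * g t) <= Num.sqrt (nrm2 f) * Num.sqrt (nrm2 g).
Proof.
rewrite -sqrtrM ?nrm2_ge0 //; set S := \sum_t _.
have [S0|S0] := leP S 0; first by apply: le_trans S0 (sqrtr_ge0 _).
rewrite -[S]gtr0_norm // -sqrtr_sqr ler_wsqrtr //.
have [g0|g0] := eqVneq (nrm2 g) 0.
  have gt t : c t * g t ^+ 2 = 0.
    move/eqP: g0; rewrite psumr_eq0; last by move=> *; rewrite mulr_ge0 ?sqr_ge0.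
    by move=> /allP/(_ t (mem_index_enum t))/eqP.
  suff : S = 0 by move=> SE; rewrite SE ltxx in S0.
  rewrite /S big1 // => t _; have /eqP := gt t; rewrite mulf_eq0 sqrf_eq0.
  by case/orP => /eqP ->; rewrite ?mul0r // !mulr0.
have gp : 0 < nrm2 g by rewrite lt_neqAle eq_sym g0 nrm2_ge0.
set x := S / nrm2 g.
have : 0 <= nrm2 (fun t => f t - x * g t) by exact: nrm2_ge0.
have -> : nrm2 (fun t => f t - x * g t) = nrm2 f - 2 * x * S + x ^+ 2 * nrm2 g.
  rewrite /nrm2 /S !mulr_sumr -sumrN -!big_split /=.
  by apply: eq_bigr => t _; ring.
have -> : nrm2 f - 2 * x * S + x ^+ 2 * nrm2 g = (nrm2 f * nrm2 g - S ^+ 2) / nrm2 g.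
  by rewrite /x; field; rewrite gt_eqF.
by rewrite pmulr_lge0 ?invr_gt0 // subr_ge0.
Qed.

Lemma nrm2_triangle f g : Num.sqrt (nrm2 (fun t => f t + g t)) <= Num.sqrt (nrm2 f) + Num.sqrt (nrm2 g).
Proof.
rewrite -[leRHS]ger0_norm ?addr_ge0 ?sqrtr_ge0 // -sqrtr_sqr ler_wsqrtr // sqrrD !sqr_sqrtr ?nrm2_ge0 //.
have -> : nrm2 (fun t => f t + g t) = nrm2 f + (\sum_t c t * (f t * g t)) *+ 2 + nrm2 g.
  rewrite /nrm2 -mulr_natl mulr_sumr -!big_split /=.
  by apply: eq_bigr => t _; ring.
by rewrite lerD2r lerD2l ler_wMn2r // cauchy_schwarz.
Qed.

Lemma nrm2Z a f : nrm2 (fun t => a * f t) = a ^+ 2 * nrm2 f.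
Proof. by rewrite /nrm2 mulr_sumr; apply: eq_bigr => t _; ring. Qed.

Lemma nrm2_abs f : nrm2 (fun t => `|f t|) = nrm2 f.
Proof. by apply: eq_bigr => t _; rewrite real_normK ?num_real. Qed.

Lemma triple_le f g h (B : R) : (forall t, `|g t| <= B) ->
  `|\sum_t c t * (f t * g t * h t)| <= B * (Num.sqrt (nrm2 f) * Num.sqrt (nrm2 h)).
Proof.
move=> gB; apply: (le_trans (ler_norm_sum _ _ _)).
have [t0 _|no] := pickP T; last first.
  rewrite big_pred0 // ; have -> : nrm2 f = 0 by rewrite /nrm2 big_pred0.
  by rewrite sqrtr0 mul0r mulr0.
have B0 : 0 <= B by apply: le_trans (gB t0).
rewrite -(nrm2_abs f) -(nrm2_abs h).
apply: (@le_trans _ _ (B * \sum_t c t * (`|f t| * `|h t|))); last first.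
  by rewrite ler_wpM2l // cauchy_schwarz.
rewrite mulr_sumr; apply: ler_sum => t _.
rewrite normrM (ger0_norm (c0 t)) !normrM [leRHS]mulrCA ler_wpM2l //.
by rewrite mulrAC mulrC ler_wpM2r ?mulr_ge0.
Qed.

End Weighted.

(** * The trilinear form *)

Section Chain.
Variable R : realType.
Local Notation P := (R * R)%type.
Local Notation dy := (@dyadic R).
Implicit Types (mu : seq (R * P)).

Definition good (lam C kap A : R) (N : nat) mu (X : P -> Prop) (sg : R) (u : P -> R -> R) :=
  [/\ frostman lam C N mu, on X mu, diam1 X, curves kap A sg X u & sg = 1 \/ sg = -1].

Definition avgt M mu (u : P -> R -> R) k (t : grid M) : R := avg mu u k (node R M t.1) (ord2 R t).
Definition haart M mu (u : P -> R -> R) k (t : grid M) : R := haar mu u k (node R M t.1) (ord2 R t).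

Definition triple M mu1 u1 mu2 u2 mu3 u3 k : R :=
  \sum_(t : grid M) wt R t * (avgt mu1 u1 k t * avgt mu2 u2 k t * avgt mu3 u3 k t).

Lemma avgt_step M mu u k (t : grid M) :
  avgt mu u k.+1 t = avgt mu u k t + (dy k)^-1 * haart mu u k t.
Proof. by have := avg_haar mu u k (node R M t.1) (ord2 R t); rewrite /avgt /haart; lra. Qed.

Lemma node_ord M (t : grid M) : 0 <= node R M t.1 <= 2.
Proof. by have /andP[-> /= h] := node_bound R (ltnW (ltn_ord t.1)); lra. Qed.

Lemma wt_sum M : \sum_(t : grid M) wt R t <= 2.
Proof.
case: M => [|M].
  rewrite big1 //= => -[[]] //.
apply: (@le_trans _ _ (\sum_(t : grid M.+1) (M.+1%:R^-1 / M.+1%:R))).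
  apply: ler_sum => t _; have /andP[h0 h1] := chi_bound R (ltnW (ltn_ord t.1)).
  rewrite /wt; apply: ler_wpM2r; first by rewrite invr_ge0.
  by rewrite -[leRHS]mul1r; apply: ler_wpM2r; rewrite ?invr_ge0.
rewrite sumr_const card_prod !card_ord -[_ *+ _]mulr_natr !natrM.
have m0 : M.+1%:R != 0 :> R by rewrite pnatr_eq0.
rewrite le_eqVlt; apply/orP; left; apply/eqP; move: (M.+1%:R) m0 => m m0.
by field.
Qed.

Section Consts.
Variables lam C kap A : R.
Hypotheses (l4 : 1 / 4 < lam) (l2 : lam < 1 / 2) (C0 : 0 <= C) (kap0 : 0 < kap) (kapA : kap <= A).

Let l0 : 0 < lam. Proof. by move: l4; lra. Qed.
Let A0 : 0 <= A. Proof. by apply: le_trans kapA; apply: ltW. Qed.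

Lemma avg_sup : exists K, 0 <= K /\ forall N mu X sg u, good lam C kap A N mu X sg u ->
  forall k v b, (k <= N)%N -> 0 <= v <= 2 -> avg mu u k v b <= K * (4 * lam) ^+ k.
Proof.
have L4 := l4; have L2 := l2.
have [K [K0 hK]] := @strip_mass R lam C A 1 l0 ltac:(lra) C0 A0 ltac:(lra).
exists K; split=> // N mu X sg u [hf hX hd hc _] k v b kN v2.
have d0 := dy_gt0 R k; have [h0 _] := hf.
rewrite /avg ler_pdivrMl //; apply: (@le_trans _ _ (K * (2 * lam) ^+ k)).
  have [_ H0 _ _] := hc.
  apply: le_trans (hK N mu X (fun p => u p v) hf hX hd _ k b kN); last first.
    by move=> p q Xp Xq; exact: H0.
  apply: mass_le => // e _ /andP[e0 e1].
  by rewrite mul1r gtr0_norm.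
rewrite le_eqVlt; apply/orP; left; apply/eqP.
rewrite mulrCA; congr (_ * _); rewrite /dyadic -exprMn; congr (_ ^+ _); by field.
Qed.

(** The factor [(dy k)^-1], once squared, turns the [(lam / 2) ^ k] of [haar_l2] into
    [4 ^ k * (lam / 2) ^ k = (2 * lam) ^ k]. *)
Definition rate : R := Num.sqrt (2 * lam).

Lemma rate_gt0 : 0 < rate. Proof. by have L4 := l4; rewrite sqrtr_gt0; lra. Qed.
Lemma rate_lt1 : rate < 1.
Proof. by have L2 := l2; rewrite /rate -[ltRHS]sqrtr1 ltr_sqrt //; lra. Qed.

Lemma haar_nrm : exists K, 0 <= K /\ forall N mu X sg u M k, good lam C kap A N mu X sg u ->
  (0 < k <= N)%N -> (8 ^ k <= M)%N ->
  Num.sqrt (nrm2 (@wt R M) (fun t => (dy k)^-1 * haart mu u k t)) <= K * rate ^+ k.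
Proof.
have L4 := l4; have L2 := l2.
have [K [K0 hK]] := haar_l2 l4 ltac:(lra) C0 kap0 kapA.
exists (Num.sqrt K); split; first exact: sqrtr_ge0.
move=> N mu X sg u M k [hf hX hd hc sgE] kN kM.
have d0 := dy_gt0 R k.
rewrite -[leRHS]ger0_norm; last by rewrite mulr_ge0 ?sqrtr_ge0 // exprn_ge0 // ltW // rate_gt0.
rewrite -sqrtr_sqr ler_wsqrtr // nrm2Z exprMn sqr_sqrtr // -exprM (mulnC k 2) exprM.
rewrite /rate sqr_sqrtr; last by lra.
have := hK N mu X sg u k M hf hX hd hc sgE kN kM.
rewrite (exprVn (dy k)) ler_pdivrMl ?(exprn_gt0 2 d0) // => /le_trans; apply.
rewrite le_eqVlt; apply/orP; left; apply/eqP.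
rewrite mulrCA; congr (_ * _); rewrite /dyadic -exprM mulnC exprM -exprMn; congr (_ ^+ _); by field.
Qed.

(** The increments are summable because [rate < 1], so the norm is bounded by telescoping from scale
    1, where the supremum bound suffices. *)
Lemma avg_nrm : exists K, 0 <= K /\ forall N mu X sg u M k, good lam C kap A N mu X sg u ->
  (0 < k <= N)%N -> (8 ^ N <= M)%N ->
  Num.sqrt (nrm2 (@wt R M) (avgt mu u k)) <= K.
Proof.
have L4 := l4; have L2 := l2.
have [K1 [K10 hK1]] := avg_sup; have [K2 [K20 hK2]] := haar_nrm.
have r0 := rate_gt0; have r1 := rate_lt1.
have q0 : 0 < 1 - rate by rewrite subr_gt0.
pose B := Num.sqrt (2 * (K1 * (4 * lam)) ^+ 2).
exists (B + K2 / (1 - rate)); split; first by rewrite addr_ge0 ?sqrtr_ge0 // divr_ge0 // ltW.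
move=> N mu X sg u M k hg /andP[k0 kN] NM.
suff : Num.sqrt (nrm2 (@wt R M) (avgt mu u k)) <= B + K2 * ((1 - rate ^+ k) / (1 - rate)).
  move=> /le_trans; apply; rewrite lerD2l ler_wpM2l // ler_pdivrMr // mulVf ?gt_eqF //.
  by have := exprn_ge0 k (ltW r0); lra.
elim: k k0 kN => // k IH _ kN.
have w0 := @wt_ge0 R M.
case: (posnP k) => [->|k0].
  apply: (@le_trans _ _ B); last first.
    rewrite lerDl mulr_ge0 // divr_ge0 ?(ltW q0) // expr1; exact: ltW.
  rewrite ler_wsqrtr // /nrm2; apply: (@le_trans _ _ (\sum_(t : grid M) wt R t * (K1 * (4 * lam)) ^+ 2)).
    apply: ler_sum => t _; rewrite ler_wpM2l // /avgt.
    have [[h0 _] _ _ _ _] := hg.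
    rewrite lerXn2r ?nnegrE ?avg_ge0 //; first by positivity.
    have := hK1 N mu X sg u hg 1%N (node R M t.1) (ord2 R t); rewrite expr1; apply => //.
      by apply: leq_trans kN.
    exact: node_ord.
  by rewrite -mulr_suml ler_wpM2r ?sqr_ge0 // wt_sum.
have := IH k0 (ltnW kN) => {}IH.
have kM : (8 ^ k <= M)%N by apply: leq_trans NM; rewrite leq_exp2l // ltnW.
have := hK2 N mu X sg u M k hg; rewrite k0 (ltnW kN) => /(_ isT kM) st.
have := nrm2_triangle w0 (avgt mu u k) (fun t => (dy k)^-1 * haart mu u k t).
have -> : nrm2 (@wt R M) (fun t => avgt mu u k t + (dy k)^-1 * haart mu u k t) =
  nrm2 (@wt R M) (avgt mu u k.+1).
  by apply: eq_bigr => t _; rewrite avgt_step.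
move=> /le_trans; apply; apply: (le_trans (lerD IH st)).
rewrite -addrA lerD2l -mulrDr ler_wpM2l // le_eqVlt; apply/orP; left; apply/eqP.
by rewrite exprS; field; rewrite gt_eqF.
Qed.

(** The three factors are moved to scale [k.+1] one at a time. Each of the resulting terms holds one
    increment, estimated by [haar_nrm], one average in the supremum norm and one in L^2. The ratio
    [4 * lam * rate] has square [32 * lam ^+ 3]. *)
Theorem triple_step : 32 * lam ^+ 3 < 1 ->
  exists K q, [/\ 0 <= K, 0 < q, q < 1 &
  forall N M mu1 X1 sg1 u1 mu2 X2 sg2 u2 mu3 X3 sg3 u3,
  good lam C kap A N mu1 X1 sg1 u1 -> good lam C kap A N mu2 X2 sg2 u2 ->
  good lam C kap A N mu3 X3 sg3 u3 -> (8 ^ N <= M)%N ->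
  forall k, (0 < k)%N -> (k < N)%N ->
  `|triple M mu1 u1 mu2 u2 mu3 u3 k.+1 - triple M mu1 u1 mu2 u2 mu3 u3 k| <= K * q ^+ k].
Proof.
have L4 := l4; have L2 := l2.
move=> l3.
have [K1 [K10 hK1]] := avg_sup; have [K2 [K20 hK2]] := haar_nrm.
have [K3 [K30 hK3]] := avg_nrm.
have r0 := rate_gt0; have r1 := rate_lt1.
exists (3 * (K1 * (4 * lam) * (K2 * K3))), (4 * lam * rate); split.
- by positivity.
- by rewrite !mulr_gt0 //; lra.
- rewrite -(@ltr_pXn2r _ 2) ?nnegrE ?mulr_ge0 ?(ltW l0) ?(ltW r0) // expr1n exprMn.
  by rewrite /rate sqr_sqrtr; [apply: le_lt_trans l3; rewrite le_eqVlt; apply/orP; left; apply/eqP; ring | lra].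
move=> N M mu1 X1 sg1 u1 mu2 X2 sg2 u2 mu3 X3 sg3 u3 g1 g2 g3 NM k k0 kN.
have kM : (8 ^ k <= M)%N by apply: leq_trans NM; rewrite leq_exp2l // ltnW.
have w0 := @wt_ge0 R M.
pose D mu u := fun t : grid M => (dy k)^-1 * haart mu u k t.
have q1 : 1 <= 4 * lam by lra.
have l40 : 0 <= 4 * lam by lra.
pose Y := K1 * (4 * lam) * (K2 * K3) * (4 * lam * rate) ^+ k.
have main mu X sg u mu' X' sg' u' mu'' X'' sg'' u'' j j' :
  good lam C kap A N mu X sg u -> good lam C kap A N mu' X' sg' u' ->
  good lam C kap A N mu'' X'' sg'' u'' -> (j <= k.+1)%N -> (0 < j' <= k.+1)%N ->
  `|\sum_t wt R t * (D mu u t * avgt mu' u' j t * avgt mu'' u'' j' t)| <= Y.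
  move=> gg gg' gg'' jk /andP[j0 jk'].
  have B (t : grid M) : `|avgt mu' u' j t| <= K1 * (4 * lam) ^+ k.+1 :> R.
    have [[h0 _] _ _ _ _] := gg'; rewrite /avgt ger0_norm ?avg_ge0 //.
    apply: (le_trans (hK1 N mu' X' sg' u' gg' j _ (ord2 R t) (leq_trans jk kN) (@node_ord M t))).
    by rewrite ler_wpM2l // ler_weXn2l.
  apply: (le_trans (triple_le w0 _ _ B)).
  have -> : Y = K1 * (4 * lam) ^+ k.+1 * (K2 * rate ^+ k * K3) by rewrite /Y exprMn exprS; ring.
  apply: ler_wpM2l; first by positivity.
  apply: ler_pM; rewrite ?sqrtr_ge0 //.
    by apply: (hK2 N mu X sg u) => //; rewrite k0 ltnW.
  by apply: (hK3 N mu'' X'' sg'' u'') => //; rewrite j0 (leq_trans jk' kN).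
have -> : triple M mu1 u1 mu2 u2 mu3 u3 k.+1 - triple M mu1 u1 mu2 u2 mu3 u3 k =
  (\sum_t wt R t * (D mu1 u1 t * avgt mu2 u2 k t * avgt mu3 u3 k t)) +
  (\sum_t wt R t * (D mu2 u2 t * avgt mu1 u1 k.+1 t * avgt mu3 u3 k t)) +
  (\sum_t wt R t * (D mu3 u3 t * avgt mu1 u1 k.+1 t * avgt mu2 u2 k.+1 t)).
  rewrite /triple -sumrB -!big_split /=; apply: eq_bigr => t _.
  rewrite !avgt_step /D; ring.
rewrite (_ : _ * _ ^+ k = Y + Y + Y); last by rewrite /Y; ring.
apply: (le_trans (ler_normD _ _)); apply: lerD.
    apply: (le_trans (ler_normD _ _)); apply: lerD.
      by apply: (main _ _ _ _ _ _ _ _ _ _ _ _ k k g1 g2 g3) => //; rewrite k0 leqnSn.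
    by apply: (main _ _ _ _ _ _ _ _ _ _ _ _ k.+1 k g2 g1 g3) => //; rewrite k0 leqnSn.
  by apply: (main _ _ _ _ _ _ _ _ _ _ _ _ k.+1 k.+1 g3 g1 g2); rewrite ?leqnn.
Qed.

End Consts.

Lemma telescope_pos (s : nat -> R) (K q c : R) (k0 m : nat) : 0 <= K -> 0 < q -> q < 1 ->
  (forall k, (k0 <= k < k0 + m)%N -> `|s k.+1 - s k| <= K * q ^+ k) ->
  c <= s k0 -> K * q ^+ k0 / (1 - q) < c -> 0 < s (k0 + m)%N.
Proof.
move=> K0 q0 q1 hs cs hc.
have q' : 0 < 1 - q by rewrite subr_gt0.
suff : s k0 - K * (q ^+ k0 - q ^+ (k0 + m)) / (1 - q) <= s (k0 + m)%N.
  have : 0 <= K * q ^+ (k0 + m) / (1 - q) by positivity.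
  rewrite mulrBr mulrBl; lra.
elim: m hs => [|m IH] hs; first by rewrite addn0 subrr mulr0 mul0r subr0.
have h1 : s k0 - K * (q ^+ k0 - q ^+ (k0 + m)) / (1 - q) <= s (k0 + m)%N.
  by apply: IH => k /andP[h1 h2]; apply: hs; rewrite h1 addnS ltnW.
have := hs (k0 + m)%N; rewrite leq_addr addnS ltnS leqnn => /(_ isT).
rewrite ler_norml => /andP[h2 _].
apply: (@le_trans _ _ (s (k0 + m)%N - K * q ^+ (k0 + m))); last by lra.
move: h1; set a := s k0; set b := s (k0 + m)%N => h1.
have -> : a - K * (q ^+ k0 - q ^+ (k0 + m).+1) / (1 - q) =
  (a - K * (q ^+ k0 - q ^+ (k0 + m)) / (1 - q)) - K * q ^+ (k0 + m).
  by rewrite exprS; field; rewrite gt_eqF.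
by rewrite lerD2r.
Qed.

End Chain.

(** * Frostman's lemma *)

Section Frostman.
Variable R : realType.
Local Notation P := (R * R)%type.
Local Notation dy := (@dyadic R).
Variable lam : R.
Hypothesis lam0 : 0 < lam.
Implicit Types (mu : seq (R * P)) (S : seq (nat * P)) (A B : set P).

Definition covers S A := forall p, A p -> exists2 e, e \in S & inbox p e.2 (dy e.1).
Definition cost S : R := \sum_(e <- S) lam ^+ e.1.
(* Positive dyadic content with gauge [lam ^ k] at side [2 ^- k], i.e. in dimension
   [- log2 lam]. *)
Definition pos_content A := exists2 h : R, 0 < h & forall S, covers S A -> h <= cost S.

Lemma cost_cat S S' : cost (S ++ S') = cost S + cost S'.
Proof. by rewrite /cost big_cat. Qed.

Lemma covers_cat S S' A B : covers S A -> covers S' B -> covers (S ++ S') (A `|` B).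
Proof.
by move=> h h' p [/h[e eS ne]|/h'[e eS ne]]; exists e; rewrite // mem_cat eS ?orbT.
Qed.

Lemma pos_content_sub A B : A `<=` B -> pos_content A -> pos_content B.
Proof. by move=> AB [h h0 H]; exists h => // S hS; apply: H => p /AB; exact: hS. Qed.

Lemma not_pos_content A : ~ pos_content A -> forall h : R, 0 < h -> exists2 S, covers S A & cost S < h.
Proof.
move=> nF h h0; apply: contrapT => H; apply: nF; exists h => // S hS.
by rewrite leNgt; apply/negP => c; apply: H; exists S.
Qed.

Lemma pos_content_set0 : ~ pos_content set0.
Proof. by case=> h h0 /(_ [::]) H; have := H ltac:(by []); rewrite /cost big_nil leNgt h0. Qed.

Lemma pos_content_setU A B : pos_content (A `|` B) -> pos_content A \/ pos_content B.
Proof.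
case=> h h0 H; apply: contrapT => /not_orP[nA nB].
have [S hS cS] := not_pos_content nA (divr_gt0 h0 (ltr0n R 2)).
have [S' hS' cS'] := not_pos_content nB (divr_gt0 h0 (ltr0n R 2)).
by have := H _ (covers_cat hS hS'); rewrite cost_cat; lra.
Qed.

Lemma pos_content_bigcup (I : eqType) (s : seq I) A (B : I -> set P) : pos_content A ->
  (forall p, A p -> exists2 i, i \in s & B i p) -> exists2 i, i \in s & pos_content (A `&` B i).
Proof.
elim: s A => [|i s IH] A FA AB.
  by exfalso; apply: pos_content_set0; apply: pos_content_sub FA => p /AB[].
have [FB|FB] := pselect (pos_content (A `&` B i)); first by exists i => //; exact: mem_head.
have /pos_content_setU[//|FC] : pos_content ((A `&` B i) `|` (A `&` ~` B i)) by rewrite -setIUr setUv setIT.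
have [j js Fj] : exists2 j, j \in s & pos_content ((A `&` ~` B i) `&` B j).
  apply: IH => // p [Ap nB]; have [j] := AB p Ap.
  by rewrite inE => /orP[/eqP->|js] Bj //; exists j.
exists j; first by rewrite inE js orbT.
by apply: pos_content_sub Fj => p [[Ap _] Bj].
Qed.

Definition idx (k : nat) (p : P) : int * int := (Num.floor (p.1 / dy k), Num.floor (p.2 / dy k)).

Lemma floor_dbl (y : R) (i : int) : (Num.floor y == i) = (Num.floor (2 * y) \in [:: 2 * i; 2 * i + 1]).
Proof.
rewrite !inE !floor_eq !rmorphD !rmorphM /=.
apply/idP/idP => [/andP[h1 h2]|/orP[]/andP[h1 h2]].
- have [h|h] := ltP (2 * y) (2 * i%:~R + 1).
    by apply/orP; left; apply/andP; split; lra.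
  by apply/orP; right; apply/andP; split; lra.
- by apply/andP; split; lra.
- by apply/andP; split; lra.
Qed.

Definition kids (c : int * int) : seq (int * int) :=
  [:: (2 * c.1, 2 * c.2); (2 * c.1, 2 * c.2 + 1); (2 * c.1 + 1, 2 * c.2); (2 * c.1 + 1, 2 * c.2 + 1)].

Lemma idx_kids k p c : (idx k p == c) = (idx k.+1 p \in kids c).
Proof.
have h (x : R) : x / dy k.+1 = 2 * (x / dy k).
  by rewrite dyS; field; rewrite gt_eqF // dy_gt0.
case: c => i j; rewrite /idx !h xpair_eqE !floor_dbl !inE !xpair_eqE /=.
by do 4!case: (_ == _).
Qed.

Lemma uniq_kids c : uniq (kids c).
Proof.
have n (x : int) : (x == x + 1) = false by apply/negbTE/eqP; lia.
have n' (x : int) : (x + 1 == x) = false by apply/negbTE/eqP; lia.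
by rewrite /= !inE !xpair_eqE !eqxx !n !n'.
Qed.

Lemma idx_mono k l p q : (k <= l)%N -> idx l p = idx l q -> idx k p = idx k q.
Proof.
move=> kl; rewrite -(subnK kl); elim: (l - k)%N => [|d IH] //.
rewrite addSn => h; apply: IH; apply/eqP; rewrite idx_kids h -idx_kids; exact: eqxx.
Qed.

(* Max-flow min-cut on the tree of dyadic cells: the mass of [mu] equals the cost of the
   cover [S]. *)
Definition flow A k d (cs : seq (int * int)) := exists mu S,
  [/\ forall e, e \in mu -> [/\ 0 <= e.1, A e.2 & idx k e.2 \in cs],
      \sum_(e <- mu) e.1 = cost S,
      covers S (A `&` [set p | idx k p \in cs]) &
      forall l c, (k <= l <= k + d)%N -> mass mu (fun p => idx l p == c) <= lam ^+ l].

(** Distinct cells of level [k] have no descendants in common, so each capacity constraint at a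
    level [l >= k] concerns only one of the flows. *)
Lemma flow_cat A k d cs : uniq cs -> (forall c, flow A k d [:: c]) -> flow A k d cs.
Proof.
move=> + H; elim: cs => [|c cs IH].
  exists [::], [::]; split=> //; first by rewrite /cost !big_nil.
    by move=> p [].
  by move=> l c _; rewrite /mass big_nil exprn_ge0 // ltW.
rewrite cons_uniq => /andP[ccs ucs]; have [mu [S [h1 h2 h3 h4]]] := IH ucs.
have [mu' [S' [h1' h2' h3' h4']]] := H c.
exists (mu' ++ mu), (S' ++ S); split.
- move=> e; rewrite mem_cat => /orP[/h1'|/h1] [e0 Ae ic]; split=> //.
    by rewrite mem_seq1 in ic; rewrite in_cons ic.
  by rewrite in_cons ic orbT.
- by rewrite cost_cat big_cat /= h2 h2'.
- move=> p [Ap /=]; rewrite in_cons => /orP[pc|pc].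
    have [|e eS ne] := h3' p; first by split=> //=; rewrite mem_seq1.
    by exists e; rewrite // mem_cat eS.
  by have [|e eS ne] := h3 p; [split | exists e; rewrite // mem_cat eS orbT].
- move=> l c' kl; rewrite /mass big_cat /=.
  have [/hasP[e emu /eqP ec]|/hasPn no] := boolP (has (fun e => idx l e.2 == c') mu').
    rewrite [X in _ + X]big_seq [X in _ + X]big1 ?addr0; first exact: h4'.
    move=> f fmu; case: eqP => [fc|]; last by rewrite mulr0.
    have [_ _] := h1 f fmu; have [_ _] := h1' e emu; rewrite mem_seq1 => /eqP ec'.
    have /andP[kl' _] := kl.
    by rewrite (@idx_mono k l f.2 e.2 kl') ?fc ?ec // ec' (negPf ccs).
  rewrite [X in X + _]big_seq [X in X + _]big1 ?add0r; first exact: h4.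
  by move=> f /no/negPf ->; rewrite mulr0.
Qed.

(** Induction on the depth [d] below the cell. A leaf meeting [A] gets mass [lam ^ k] at one of its
    points and is covered by one box. At an inner cell the flows of the four children are joined. If
    their total exceeds the capacity [lam ^ k], the flow is scaled down to it and the cover is
    replaced by one box around the cell. Either way mass and cost agree. *)
Lemma flow_cell A d k c : flow A k d [:: c].
Proof.
have l0 n : 0 <= lam ^+ n by rewrite exprn_ge0 // ltW.
elim: d k c => [|d IH] k c.
  have [[p [Ap pc]]|no] := pselect (exists p, A p /\ idx k p = c).
    exists [:: (lam ^+ k, p)], [:: (k, p)]; split.
    - by move=> e; rewrite mem_seq1 => /eqP ->; rewrite mem_seq1 /= pc.
    - by rewrite /cost !big_seq1.
    - move=> q [Aq /=]; rewrite mem_seq1 => /eqP qc; exists (k, p); first exact: mem_head.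
      have d0 := dy_gt0 R k.
      have E (x y : R) : Num.floor (x / dy k) = Num.floor (y / dy k) -> `|x - y| <= dy k.
        move=> E; have := floor_itv (x / dy k); have := floor_itv (y / dy k).
        rewrite E rmorphD /= !ler_pdivlMr // !ltr_pdivrMr //.
        by rewrite ler_norml => /andP[? ?] /andP[? ?]; apply/andP; split; lra.
      by rewrite -pc in qc; case: qc => e1 e2; rewrite /inbox !E.
    - move=> l c'; rewrite addn0 -eqn_leq => /eqP <-.
      by rewrite /mass big_seq1 /=; case: (_ == _); rewrite ?mulr1 ?mulr0.
  exists [::], [::]; split=> //; first by rewrite /cost !big_nil.
    by move=> p [Ap /=]; rewrite mem_seq1 => /eqP pc; case: no; exists p.
  by move=> l c' _; rewrite /mass big_nil.
have [mu [S [h1 h2 h3 h4]]] := flow_cat (uniq_kids c) (IH k.+1).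
have kid p : (idx k p \in [:: c]) = (idx k.+1 p \in kids c) by rewrite mem_seq1 idx_kids.
have tot l c' : mass mu (fun p => idx l p == c') <= \sum_(e <- mu) e.1.
  rewrite -mass_total; apply: mass_le => // e /h1[] //.
have [le|gt] := leP (\sum_(e <- mu) e.1) (lam ^+ k).
  exists mu, S; split=> //.
  - by move=> e /h1[e0 Ae ek]; rewrite kid.
  - by move=> p [Ap /=]; rewrite kid => pk; apply: h3.
  - move=> l c' /andP[kl ld]; have [kE|kl'] := eqVneq k l.
      by rewrite -kE; apply: le_trans le; exact: tot.
    by apply: h4; rewrite addSnnS ld andbT ltn_neqAle kl' kl.
set T := \sum_(e <- mu) e.1 in tot gt.
have T0 : 0 < T by apply: le_lt_trans gt.
pose x := lam ^+ k / T.
have x0 : 0 <= x by rewrite /x divr_ge0 // ltW.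
have x1 : x <= 1 by rewrite /x ler_pdivrMr // mul1r ltW.
pose mu' := [seq (x * e.1, e.2) | e <- mu].
have mE Q : mass mu' Q = x * mass mu Q.
  by rewrite /mass big_map mulr_sumr; apply: eq_bigr => e _; rewrite mulrA.
(* The new cover is the box centred at the lower left corner of the cell [c]. *)
exists mu', [:: (k, (c.1%:~R * dy k, c.2%:~R * dy k))]; split.
- move=> e /mapP[f /h1[f0 Af fk] ->] /=; split=> //; first by rewrite mulr_ge0.
  by rewrite kid.
- by rewrite /cost big_seq1 /= big_map -mulr_sumr /x -/T divfK // gt_eqF.
- move=> p [Ap /=]; rewrite mem_seq1 => /eqP pc; exists (k, (c.1%:~R * dy k, c.2%:~R * dy k)).
    exact: mem_head.
  have d0 := dy_gt0 R k.
  have E (y : R) : `|y - (Num.floor (y / dy k))%:~R * dy k| <= dy k.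
    have := floor_itv (y / dy k); rewrite rmorphD /= ler_pdivlMr // ltr_pdivrMr //.
    by rewrite ler_norml => /andP[? ?]; apply/andP; split; lra.
  by rewrite -pc /inbox !E.
- move=> l c' /andP[kl ld]; rewrite mE; have [kE|kl'] := eqVneq k l.
    rewrite -kE; apply: (@le_trans _ _ (x * T)); first by rewrite ler_wpM2l.
    by rewrite /x divfK // gt_eqF.
  apply: (@le_trans _ _ (1 * lam ^+ l)); last by rewrite mul1r.
  apply: ler_pM => //; first by apply: mass_ge0 => e /h1[].
  by apply: h4; rewrite addSnnS ld andbT ltn_neqAle kl' kl.
Qed.

Lemma inbox_idx k p q : inbox p q (dy k) -> exists i j : nat,
  [/\ (i < 3)%N, (j < 3)%N & idx k p = ((idx k q).1 - 1 + i%:Z, (idx k q).2 - 1 + j%:Z)].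
Proof.
clear lam0; have d0 := dy_gt0 R k.
have h (x y : R) : `|x - y| <= dy k -> exists2 i : nat, (i < 3)%N &
    Num.floor (x / dy k) = Num.floor (y / dy k) - 1 + i%:Z.
  move=> xy; have : `|x / dy k - y / dy k| <= 1.
    by rewrite -mulrBl normrM normfV (gtr0_norm d0) ler_pdivrMr // mul1r.
  rewrite ler_norml; set u := x / dy k; set v := y / dy k => /andP[h1 h2].
  have := floor_itv v; set f := Num.floor v => /andP[f1 f2].
  have : f - 1 <= Num.floor u by rewrite floor_ge_int rmorphB /=; lra.
  have : Num.floor u < f + 2 by rewrite floor_lt_int !rmorphD /= in f2 *; lra.
  move=> g2 g1; by exists (absz (Num.floor u - (f - 1))%R); lia.
by case/andP => /h[i i3 hi] /h[j j3 hj]; exists i, j; split=> //; rewrite /idx hi hj.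
Qed.

(** A box of radius [dy k] meets at most nine cells of level [k]. The flow, whose total is the cost
    of a cover and hence at least [h], is scaled down to total mass exactly [h], so that the mass
    does not depend on [N]. *)
Lemma Frostman A c : pos_content A -> (forall p, A p -> idx 0 p = c) ->
  exists2 h : R, 0 < h & forall N, exists mu,
    [/\ frostman lam 9 N mu, on A mu & \sum_(e <- mu) e.1 = h].
Proof.
case=> h h0 HA Ac; exists h => // N.
have [mu [S [h1 h2 h3 h4]]] := flow_cell A N 0 c.
have hT : h <= \sum_(e <- mu) e.1.
  rewrite h2; apply: HA => p Ap; apply: h3; split=> //=.
  by rewrite mem_seq1 (Ac _ Ap).
set T := \sum_(e <- mu) e.1 in hT.
have T0 : 0 < T by apply: lt_le_trans hT.
pose x := h / T.
have x0 : 0 <= x by rewrite /x divr_ge0 // ltW.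
have x1 : x <= 1 by rewrite /x ler_pdivrMr // mul1r.
pose mu' := [seq (x * e.1, e.2) | e <- mu].
have mE Q : mass mu' Q = x * mass mu Q.
  by rewrite /mass big_map mulr_sumr; apply: eq_bigr => e _; rewrite mulrA.
exists mu'; split.
- split; first by move=> e /mapP[f /h1[f0 _ _] ->]; rewrite mulr_ge0.
  move=> k q kN; rewrite mE.
  apply: (@le_trans _ _ (1 * (9 * lam ^+ k))); last by rewrite mul1r.
  apply: ler_pM => //; first by apply: mass_ge0 => e /h1[].
  apply: (@le_trans _ _ (\sum_(l < 9) mass mu (fun p => idx k p ==
      ((idx k q).1 - 1 + (l %/ 3)%N%:Z, (idx k q).2 - 1 + (l %% 3)%N%:Z)))).
    apply: (@mass_union R mu (fun p => inbox p q (dy k)) 9 (fun l p => idx k p ==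
      ((idx k q).1 - 1 + (l %/ 3)%N%:Z, (idx k q).2 - 1 + (l %% 3)%N%:Z))).
      by move=> e /h1[].
    move=> e _ /inbox_idx[i [j [i3 j3 ->]]]; exists (i * 3 + j)%N; first by lia.
    by rewrite divnMDl // divn_small // addn0 modnMDl modn_small.
  rewrite mulr_natl -[X in _ *+ X]card_ord -sumr_const; apply: ler_sum => l _.
  by apply: h4; rewrite add0n.
- by move=> e /mapP[f /h1[_ Af _] ->].
- by rewrite big_map -mulr_sumr /x -/T divfK // gt_eqF.
Qed.

End Frostman.

(** * Points of positive local content *)

Section Thick.
Variable R : realType.
Local Notation P := (R * R)%type.
Local Notation dy := (@dyadic R).
Variable lam : R.
Hypothesis lam0 : 0 < lam.
Hypothesis lam1 : lam < 1 / 2.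
Implicit Types (A B E : set P).
Local Notation pos_content := (pos_content lam).

(** These points play the part of the support of a Frostman measure, without fixing a measure. *)
Definition thick A x := forall r : R, 0 < r -> pos_content (A `&` [set p | inbox p x r]).

Lemma inbox_nbhs (x : P) (r : R) : 0 < r -> nbhs x [set p : P | inbox p x r].
Proof.
move=> r0; exists ([set a : R | `|a - x.1| <= r], [set a : R | `|a - x.2| <= r]) => /=.
  split; apply/nbhs_ballP; exists r => //= y; rewrite /ball /= distrC => /ltW //.
by move=> p [h1 h2] /=; rewrite /inbox h1 h2.
Qed.

Lemma compact_cluster (E : set P) (F : set (set P)) : compact E ->
  F setT -> (forall A B, F A -> F B -> F (A `&` B)) -> (forall A B, A `<=` B -> F A -> F B) ->
  ~ F set0 -> F E ->
  exists x, E x /\ forall r B, 0 < r -> F B -> exists p, B p /\ inbox p x r.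
Proof.
move=> cE FT FI FS F0 FE.
have Ff : Filter F by split.
have Pf : ProperFilter F by split.
have [x [Ex cx]] := cE F Pf FE; exists x; split=> // r B r0 FB.
by have [p [Bp xp]] := cx B _ FB (inbox_nbhs x r0); exists p.
Qed.

(** By subadditivity, the sets that contain [A] up to a part without positive content form a proper
    filter. Any of its cluster points is thick. *)
Lemma thick_exists A E : compact E -> A `<=` E -> pos_content A -> exists x, E x /\ thick A x.
Proof.
move=> cE AE FA.
have [|||||x [Ex hx]] := @compact_cluster E (fun B => ~ pos_content (A `\` B)) cE.
- by rewrite setDT; exact: pos_content_set0.
- by move=> B C nB nC; rewrite setDIr => /pos_content_setU [].
- by move=> B C BC nB FC; apply: nB; apply: pos_content_sub FC => p [Ap nC]; split=> // /BC.
- by rewrite setD0; apply.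
- by rewrite (_ : A `\` E = set0); [exact: pos_content_set0|apply/seteqP; split=> p // [/AE]].
exists x; split=> // r r0; apply: contrapT => nF.
have [|p [np xp]] := hx r (~` [set p | inbox p x r]) r0; last exact: np.
by rewrite setDE setCK.
Qed.

Lemma thick_sub A B x : A `<=` B -> thick A x -> thick B x.
Proof. by move=> AB h r /h; apply: pos_content_sub => p [/AB]. Qed.

Lemma pow_small (x e : R) : 0 <= x -> x < 1 -> 0 < e -> exists m, forall n, (m <= n)%N -> x ^+ n < e.
Proof.
clear lam0 lam1.
move=> x0 x1 e0; have := @cvg_expr R x; rewrite ger0_norm // => /(_ x1) /cvgr0_norm_lt /(_ _ e0).
case=> m _ hm; exists m => n /hm /=; rewrite ger0_norm // exprn_ge0 //.
Qed.

(* A strip of width 2^-m around a Lipschitz curve has covering cost O((2 lam)^m). *)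
Lemma pos_content_off_curve A (g : R -> P) (L B : R) : 0 <= L -> 0 <= B ->
  (forall s t, inbox (g s) (g t) (L * `|s - t|)) -> pos_content A ->
  exists m, pos_content (A `&` [set p | forall s, `|s| <= B -> ~ inbox p (g s) (dy m)]).
Proof.
have L0 := lam0; have L1 := lam1.
move=> Lip0 B0 gL [h h0 hA].
have [c hc] := two_pow_ge (L + 1).
(* At most [(2 * B + 1) * 2 ^ m] boxes are spaced by [dy m] along the curve. They are taken of level
   [m - c], to absorb the Lipschitz factor, so each costs [lam ^- c * lam ^ m]. *)
pose K := (2 * B + 1) * lam ^- c.
have K0 : 0 < K by rewrite mulr_gt0 ?invr_gt0 ?exprn_gt0 //; lra.
have [m0 hm0] := @pow_small (2 * lam) (h / 2 / K) ltac:(lra) ltac:(lra) ltac:(by apply: divr_gt0 => //; apply: divr_gt0).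
pose m := (m0 + c)%N.
have hK : K * (2 * lam) ^+ m < h / 2.
  by rewrite mulrC -ltr_pdivlMr // hm0 // leq_addr.
(* Were the remainder without positive content, it would have a cover of cost below [h / 2]; with
   the boxes along the curve, [A] would have one of cost below [h]. *)
exists m; apply: contrapT => nF.
have [S1 cS1 hS1] := not_pos_content nF (divr_gt0 h0 (ltr0n R 2)).
have d0 := dy_gt0 R m.
pose n := (Num.truncn (2 * B / dy m)).+1.
pose S2 := [seq ((m - c)%N, g (- B + l%:R * dy m)) | l <- iota 0 n].
have cov : covers (S1 ++ S2) A.
  move=> p Ap.
  have [[s [sB ps]]|no] := pselect (exists s, `|s| <= B /\ inbox p (g s) (dy m)); last first.
    have [|e e1 e2] := cS1 p; first by split=> // s sB ps; apply: no; exists s.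
    by exists e; rewrite // mem_cat e1.
  move: sB; rewrite ler_norml => /andP[s1 s2].
  have z0 : 0 <= (s + B) / dy m by rewrite divr_ge0 ?(ltW d0) //; lra.
  pose l := Num.truncn ((s + B) / dy m).
  exists ((m - c)%N, g (- B + l%:R * dy m)).
    rewrite mem_cat; apply/orP; right; apply: map_f; rewrite mem_iota /= add0n ltnS.
    by apply: le_truncn; rewrite ler_pM2r ?invr_gt0 //; lra.
  have /andP[l1 l2] := truncn_itv z0; rewrite -/l in l1 l2.
  rewrite ler_pdivlMr // in l1; rewrite ltr_pdivrMr // -natr1 in l2.
  have sl : `|s - (- B + l%:R * dy m)| <= dy m.
    by rewrite ler_norml; apply/andP; split; lra.
  have dmc : (L + 1) * dy m <= dy (m - c).
    rewrite /m addnK dyD mulrCA -[leRHS]mulr1 ler_pM2l ?dy_gt0 //.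
  have := gL s (- B + l%:R * dy m); have Ll : L * `|s - (- B + l%:R * dy m)| <= L * dy m by rewrite ler_wpM2l.
  move: ps; rewrite /inbox /= => /andP[p1 p2] /andP[q1 q2].
  apply/andP; split; apply: le_trans dmc.
    by apply: (le_trans (ler_distD (g s).1 _ _)); lra.
  by apply: (le_trans (ler_distD (g s).2 _ _)); lra.
have := hA _ cov; rewrite cost_cat leNgt => /negP; apply.
suff : cost lam S2 <= K * (2 * lam) ^+ m by lra.
rewrite /cost /S2 big_map (eq_bigr (fun=> lam ^+ (m - c))) //.
rewrite -[iota 0 n]/(index_iota 0 n) sumr_const_nat subn0.
rewrite -[_ *+ n]mulr_natl exprMn /K.
rewrite (_ : (2 * B + 1) * lam ^- c * (2 ^+ m * lam ^+ m) =
  (2 * B + 1) * 2 ^+ m * lam ^+ (m - c)); last first.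
  by rewrite /m addnK [lam ^+ (_ + c)]exprD; field; rewrite expf_neq0 // gt_eqF.
rewrite ler_pM2r ?exprn_gt0 // /n -natr1.
have two : 2 ^+ m * dy m = 1 :> R by rewrite /dyadic -exprMn divff ?expr1n // gt_eqF.
have : (Num.truncn (2 * B / dy m))%:R <= 2 * B / dy m.
  by rewrite truncn_le divr_ge0 ?(ltW d0) //; lra.
have -> : (dy m)^-1 = 2 ^+ m.
  by apply: (mulIf (lt0r_neq0 d0)); rewrite two mulVf // gt_eqF.
have : 1 <= 2 ^+ m :> R by rewrite exprn_ege1 //; lra.
lra.
Qed.

Lemma thick_off_curve E (g : R -> P) (L B : R) : compact E -> pos_content E -> 0 <= L -> 0 <= B ->
  (forall s t, inbox (g s) (g t) (L * `|s - t|)) ->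
  exists x, [/\ E x, thick E x & forall s, `|s| <= B -> g s <> x].
Proof.
move=> cE FE Lip0 B0 gL; have [m Fm] := pos_content_off_curve Lip0 B0 gL FE.
have [x [Ex tx]] := thick_exists cE (@subIsetl _ _ _) Fm.
exists x; split=> //; first by apply: thick_sub tx; exact: subIsetl.
move=> s sB gx; apply: (@pos_content_set0 R lam); apply: pos_content_sub (tx _ (dy_gt0 R m)) => p [[_ /(_ s sB)]].
by rewrite gx.
Qed.

Lemma compact_box E : compact E -> exists2 B : R, 0 <= B & forall p, E p -> `|p.1| <= B /\ `|p.2| <= B.
Proof.
clear lam0 lam1.
move=> cE; apply: contrapT => no.
have [|||||x [Ex hx]] := @compact_cluster E (fun A => exists2 B : R, 0 <= B &
    forall p, E p -> ~ (`|p.1| <= B /\ `|p.2| <= B) -> A p) cE.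
- by exists 0.
- move=> A C [B B0 hB] [B' B'0 hB']; exists (Num.max B B'); first by rewrite le_max B0.
  move=> p Ep np; split; [apply: hB|apply: hB'] => //; apply: (contra_not _ np) => -[h1 h2];
    by rewrite !le_max h1 h2 ?orbT.
- by move=> A C subAC [B B0 hB]; exists B => // p Ep np; apply: subAC; apply: hB.
- case=> B B0 hB; apply: no; exists B => // p Ep; apply: contrapT => /(hB p Ep) [].
- by exists 0.
have [|p [np /andP[p1 p2]]] := hx 1 [set p | ~ (`|p.1| <= `|x.1| + `|x.2| + 1 /\ `|p.2| <= `|x.1| + `|x.2| + 1)] ltr01.
  by exists (`|x.1| + `|x.2| + 1) => //; have := normr_ge0 x.1; have := normr_ge0 x.2; lra.
have h1 := ler_normD (p.1 - x.1) x.1; have h2 := ler_normD (p.2 - x.2) x.2.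
rewrite !subrK in h1 h2; have n1 := normr_ge0 x.1; have n2 := normr_ge0 x.2.
by apply: np; split; lra.
Qed.

(** After any thick [z], a thick [y] is taken off the vertical line through [z], then a thick [x]
    off the line through [z] and [y], which is now the graph of a Lipschitz function of the
    abscissa. Only bounded pieces of these lines matter as [E] is bounded. *)
Theorem thick_triangle E : compact E -> pos_content E -> exists x y z,
  [/\ E x, E y & E z] /\ [/\ thick E x, thick E y & thick E z] /\
  det2 (psub x z) (psub y z) != 0.
Proof.
move=> cE FE; have [B B0 hB] := compact_box cE.
have [z [Ez tz]] := thick_exists cE (@subset_refl _ _) FE.
have [|y [Ey ty hy]] := @thick_off_curve E (fun s => (z.1, s)) 1 B cE FE ltac:(lra) B0.
  by move=> s t; rewrite /inbox /= subrr normr0 mul1r normr_ge0 lexx.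
have yz : y.1 - z.1 != 0.
  rewrite subr_eq0; apply/eqP => yz; apply: (hy y.2); first by have [] := hB y Ey.
  by rewrite -yz; case: (y).
pose al := (y.2 - z.2) / (y.1 - z.1).
have [|x [Ex tx hx]] := @thick_off_curve E (fun s => (s, z.2 + al * (s - z.1))) (`|al| + 1) B cE FE ltac:(by have := normr_ge0 al; lra) B0.
  move=> s t; rewrite /inbox /=; apply/andP; split.
    by rewrite ler_peMl //; have := normr_ge0 al; lra.
  rewrite (_ : z.2 + al * (s - z.1) - (z.2 + al * (t - z.1)) = al * (s - t)); last ring.
  by rewrite normrM ler_wpM2r //; lra.
exists x, y, z; split=> //; split=> //.
apply/negP => /eqP; rewrite /det2 /psub /= => h.
apply: (hx x.1); first by have [] := hB x Ex.
apply/eqP; rewrite [X in _ == X]surjective_pairing xpair_eqE eqxx /=.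
rewrite /al -subr_eq0 -(mulIr_eq0 _ (mulIf yz)); apply/eqP.
rewrite -[RHS]h; by field.
Qed.

End Thick.

(** * From Hausdorff dimension to dyadic content *)

Section HausdorffDim.
Variable R : realType.
Local Notation P := (R * R)%type.
Local Notation dy := (@dyadic R).

Lemma edist_le (x y : P) (r : R) : 0 <= r -> `|x.1 - y.1| <= r -> `|x.2 - y.2| <= r ->
  Defs.edist x y <= 2 * r.
Proof.
move=> r0 h1 h2; rewrite /Defs.edist -[leRHS]ger0_norm ?mulr_ge0 // -sqrtr_sqr ler_wsqrtr //.
have : (x.1 - y.1) ^+ 2 <= r ^+ 2 by rewrite -real_normK ?num_real // lerXn2r ?nnegrE.
have : (x.2 - y.2) ^+ 2 <= r ^+ 2 by rewrite -real_normK ?num_real // lerXn2r ?nnegrE.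
rewrite exprMn; have := sqr_ge0 r; lra.
Qed.

Lemma diam_inbox (c : P) (r : R) : 0 <= r ->
  (diam [set p | inbox p c r] <= (4 * r)%:E)%E.
Proof.
move=> r0; apply: ge_ereal_sup => _ [->|[x /andP[x1 x2] [y /andP[y1 y2] <-]]].
  by rewrite lee_fin mulr_ge0.
rewrite lee_fin (_ : 4 * r = 2 * (2 * r)); last by ring.
apply: edist_le; rewrite ?mulr_ge0 //.
  by apply: (le_trans (ler_distD c.1 _ _)); rewrite (distrC c.1); lra.
by apply: (le_trans (ler_distD c.2 _ _)); rewrite (distrC c.2); lra.
Qed.

Lemma diam_ge0 (A : set P) : (0 <= diam A)%E.
Proof. by apply: ereal_sup_ubound; left. Qed.

Lemma diam_set0 : diam (@set0 P) = 0%E.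
Proof.
apply/eqP; rewrite eq_le diam_ge0 andbT; apply: ge_ereal_sup => _ [->//|[x []]].
Qed.

Lemma fine_diam_le (A : set P) (r : R) : (diam A <= r%:E)%E -> 0 <= fine (diam A) <= r.
Proof.
move=> h; have fd : diam A \is a fin_num.
  by rewrite ge0_fin_numE ?diam_ge0 // (le_lt_trans h) // ltry.
by rewrite fine_ge0 ?diam_ge0 //= -lee_fin fineK.
Qed.

(** Positivity of the measure gives a [d] at which [hausdorff_approx] is positive. A cover using a
    box of level below [n0] costs at least [lam ^ n0]. All other covers have diameters at most
    [4 * dy k <= d], and [(4 * dy k) ^ s = 4 ^ s * lam ^ k] compares their cost with
    [hausdorff_approx s d E]. *)
Lemma hausdorff_pos_content (s : R) (E : set P) : 0 < s -> hausdorff_measure s E <> 0%E ->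
  pos_content (2 `^ (- s)) E.
Proof.
move=> s0 Hs; set lam := 2 `^ (- s).
have lam0 : 0 < lam by rewrite powR_gt0.
have lam1 : lam <= 1.
  by rewrite -(powRr0 2) ler_powR //; lra.
have pos d : (0 <= hausdorff_approx s d E)%E.
  apply: le_ereal_inf_tmp => _ [F _ <-]; apply: nneseries_ge0 => i _ _.
  by rewrite lee_fin powR_ge0.
have [d d0 Hd] : exists2 d : R, 0 < d & (0 < hausdorff_approx s d E)%E.
  apply: contrapT => no; apply: Hs; apply/eqP; rewrite eq_le; apply/andP; split.
    apply: ge_ereal_sup => _ [d d0 <-]; rewrite leNgt; apply/negP => h; apply: no.
    by exists d.
  apply: le_ereal_sup_tmp; exists (hausdorff_approx s 1 E) => //.
  by exists 1 => //=; exact: ltr01.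
have [h h0 hH] : exists2 h : R, 0 < h & (h%:E <= hausdorff_approx s d E)%E.
  move: Hd; case: (hausdorff_approx s d E) => [r||] //; last by exists 1 => //; rewrite leey.
  by rewrite lte_fin => r0; exists r.
have [n0 hn0] := @dy_small R (d / 4) ltac:(by rewrite divr_gt0).
have l4 : 0 < 4 `^ s by rewrite powR_gt0.
exists (Num.min (lam ^+ n0) (h / 4 `^ s)); first by rewrite lt_min exprn_gt0 // divr_gt0.
move=> S cS; have [/hasP[e eS en]|/hasPn low] := boolP (has (fun e => (e.1 < n0)%N) S).
  apply: le_trans (_ : lam ^+ n0 <= _); first by rewrite ge_min lexx.
  apply: (@le_trans _ _ (lam ^+ e.1)).
    by rewrite ler_wiXn2l // ?ltW // ltnW.
  rewrite /cost (big_rem e) //= lerDl; apply: sumr_ge0 => f _; exact: exprn_ge0 (ltW _).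
apply: le_trans (_ : h / 4 `^ s <= _); first by rewrite ge_min lexx orbT.
rewrite ler_pdivrMr // -lee_fin; apply: (le_trans hH).
pose e0 : nat * P := (0%N, (0, 0)).
(* The finite cover is padded with empty sets; these contribute nothing because their diameter is 0
   and [s] is positive. *)
pose F i := if (i < size S)%N then [set p | inbox p (nth e0 S i).2 (dy (nth e0 S i).1)] else set0.
have Fd i : (i < size S)%N -> (diam (F i) <= (4 * dy (nth e0 S i).1)%:E)%E.
  by move=> iS; rewrite /F iS; apply: diam_inbox; rewrite ltW ?dy_gt0.
apply: ge_ereal_inf; exists (\sum_(0 <= i <oo) ((fine (diam (F i))) `^ s)%:E)%E.
  exists F => //; split.
    move=> p /cS[e eS pe]; exists (index e S) => //.
    by rewrite /F index_mem eS /= nth_index.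
  move=> i; have [iS|iS] := ltnP i (size S); last first.
    by rewrite /F ltnNge iS /= diam_set0 lee_fin ltW.
  apply: (le_trans (Fd i iS)); rewrite lee_fin.
  have := low _ (mem_nth e0 iS); rewrite -leqNgt => /(dy_le R); lra.
rewrite (nneseries_split _ (size S)); last by move=> k _; rewrite lee_fin powR_ge0.
rewrite add0n [X in (_ + X)%E]eseries0 ?adde0; last first.
  move=> i iS _; rewrite /F ltnNge iS /= diam_set0 /= powR0 //; by rewrite gt_eqF.
rewrite sumEFin lee_fin /cost (big_nth e0) mulr_suml !big_mkord.
apply: ler_sum => i _.
have /andP[f0 f1] := fine_diam_le (Fd i (ltn_ord i)).
set k := (nth e0 S i).1 in f1 *.
apply: (@le_trans _ _ ((4 * dy k) `^ s)).
  by apply: ge0_ler_powR; rewrite ?nnegrE ?(ltW s0) // mulr_ge0 // ltW ?dy_gt0.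
rewrite powRM ?(ltW (dy_gt0 _ _)) // mulrC ler_pM2r //.
have -> : dy k = 2 `^ (- k%:R) by rewrite powR_invn // /dyadic exprVn.
rewrite le_eqVlt; apply/orP; left; apply/eqP.
by rewrite -[RHS]powR_mulrn ?powR_ge0 // /lam -powRrM -[RHS]powRrM !mulNr mulrC.
Qed.

(** An exponent [s] strictly between 5/3 and 2, below the dimension, gives [lam = 2 ^ (- s)], and
    then [32 * lam ^ 3 = 2 ^ (5 - 3 * s)]. Staying below 2 ensures [4 * lam > 1], even for sets of
    dimension 2. *)
Theorem dim_pos_content (E : set P) : ((5 / 3 : R)%:E < hausdorff_dim E)%E ->
  exists lam : R, [/\ 1 / 4 < lam, lam < 1 / 2, 32 * lam ^+ 3 < 1 & pos_content lam E].
Proof.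
move=> hE.
have [s [s1 s2 s3]] : exists s : R, [/\ 5 / 3 < s, s < 2 & (s%:E < hausdorff_dim E)%E].
  move: hE; case: (hausdorff_dim E) => [r||] //.
    rewrite lte_fin => hr; have [h|h] := leP r 2.
      by exists ((5 / 3 + r) / 2); split; [lra|lra|rewrite lte_fin; lra].
    by exists (11 / 6); split; [lra|lra|rewrite lte_fin; lra].
  by move=> _; exists (11 / 6); split; [lra|lra|rewrite ltry].
exists (2 `^ (- s)).
have pw (a b : R) : a < b -> 2 `^ a < 2 `^ b.
  move=> ab; rewrite lt_neqAle ler_powR ?ltW ?andbT //; last by lra.
  apply/eqP => /(congr1 (@ln R)); rewrite !ln_powR => /mulIf e.
  by move: ab; rewrite e ?ltxx // gt_eqF // ln_gt0 //; lra.
split.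
- have -> : 1 / 4 = 2 `^ (- 2%:R) :> R by rewrite powR_invn //; field.
  by apply: pw; lra.
- have -> : 1 / 2 = 2 `^ (- 1%:R) :> R by rewrite powR_invn //; field.
  by apply: pw; lra.
- rewrite -powR_mulrn ?powR_ge0 // -powRrM.
  have -> : 32 = 2 `^ (5%:R) :> R by rewrite powR_mulrn //; ring.
  rewrite -powRD; last by apply/implyP => _; rewrite pnatr_eq0.
  by rewrite -[ltRHS](powRr0 2); apply: pw; lra.
- apply: hausdorff_pos_content; first by lra.
  move=> H0; move: s3; rewrite ltNge => /negP; apply.
  by apply: ereal_inf_lbound; exists s => //=; split=> //; lra.
Qed.

End HausdorffDim.

(** * Lipschitz images and local Frostman measures *)

Section Image.
Variable R : realType.
Local Notation P := (R * R)%type.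
Local Notation dy := (@dyadic R).
Variable lam : R.
Hypothesis lam0 : 0 < lam.
Hypothesis lam1 : lam < 1 / 2.

(** A cover of the image is pulled back by the Lipschitz left inverse [f], each box rising by [c]
    levels. A cover with a box of level below [c] cannot be shifted, but already costs [lam ^ c]. *)
Lemma pos_content_image (A : set P) (g f : P -> P) (L : R) : (forall p, f (g p) = p) ->
  (forall a b r, 0 <= r -> inbox a b r -> inbox (f a) (f b) (L * r)) -> pos_content lam A -> pos_content lam (g @` A).
Proof.
have L0 := lam0; have L1 := lam1.
move=> fg fL [h h0 hA]; have [c hc] := two_pow_ge L.
exists (Num.min (lam ^+ c) (h * lam ^+ c)); first by rewrite lt_min exprn_gt0 // mulr_gt0 // exprn_gt0.
move=> S cS; have [/hasP[e eS en]|/hasPn low] := boolP (has (fun e => (e.1 < c)%N) S).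
  apply: le_trans (_ : lam ^+ c <= _); first by rewrite ge_min lexx.
  apply: (@le_trans _ _ (lam ^+ e.1)).
    apply: ler_wiXn2l; [exact: ltW|lra|exact: ltnW].
  rewrite /cost (big_rem e) //= lerDl; apply: sumr_ge0 => f' _; exact: exprn_ge0 (ltW _).
apply: le_trans (_ : h * lam ^+ c <= _); first by rewrite ge_min lexx orbT.
rewrite -ler_pdivlMr ?exprn_gt0 //.
apply: (@le_trans _ _ (cost lam [seq ((e.1 - c)%N, f e.2) | e <- S])).
  apply: hA => p Ap; have [|e eS pe] := cS (g p); first by exists p.
  exists ((e.1 - c)%N, f e.2); first exact: map_f.
  have ec : (c <= e.1)%N by rewrite leqNgt low.
  have := fL _ _ _ (ltW (dy_gt0 R e.1)) pe; rewrite fg; apply: inbox_le.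
  rewrite -{1}(subnK ec) dyD mulrCA -[leRHS]mulr1 ler_pM2l ?dy_gt0 //.
rewrite /cost big_map mulr_suml big_seq [leRHS]big_seq; apply: ler_sum => e eS.
have ec : (c <= e.1)%N by rewrite leqNgt low.
by rewrite ler_pdivlMr ?exprn_gt0 // -exprD subnK.
Qed.

Lemma thick_image (E : set P) x (g f : P -> P) (L K : R) : (forall p, f (g p) = p) ->
  (forall a b r, 0 <= r -> inbox a b r -> inbox (f a) (f b) (L * r)) ->
  0 < K -> (forall a b r, 0 <= r -> inbox a b r -> inbox (g a) (g b) (K * r)) ->
  thick lam E x -> thick lam (g @` E) (g x).
Proof.
move=> fg fL K0 gK tx r r0.
have := pos_content_image fg fL (tx _ (divr_gt0 r0 K0)); apply: pos_content_sub => _ [p [Ep /= px] <-].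
split; first by exists p.
have := gK _ _ _ (ltW (divr_gt0 r0 K0)) px; by rewrite mulrCA divff ?gt_eqF // mulr1.
Qed.

(** [Frostman] wants its set inside one unit cell. At most nine cells come near [x], and one of them
    keeps positive content. *)
Lemma thick_cell (E : set P) x (r : R) : thick lam E x -> 0 < r ->
  exists c, pos_content lam (E `&` [set p | inbox p x r /\ idx 0 p = c]).
Proof.
move=> tx r0; pose r1 := Num.min r 1.
have r10 : 0 < r1 by rewrite lt_min r0 ltr01.
pose cells := [seq ((idx 0 x).1 - 1 + (l %/ 3)%N%:Z, (idx 0 x).2 - 1 + (l %% 3)%N%:Z) | l <- iota 0 9].
have [|c _ Fc] := @pos_content_bigcup R lam _ cells _ (fun c => [set p | idx 0 p = c]) (tx _ r10).
  move=> p [_ /= px]; have : inbox p x (dy 0).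
    by apply: inbox_le px; rewrite /dyadic expr0 ge_min lexx orbT.
  move=> /inbox_idx[i [j [i3 j3 e]]]; exists (idx 0 p) => //.
  apply/mapP; exists (i * 3 + j)%N; first by rewrite mem_iota; lia.
  by rewrite e divnMDl // divn_small // addn0 modnMDl modn_small.
exists c; apply: pos_content_sub Fc => p [[Ep px] pc]; split=> //; split=> //.
by apply: inbox_le px; rewrite ge_min lexx.
Qed.

Theorem thick_measure (E : set P) x (r : R) : thick lam E x -> 0 < r ->
  exists2 h : R, 0 < h & forall N, exists mu,
    [/\ frostman lam 9 N mu, on (fun p => E p /\ inbox p x r) mu & \sum_(e <- mu) e.1 = h].
Proof.
have L0 := lam0; have L1 := lam1.
move=> tx r0; have [c Fc] := thick_cell tx r0.
have [|h h0 H] := @Frostman R lam lam0 _ c Fc; first by move=> p [_ []].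
exists h => // N; have [mu [h1 h2 h3]] := H N; exists mu; split=> // e /h2 [? []] //.
Qed.

End Image.

(** * Limits by compactness *)

Section Limit.
Variable R : realType.
Local Notation P := (R * R)%type.
Local Notation dy := (@dyadic R).

(** Limits are extracted one point at a time: [t] carries the points still to be treated, and the
    conclusion has the form needed for the next application. *)
Lemma limit_point (E : set P) (T : Type) (Q : nat -> P -> T -> Prop) : compact E ->
  (forall n, exists p t, E p /\ Q n p t) -> (forall n p t, Q n.+1 p t -> Q n p t) ->
  exists x, E x /\ forall n, exists p t, inbox p x (dy n) /\ Q n p t.
Proof.
move=> cE ex anti.
have mono m n p t : (m <= n)%N -> Q n p t -> Q m p t.
  by move=> mn; rewrite -(subnK mn); elim: (n - m)%N => // k IH /anti /IH.
have [|||||x [Ex hx]] := @compact_cluster R E (fun B => exists n, forall p t, E p -> Q n p t -> B p) cE.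
- by exists 0%N.
- move=> A B [n hn] [m hm]; exists (maxn n m) => p t Ep q; split.
    by apply: (hn p t) => //; apply: mono q; exact: leq_maxl.
  by apply: (hm p t) => //; apply: mono q; exact: leq_maxr.
- by move=> A B AB [n hn]; exists n => p t Ep q; apply: AB; apply: hn Ep q.
- by case=> n hn; have [p [t [Ep q]]] := ex n; exact: (hn p t).
- by exists 0%N.
exists x; split=> // n.
have [|p [[t [_ q]] px]] := hx (dy n) [set p | exists t, E p /\ Q n p t] (dy_gt0 R n).
  by exists n => p t Ep q; exists t.
by exists p, t.
Qed.

Lemma le0_dy (K x : R) : (forall n, `|x| <= K * dy n) -> x = 0.
Proof.
move=> h; apply/eqP; rewrite -normr_eq0; apply/negPn/negP => x0.
have xp : 0 < `|x| by rewrite lt_neqAle eq_sym x0 normr_ge0.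
have K0 : 0 < `|K| + 1 by have := normr_ge0 K; lra.
have [n hn] := @dy_small R (`|x| / (`|K| + 1) / 2) ltac:(by rewrite !divr_gt0).
have := h n; rewrite leNgt => /negP; apply.
apply: (@le_lt_trans _ _ ((`|K| + 1) * dy n)).
  by rewrite ler_wpM2r ?(ltW (dy_gt0 _ _)) //; have := ler_norm K; lra.
apply: (@le_lt_trans _ _ ((`|K| + 1) * (`|x| / (`|K| + 1) / 2))).
  by rewrite ler_pM2l.
rewrite (_ : _ * _ = `|x| / 2); last by field; rewrite gt_eqF.
lra.
Qed.

(** If each [l] failed at some stage [b l], all of them would fail at the largest of these
    stages. *)
Lemma pigeonhole_level (L : nat) (Q : nat -> nat -> Prop) :
  (forall n l, Q n.+1 l -> Q n l) -> (forall n, exists2 l, (l < L)%N & Q n l) ->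
  exists2 l, (l < L)%N & forall n, Q n l.
Proof.
move=> anti ex.
have mono m n l : (m <= n)%N -> Q n l -> Q m l.
  by move=> mn; rewrite -(subnK mn); elim: (n - m)%N => // k IH /anti /IH.
apply: contrapT => no.
have bad l : exists n, (l < L)%N -> ~ Q n l.
  have [[n hn]|h] := pselect (exists n, ~ Q n l); first by exists n.
  exists 0%N => lL; exfalso; apply: no; exists l => // n; apply: contrapT => q.
  by apply: h; exists n.
have [b hb] := choice bad.
have [l lL q] := ex (\max_(l < L) b l)%N.
apply: (hb l lL); apply: mono q.
exact: (@leq_bigmax _ (fun l : 'I_L => b l) (Ordinal lL)).
Qed.

End Limit.

(** * Circles *)

Section Differences.
Variable R : realType.
Implicit Types (f df : R -> R).

Lemma mvt_bound f df (a b k A : R) : a <= b ->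
  (forall x, a <= x <= b -> is_derive x 1 f (df x)) ->
  (forall x, a <= x <= b -> k <= df x <= A) ->
  k * (b - a) <= f b - f a <= A * (b - a).
Proof.
move=> ab fd dfb; have [||c] := @MVT_segment R f df a b ab.
- by move=> x; rewrite in_itv /= => /andP[x1 x2]; apply: fd; rewrite !ltW.
- apply: derivable_within_continuous => x; rewrite in_itv /= => /fd [] //.
- rewrite in_itv /= => /dfb /andP[c1 c2] ->.
  by rewrite !ler_wpM2r // subr_ge0.
Qed.

Lemma is_derive_shift f df (h x : R) : is_derive (x + h) 1 f (df (x + h)) ->
  is_derive x 1 (fun z => f (z + h)) (df (x + h)).
Proof.
move=> H; have G : is_derive x 1 (fun z : R => z + h) 1.
  by apply: is_derive_eq; rewrite addr0.
have := @is_derive1_comp R f (fun z => z + h) x _ _ H G; by rewrite mulr1.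
Qed.

Lemma is_derive_sub f g (x a b : R) : is_derive x 1 f a -> is_derive x 1 g b ->
  is_derive x 1 (fun z => f z - g z) (a - b).
Proof. move=> H G; exact: is_deriveB. Qed.

(** The mean value theorem is used twice, in the base point and in the step. This serves the
    transversality clause of [curves], and [mixed3] its last clause. *)
Lemma mixed2 f f1 f2 (lo hi k A y y' h : R) :
  (forall x, lo <= x <= hi -> is_derive x 1 f (f1 x)) ->
  (forall x, lo <= x <= hi -> is_derive x 1 f1 (f2 x)) ->
  (forall x, lo <= x <= hi -> k <= f2 x <= A) ->
  lo <= y' -> y' <= y -> 0 <= h -> y + h <= hi ->
  k * h * (y - y') <= (f (y + h) - f y) - (f (y' + h) - f y') <= A * h * (y - y').
Proof.
move=> d1 d2 b2 ly yy h0 yh.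
apply: (@mvt_bound (fun z => f (z + h) - f z) (fun z => f1 (z + h) - f1 z)) => // x /andP[x1 x2].
  apply: is_derive_sub; last by apply: d1; lra.
  by apply: is_derive_shift; apply: d1; lra.
have -> : k * h = k * (x + h - x) by ring.
have -> : A * h = A * (x + h - x) by ring.
apply: mvt_bound; first by lra.
  by move=> z /andP[z1 z2]; apply: d2; lra.
by move=> z /andP[z1 z2]; apply: b2; lra.
Qed.

Lemma mixed3 f f1 f2 f3 (lo hi A y y' h : R) :
  (forall x, lo <= x <= hi -> is_derive x 1 f (f1 x)) ->
  (forall x, lo <= x <= hi -> is_derive x 1 f1 (f2 x)) ->
  (forall x, lo <= x <= hi -> is_derive x 1 f2 (f3 x)) ->
  (forall x, lo <= x <= hi -> - A <= f3 x <= A) ->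
  lo <= y' -> y' <= y -> 0 <= h -> y + 2 * h <= hi ->
  `|(f (y + 2 * h) - 2 * f (y + h) + f y) - (f (y' + 2 * h) - 2 * f (y' + h) + f y')|
    <= A * h ^+ 2 * (y - y').
Proof.
move=> d1 d2 d3 b3 ly yy h0 yh; rewrite ler_norml -mulNr -mulNr.
set Z := (X in _ <= X <= _).
have -> : Z = ((f (y + 2 * h) - f (y + h)) - (f (y + h) - f y)) -
   ((f (y' + 2 * h) - f (y' + h)) - (f (y' + h) - f y')) by rewrite /Z; ring.
apply: (@mvt_bound (fun z => (f (z + 2 * h) - f (z + h)) - (f (z + h) - f z))
   (fun z => (f1 (z + 2 * h) - f1 (z + h)) - (f1 (z + h) - f1 z))) => // x /andP[x1 x2].
  apply: is_derive_sub; apply: is_derive_sub; try apply: is_derive_shift; apply: d1; lra.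
have E : x + 2 * h = x + h + h by ring.
have := @mixed2 f1 f2 f3 lo hi (- A) A (x + h) x h d2 d3 b3 ltac:(lra) ltac:(lra) h0 ltac:(lra).
rewrite E (_ : x + h - x = h); last by ring.
by rewrite -!mulrA -expr2.
Qed.

End Differences.

Section Sqrt.
Variable R : realType.
Variable t : R.
Definition arc (y : R) : R := Num.sqrt (t ^+ 2 - y ^+ 2).

Lemma arc_gt0 y : 0 < t ^+ 2 - y ^+ 2 -> 0 < arc y.
Proof. by move=> h; rewrite sqrtr_gt0. Qed.

Lemma arc_sqr y : 0 < t ^+ 2 - y ^+ 2 -> arc y ^+ 2 = t ^+ 2 - y ^+ 2.
Proof. by move=> h; rewrite sqr_sqrtr // ltW. Qed.

Lemma arc_d1 y : 0 < t ^+ 2 - y ^+ 2 -> is_derive y 1 arc (- y * (arc y)^-1).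
Proof.
move=> h; have G : is_derive y 1 (fun z : R => t ^+ 2 - z ^+ 2) (0 - 2 * y).
  apply: is_derive_sub.
  by apply: (is_derive_eq (is_deriveX 2 (is_derive_id y 1))); rewrite /GRing.scale /= mulr1.
have := @is_derive1_comp R Num.sqrt _ y _ _ (is_derive1_sqrt h) G.
rewrite -/(arc y) => H; apply: (is_derive_eq H); field.
by rewrite gt_eqF // arc_gt0.
Qed.

Lemma arc_inv y : 0 < t ^+ 2 - y ^+ 2 -> is_derive y 1 (fun z => (arc z)^-1) (y * (arc y)^-1 ^+ 3).
Proof.
move=> h; have a0 := arc_gt0 h.
have := @is_deriveV R arc y _ 1 (lt0r_neq0 a0) (arc_d1 h).
move=> H; apply: (is_derive_eq H); rewrite /GRing.scale /=; field.
by rewrite gt_eqF.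
Qed.

Lemma arc_d2 y : 0 < t ^+ 2 - y ^+ 2 ->
  is_derive y 1 (fun z => - z * (arc z)^-1) (- t ^+ 2 * (arc y)^-1 ^+ 3).
Proof.
move=> h; have a0 := arc_gt0 h; have I := arc_inv h.
have N : is_derive y 1 (fun z : R => - z) (- 1) by apply: is_derive_eq.
have H := is_deriveM N I; apply: (is_derive_eq H); rewrite /GRing.scale /=.
have -> : t ^+ 2 = arc y ^+ 2 + y ^+ 2 by rewrite arc_sqr // subrK.
by field; rewrite gt_eqF.
Qed.

Lemma arc_d3 y : 0 < t ^+ 2 - y ^+ 2 ->
  is_derive y 1 (fun z => - t ^+ 2 * (arc z)^-1 ^+ 3) (- (3 * t ^+ 2 * y * (arc y)^-1 ^+ 5)).
Proof.
move=> h; have a0 := arc_gt0 h; have I := arc_inv h.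
have X := is_deriveX 3 I.
have Z := is_deriveZ (- t ^+ 2) X.
apply: (is_derive_eq Z); rewrite /GRing.scale /=.
by field; rewrite gt_eqF.
Qed.

End Sqrt.

Section CircleCurves.
Variable R : realType.
Local Notation P := (R * R)%type.

(* [circ s l t p v = b] makes [(l * (v - 1 / 2), b - 1)] a point at distance [t] from [p];
   the sign [s] selects the arc. *)
Definition circ (s l t : R) (p : P) (v : R) : R := p.2 - s * arc t (p.1 - l * (v - 2^-1)) + 1.

(** [m] keeps [p0] off the horizontal axis, where the arc would have a vertical tangent, and [l] is
    so small that [t ^ 2 - y ^ 2] stays above [m ^ 2 / 4]. The width [5 / 2 * l] allows [l] for a
    point near [p0] and [3 / 2 * l] for [v] in [0, 2]. *)
Lemma arc_region (m l t y : R) (p0 : P) : 0 < m -> m <= 1 -> l = m ^+ 2 / 32 ->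
  p0.1 ^+ 2 + p0.2 ^+ 2 = 1 -> m <= `|p0.2| -> `|t - 1| <= l -> `|y - p0.1| <= 5 / 2 * l ->
  [/\ 0 < t ^+ 2 - y ^+ 2, m / 2 <= arc t y <= 2, `|arc t y - `|p0.2| | <= 1 / 4,
      1 / 2 <= t <= 2 & `|y| <= 2].
Proof.
move=> m0 m1 lE p1 mp tl yl.
have mm0 : 0 < m ^+ 2 by rewrite exprn_gt0.
have mm1 : m ^+ 2 <= 1 by rewrite exprn_ile1 // ltW.
have l0 : 0 < l by rewrite lE; lra.
have l1 : l <= 1 / 32 by rewrite lE; lra.
have m32 : m ^+ 2 = 32 * l by rewrite lE; field.
have p2m : m ^+ 2 <= p0.2 ^+ 2 by rewrite -[leRHS]real_normK ?num_real // lerXn2r ?nnegrE // ltW.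
have p11 : - 1 <= p0.1 <= 1 by apply/andP; split; nra.
move: tl yl; rewrite !ler_norml => /andP[t1 t2] /andP[y1 y2].
have /andP[p1a p1b] := p11.
set d := y - p0.1 in y1 y2; have yE : y = p0.1 + d by rewrite /d; ring.
have d2 : d ^+ 2 <= l by nra.
have pd : - (5 / 2 * l) <= p0.1 * d <= 5 / 2 * l by apply/andP; split; nra.
have /andP[pd1 pd2] := pd.
have ys : y ^+ 2 = p0.1 ^+ 2 + 2 * (p0.1 * d) + d ^+ 2 by rewrite yE; ring.
have ts : 1 - 2 * l <= t ^+ 2 <= 1 + 3 * l by apply/andP; split; nra.
have /andP[ts1 ts2] := ts.
have d20 := sqr_ge0 d.
have w1 : m ^+ 2 / 4 <= t ^+ 2 - y ^+ 2 by lra.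
have w0 : 0 < t ^+ 2 - y ^+ 2 by lra.
have ysq := sqr_ge0 y.
have a0 := arc_gt0 w0; have a2 := arc_sqr w0.
have am : m / 2 <= arc t y.
  rewrite -(@ler_pXn2r _ 2) ?nnegrE ?divr_ge0 ?(ltW m0) ?(ltW a0) //.
  by rewrite a2 exprMn exprVn; move: w1; clear; lra.
have a4 : arc t y <= 2.
  by rewrite -(@ler_pXn2r _ 2) ?nnegrE ?(ltW a0) // a2; move: ts2 l1 ysq; clear; lra.
split=> //.
- by rewrite am.
- set q := `|p0.2| in mp *; have q2 : q ^+ 2 = p0.2 ^+ 2 by rewrite real_normK ?num_real.
  have e : `|(arc t y - q) * (arc t y + q)| <= 8 * l.
    have -> : (arc t y - q) * (arc t y + q) = arc t y ^+ 2 - q ^+ 2 by ring.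
    rewrite a2 q2 ler_norml; move: p1 ys pd1 pd2 d2 d20 ts1 ts2; clear => *.
    by apply/andP; split; lra.
  have s0 : m <= arc t y + q by move: am mp m0; clear; lra.
  have sp : 0 < arc t y + q by exact: lt_le_trans s0.
  rewrite normrM (gtr0_norm sp) in e.
  rewrite -ler_norml -(@ler_pM2r _ m) //.
  apply: (@le_trans _ _ (8 * l)).
    by apply: le_trans e; rewrite ler_wpM2l.
  by rewrite (_ : 8 * l = m ^+ 2 / 4); [move: mm0 m0 m1; clear; nra|rewrite m32; field].
- by move: t1 t2 l1; clear => *; apply/andP; split; lra.
- by move: yE y1 y2 p1a p1b l1; clear => *; apply/andP; split; lra.
Qed.

(** The abscissa of [p] and the variable [v] enter [arc t] only through [p.1 - l * (v - 1/2)], so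
    the required bounds are mixed differences of [arc t]. Transversality is the strict concavity of
    the arc: its second derivative [- t ^ 2 / arc ^ 3] is at most [- 1 / 32], and the step in [v]
    supplies the factor [l]. With [B = 2 / m] bounding [1 / arc], the third derivative is at most
    [3 * 4 * 2 * B ^ 5]. *)
Lemma circle_curves (m l t s : R) (p0 : P) : 0 < m -> m <= 1 -> l = m ^+ 2 / 32 ->
  p0.1 ^+ 2 + p0.2 ^+ 2 = 1 -> m <= `|p0.2| -> `|t - 1| <= l ->
  s = 1 \/ s = -1 -> s * p0.2 = `|p0.2| ->
  curves (l / 32) (24 * (2 / m) ^+ 5) (- s) (fun p => inbox p p0 l) (circ s l t).
Proof.
move=> m0 m1 lE p1 mp tl sE sp.
set B := 2 / m.
have mm0 : 0 < m ^+ 2 by rewrite exprn_gt0.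
have mm1 : m ^+ 2 <= 1 by rewrite exprn_ile1 // ltW.
have l0 : 0 < l by rewrite lE; lra.
have l1 : l <= 1 / 32 by rewrite lE; lra.
have B2 : 2 <= B by rewrite /B ler_pdivlMr //; lra.
have reg y := @arc_region m l t y p0 m0 m1 lE p1 mp tl.
pose lo := p0.1 - 5 / 2 * l; pose hi := p0.1 + 5 / 2 * l.
have regI y : lo <= y <= hi -> `|y - p0.1| <= 5 / 2 * l.
  by rewrite /lo /hi ler_norml => /andP[? ?]; apply/andP; split; lra.
have w0 y : lo <= y <= hi -> 0 < t ^+ 2 - y ^+ 2 by move=> /regI /reg [].
have Ib y : lo <= y <= hi -> 1 / 2 <= (arc t y)^-1 <= B.
  move=> yl; have [_ /andP[a1 a2] _ _ _] := reg y (regI y yl).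
  have a0 := arc_gt0 (w0 y yl); apply/andP; split.
    by rewrite (_ : 1 / 2 = 2^-1); [rewrite lef_pV2 // posrE|field].
  rewrite /B (_ : 2 / m = (m / 2)^-1); last by field; rewrite gt_eqF.
  by rewrite lef_pV2 // posrE divr_gt0.
clearbody B.
have [_ _ _ /andP[t1 t2] _] := reg p0.1 ltac:(by rewrite subrr normr0; lra).
have t4 : 1 / 4 <= t ^+ 2 <= 4 by apply/andP; split; nra.
have /andP[t41 t42] := t4.
have B1 : 1 <= B by lra.
have Bp n k : (n <= k)%N -> B ^+ n <= B ^+ k by move=> nk; apply: ler_weXn2l.
have f1b y : lo <= y <= hi -> - (24 * B ^+ 5) <= - y * (arc t y)^-1 <= 24 * B ^+ 5.
  move=> yl; have /andP[i1 i2] := Ib y yl; have [_ _ _ _ y2] := reg y (regI y yl).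
  rewrite -ler_norml normrM normrN (ger0_norm (_ : 0 <= (arc t y)^-1)); last by move: i1; clear; lra.
  have := Bp 1%N 5%N isT; rewrite expr1 => h.
  apply: (@le_trans _ _ (2 * B)); last by move: h B1; clear; lra.
  by apply: ler_pM => //; move: i1; clear; lra.
have pw n (x : R) : 1 / 2 <= x <= B -> (1 / 2) ^+ n <= x ^+ n <= B ^+ n.
  move=> /andP[x1 x2]; rewrite !lerXn2r ?nnegrE //; move: x1 x2 B1; clear; lra.
have f2b y : lo <= y <= hi -> - (24 * B ^+ 5) <= - t ^+ 2 * (arc t y)^-1 ^+ 3 <= - (1 / 32).
  move=> yl; have /andP[] := pw 3%N _ (Ib y yl); set I3 := (arc t y)^-1 ^+ 3.
  rewrite (_ : (1 / 2) ^+ 3 = 1 / 8 :> R); last by field.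
  move=> i1 i2; have h := Bp 3%N 5%N isT; move: i1 i2 h t41 t42; clear => *.
  by apply/andP; split; nra.
have f3b y : lo <= y <= hi ->
    - (24 * B ^+ 5) <= - (3 * t ^+ 2 * y * (arc t y)^-1 ^+ 5) <= 24 * B ^+ 5.
  move=> yl; have /andP[] := pw 5%N _ (Ib y yl); set I5 := (arc t y)^-1 ^+ 5.
  rewrite (_ : (1 / 2) ^+ 5 = 1 / 32 :> R); last by field.
  move=> i1 i2; have [_ _ _ _ y2] := reg y (regI y yl).
  rewrite -ler_norml normrN (_ : 3 * t ^+ 2 * y * I5 = (3 * t ^+ 2 * I5) * y); last by ring.
  have h0 : 0 <= 3 * t ^+ 2 * I5 by apply: mulr_ge0; move: t41 i1; clear; lra.
  rewrite normrM (ger0_norm h0) (_ : 24 * B ^+ 5 = (3 * 4 * B ^+ 5) * 2); last by ring.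
  by apply: ler_pM => //; apply: ler_pM => //; move: t41 t42 i1; clear; lra.
have d1 y : lo <= y <= hi -> is_derive y 1 (arc t) (- y * (arc t y)^-1).
  by move=> /w0; exact: arc_d1.
have d2 y : lo <= y <= hi -> is_derive y 1 (fun z => - z * (arc t z)^-1) (- t ^+ 2 * (arc t y)^-1 ^+ 3).
  by move=> /w0; exact: arc_d2.
have d3 y : lo <= y <= hi -> is_derive y 1 (fun z => - t ^+ 2 * (arc t z)^-1 ^+ 3)
    (- (3 * t ^+ 2 * y * (arc t y)^-1 ^+ 5)).
  by move=> /w0; exact: arc_d3.
have rng p v : inbox p p0 l -> 0 <= v <= 2 -> lo <= p.1 - l * (v - 2^-1) <= hi.
  rewrite /inbox ler_norml /lo /hi => /andP[/andP[x1 x2] _] /andP[v0 v2].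
  by move: x1 x2 v0 v2 l0; clear => *; apply/andP; split; nra.
have ss : s * s = 1 by case: sE => ->; ring.
have s1 : `|s| = 1 by case: sE => ->; rewrite ?normrN normr1.
split.
- move=> p v pX v2; have [_ _ a _ _] := reg _ (regI _ (rng p v pX v2)).
  move: pX; rewrite /inbox => /andP[_]; rewrite /circ.
  set a' := arc t _ in a *; have -> : p.2 - s * a' + 1 = (p.2 - p0.2) - s * (a' - `|p0.2|) + 1.
    by rewrite mulrBr -sp mulrA ss; ring.
  have := ler_norm (s * (a' - `|p0.2|)); have := ler_norm (- (s * (a' - `|p0.2|))).
  rewrite normrN normrM s1 mul1r => h1 h2; rewrite ler_norml => /andP[h3 h4].
  by move: h1 h2 h3 h4 a l1; clear => *; apply/andP; split; lra.
- move=> p q v pX qX v2.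
  have [] := (rng p v pX v2, rng q v qX v2).
  rewrite /circ; set y := p.1 - l * _; set y' := q.1 - l * _ => ry rq.
  have -> : p.2 - s * arc t y + 1 - (q.2 - s * arc t y' + 1) - (p.2 - q.2) = - (s * (arc t y - arc t y')) by ring.
  rewrite normrN normrM s1 mul1r.
  have -> : p.1 - q.1 = y - y' by rewrite /y /y'; ring.
  have key a b : lo <= a <= hi -> lo <= b <= hi -> a <= b -> `|arc t b - arc t a| <= 24 * B ^+ 5 * `|b - a|.
    move=> /andP[a1 a2] /andP[b1 b2] ab; rewrite [`|b - a|]ger0_norm ?subr_ge0 // ler_norml -mulNr.
    by apply: (@mvt_bound R (arc t) (fun z => - z * (arc t z)^-1)) => // z /andP[z1 z2]; [apply: d1|apply: f1b]; move: a1 b2 z1 z2; clear; lra.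
  have [h|/ltW h] := leP y' y; first exact: key.
  by rewrite distrC (distrC y); exact: key.
- move=> p q v h pX qX qp v0 h0 vh.
  have v2 : 0 <= v <= 2 by move: v0 h0 vh; clear => *; apply/andP; split; lra.
  have vh2 : 0 <= v + h <= 2 by move: v0 h0 vh; clear => *; apply/andP; split; lra.
  have := rng p v pX v2; have := rng q (v + h) qX vh2.
  have Ey (x : R) : x - l * (v - 2^-1) = x - l * (v + h - 2^-1) + l * h by ring.
  rewrite /circ (Ey p.1) (Ey q.1); set y := p.1 - l * _; set y' := q.1 - l * _ => /andP[q1 _] /andP[_ p2].
  have yy : y - y' = p.1 - q.1 by rewrite /y /y'; ring.
  have h0' : 0 <= l * h by rewrite mulr_ge0 // ltW.
  have y'y : y' <= y by rewrite -subr_ge0 yy subr_ge0.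
  have := @mixed2 R (arc t) _ _ lo hi (- (24 * B ^+ 5)) (- (1 / 32)) y y' (l * h) d1 d2 f2b q1 y'y h0' p2.
  rewrite yy => /andP[M1 M2].
  pose M := arc t (y + l * h) - arc t y - (arc t (y' + l * h) - arc t y'); rewrite -/M in M1 M2.
  have -> : - s * (p.2 - s * arc t y + 1 - (q.2 - s * arc t y' + 1) -
     (p.2 - s * arc t (y + l * h) + 1 - (q.2 - s * arc t (y' + l * h) + 1))) = - (s * s) * M.
    by rewrite /M; ring.
  rewrite ss mulN1r; apply/andP; split; first by move: M2; clear; lra.
  apply: (@le_trans _ _ (24 * B ^+ 5 * (l * h) * (p.1 - q.1))); first by move: M1; clear; lra.
  have h5 : 0 <= 24 * B ^+ 5 * (p.1 - q.1) * h.
    have pq : 0 <= p.1 - q.1 by rewrite subr_ge0.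
    have B0 : 0 <= B by move: B1; clear; lra.
    by positivity.
  rewrite (_ : _ * (l * h) * _ = l * (24 * B ^+ 5 * (p.1 - q.1) * h)); last by ring.
  by rewrite ler_piMl //; move: l1; clear; lra.
- move=> p q v h pX qX v0 h0 vh.
  wlog qp : p q pX qX / q.1 <= p.1.
    move=> H; have [h1|/ltW h1] := leP q.1 p.1; first exact: H.
    have := H q p qX pX h1; rewrite (distrC q.1) => hh; apply: le_trans hh.
    by rewrite -normrN le_eqVlt; apply/orP; left; apply/eqP; congr (Num.norm _); ring.
  have v2 : 0 <= v <= 2 by move: v0 h0 vh; clear => *; apply/andP; split; lra.
  have vh2 : 0 <= v + 2 * h <= 2 by move: v0 h0 vh; clear => *; apply/andP; split; lra.
  have := rng p v pX v2; have := rng q (v + 2 * h) qX vh2.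
  have Ey (x : R) : x - l * (v - 2^-1) = x - l * (v + 2 * h - 2^-1) + 2 * (l * h) by ring.
  have Ez (x : R) : x - l * (v + h - 2^-1) = x - l * (v + 2 * h - 2^-1) + l * h by ring.
  rewrite /circ (Ey p.1) (Ey q.1) (Ez p.1) (Ez q.1); set y := p.1 - l * _; set y' := q.1 - l * _ => /andP[q1 _] /andP[_ p2].
  have yy : y - y' = p.1 - q.1 by rewrite /y /y'; ring.
  have h0' : 0 <= l * h by rewrite mulr_ge0 // ltW.
  have y'y : y' <= y by rewrite -subr_ge0 yy subr_ge0.
  have := @mixed3 R (arc t) _ _ _ lo hi (24 * B ^+ 5) y y' (l * h) d1 d2 d3 f3b q1 y'y h0' p2.
  rewrite yy => M1; rewrite (ger0_norm (_ : 0 <= p.1 - q.1)) ?subr_ge0 //.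
  set X := (X in `|X| <= _).
  have -> : X = - (s * (arc t (y + 2 * (l * h)) - 2 * arc t (y + l * h) + arc t y -
     (arc t (y' + 2 * (l * h)) - 2 * arc t (y' + l * h) + arc t y'))) by rewrite /X; ring.
  rewrite normrN normrM s1 mul1r; apply: (le_trans M1).
  have h5 : 0 <= 24 * B ^+ 5 * (p.1 - q.1) * h ^+ 2.
    have pq : 0 <= p.1 - q.1 by rewrite subr_ge0.
    have B0 : 0 <= B by move: B1; clear; lra.
    by positivity.
  rewrite (_ : _ * (l * h) ^+ 2 * _ = l ^+ 2 * (24 * B ^+ 5 * (p.1 - q.1) * h ^+ 2)); last by ring.
  by rewrite ler_piMl // exprn_ile1 ?(ltW l0) //; move: l1; clear; lra.
Qed.

End CircleCurves.

(** * Circumcentres *)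

Section Circumcircle.
Variable R : realType.
Local Notation P := (R * R)%type.
Local Notation dy := (@dyadic R).

Lemma normM_le (a b x y : R) : `|a| <= x -> `|b| <= y -> `|a * b| <= x * y.
Proof. by move=> h1 h2; rewrite normrM ler_pM. Qed.

Lemma normB_le (a b x y z : R) : `|a| <= x -> `|b| <= y -> x + y <= z -> `|a - b| <= z.
Proof. by move=> h1 h2 h3; apply: (le_trans (ler_normB _ _)); lra. Qed.

Definition sqd (x y : P) : R := (x.1 - y.1) ^+ 2 + (x.2 - y.2) ^+ 2.

Lemma sqd_ge0 x y : 0 <= sqd x y.
Proof. by rewrite addr_ge0 ?sqr_ge0. Qed.

Lemma count_itv (M J : nat) (a b : R) : (0 < M)%N -> 0 <= a -> a <= b -> b <= J%:R / M%:R ->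
  M%:R * (b - a) - 2 <= \sum_(j < J) (a <= j%:R / M%:R < b)%R%:R.
Proof.
move=> M0 a0 ab bJ; have Mr : 0 < M%:R :> R by rewrite ltr0n.
have ha := @count_lattice R M J a M0 ltac:(by rewrite a0 (le_trans ab)).
have hb := @count_lattice R M J b M0 ltac:(by rewrite (le_trans a0 ab)).
have -> : \sum_(j < J) (a <= j%:R / M%:R < b)%R%:R =
   \sum_(j < J) (j%:R / M%:R < b)%R%:R - \sum_(j < J) (j%:R / M%:R < a)%R%:R :> R.
  rewrite -sumrB; apply: eq_bigr => j _; have [h|h] := leP a (j%:R / M%:R); first by rewrite subr0.
  by rewrite (lt_le_trans h ab) subrr.
set X := \sum_(j < J) (j%:R / M%:R < b)%R%:R in hb *.
set Y := \sum_(j < J) (j%:R / M%:R < a)%R%:R in ha *.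
move: ha hb; rewrite !ler_norml => /andP[_ h2] /andP[h1 _].
have E (z : R) : M%:R * (z / M%:R) = z by rewrite mulrC divfK // gt_eqF.
have k1 : M%:R * (b - M%:R^-1) <= X by rewrite -[leRHS]E ler_pM2l //; lra.
have k2 : Y <= M%:R * (a + M%:R^-1) by rewrite -[leLHS]E ler_pM2l //; lra.
by move: k1 k2; rewrite mulrBr mulrDr divff ?gt_eqF //; lra.
Qed.

Lemma pigeonhole_sum (L : nat) (f : nat -> R) (H : R) : (0 < L)%N ->
  H <= \sum_(l < L) f l -> exists2 l, (l < L)%N & H / L%:R <= f l.
Proof.
move=> L0 hf; apply: contrapT => no.
have : \sum_(l < L) f l < \sum_(l < L) (H / L%:R).
  apply: ltr_sum => [|l _]; first by apply/hasP; exists (Ordinal L0); rewrite // mem_index_enum.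
  by rewrite ltNge; apply/negP => h; apply: no; exists l.
rewrite sumr_const card_ord -[_ *+ L]mulr_natr divfK ?pnatr_eq0 -?lt0n // ltNge hf //.
Qed.

Lemma mass_gt0 mu (A : pred P) : 0 < mass mu A -> exists2 e, e \in mu & A e.2.
Proof.
move=> m0; have [/hasP[e e1 e2]|/hasPn no] := boolP (has (fun e => A e.2) mu); first by exists e.
move: m0; rewrite /mass big_seq big1 ?ltxx // => e /no/negPf ->; by rewrite mulr0.
Qed.

Lemma curves_sub kap A sg (X Y : P -> Prop) u : (forall p, Y p -> X p) ->
  @curves R kap A sg X u -> curves kap A sg Y u.
Proof.
move=> YX [h1 h2 h3 h4]; split.
- by move=> p v /YX; exact: h1.
- by move=> p q v /YX ? /YX; exact: h2.
- by move=> p q v t /YX ? /YX; exact: h3.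
- by move=> p q v t /YX ? /YX; exact: h4.
Qed.

Definition circumcentre (x y z : P) : P :=
  let a := (x.1 ^+ 2 + x.2 ^+ 2 - z.1 ^+ 2 - z.2 ^+ 2) / 2 in
  let b := (y.1 ^+ 2 + y.2 ^+ 2 - z.1 ^+ 2 - z.2 ^+ 2) / 2 in
  let D := det2 (psub x z) (psub y z) in
  ((a * (y.2 - z.2) - b * (x.2 - z.2)) / D, ((x.1 - z.1) * b - (y.1 - z.1) * a) / D).
Definition circumradius (x y z : P) : R := Num.sqrt (sqd z (circumcentre x y z)).

Lemma circumcentre_dist x y z : det2 (psub x z) (psub y z) != 0 ->
  [/\ sqd x (circumcentre x y z) = circumradius x y z ^+ 2, sqd y (circumcentre x y z) = circumradius x y z ^+ 2 &
      sqd z (circumcentre x y z) = circumradius x y z ^+ 2].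
Proof.
move=> D0; rewrite /circumradius sqr_sqrtr ?sqd_ge0 //.
by split=> //; move: D0; rewrite /sqd /circumcentre /det2 /psub /= => D0; field.
Qed.

(* By Cramer's rule the centre depends on the points through squared norms, which are
   all close to 1 near the unit circle; hence it is close to the origin. *)
Lemma circumcentre_near (p1 p2 p3 : P) (eta : R) : 0 < eta ->
  p1.1 ^+ 2 + p1.2 ^+ 2 = 1 -> p2.1 ^+ 2 + p2.2 ^+ 2 = 1 -> p3.1 ^+ 2 + p3.2 ^+ 2 = 1 ->
  det2 (psub p1 p3) (psub p2 p3) != 0 ->
  exists2 r, 0 < r & forall x y z, inbox x p1 r -> inbox y p2 r -> inbox z p3 r ->
    [/\ det2 (psub x z) (psub y z) != 0, `|(circumcentre x y z).1| <= eta, `|(circumcentre x y z).2| <= eta &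
        `|circumradius x y z - 1| <= eta].
Proof.
move=> e0 u1 u2 u3 D0; set d := det2 _ _ in D0.
pose e := Num.min eta 1.
have e1 : 0 < e by rewrite lt_min e0 ltr01.
have eE : e <= eta by rewrite ge_min lexx.
have e11 : e <= 1 by rewrite ge_min lexx orbT.
have d0 : 0 < `|d| by rewrite normr_gt0.
have unit (p : P) : p.1 ^+ 2 + p.2 ^+ 2 = 1 -> `|p.1| <= 1 /\ `|p.2| <= 1.
  move=> u; have h1 := sqr_ge0 p.1; have h2 := sqr_ge0 p.2.
  by split; rewrite -(@ler_pXn2r _ 2) ?nnegrE // expr1n real_normK ?num_real //; lra.
have [a1 b1] := unit _ u1; have [a2 b2] := unit _ u2; have [a3 b3] := unit _ u3.
have d8 : `|d| <= 8.
  rewrite /d /det2 /psub /=; apply: (le_trans (ler_normB _ _)).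
  have h (a b : R) : `|a| <= 1 -> `|b| <= 1 -> `|a - b| <= 2.
    by move=> ha hb; apply: (normB_le ha hb); clear; lra.
  have := normM_le (h _ _ a1 a3) (h _ _ b2 b3).
  by have := normM_le (h _ _ b1 b3) (h _ _ a2 a3); lra.
have ed0 : 0 < e * `|d| by exact: mulr_gt0.
have ed1 : e * `|d| <= 8 * e by rewrite mulrC ler_wpM2r // ltW.
have ed2 : e * `|d| <= `|d| by rewrite ler_piMl.
(* The determinant moves by at most [40 * r], so it keeps half its size, and the numerators of
   Cramer's rule are at most [48 * r <= e * |d| / 40]; the quotients are then at most [e / 20]. *)
pose r := e * `|d| / 2000.
have rE : 2000 * r = e * `|d| by rewrite /r; field.
have r0 : 0 < r by move: ed0; rewrite /r; clear; lra.
have re : r <= e / 250 by move: ed1; rewrite /r; clear; lra.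
have rd : r <= `|d| / 2000 by move: ed2; rewrite /r; clear; lra.
clearbody r; exists r => //.
move=> x y z /andP[x1 x2] /andP[y1 y2] /andP[z1 z2].
have nrm (a b : R) : `|b| <= 1 -> `|a - b| <= r -> `|a ^+ 2 - b ^+ 2| <= 3 * r /\ `|a| <= 2.
  move=> hb hab; have ha : `|a| <= 2.
    by have := ler_normD (a - b) b; rewrite subrK; move: hb hab re e11; clear; lra.
  split=> //; rewrite (_ : a ^+ 2 - b ^+ 2 = (a + b) * (a - b)); last ring.
  by apply: normM_le => //; apply: (le_trans (ler_normD _ _)); move: ha hb; clear; lra.
have [x1' x1b] := nrm _ _ a1 x1; have [x2' x2b] := nrm _ _ b1 x2.
have [y1' y1b] := nrm _ _ a2 y1; have [y2' y2b] := nrm _ _ b2 y2.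
have [z1' z1b] := nrm _ _ a3 z1; have [z2' z2b] := nrm _ _ b3 z2.
pose a := (x.1 ^+ 2 + x.2 ^+ 2 - z.1 ^+ 2 - z.2 ^+ 2) / 2.
pose b := (y.1 ^+ 2 + y.2 ^+ 2 - z.1 ^+ 2 - z.2 ^+ 2) / 2.
have ha : `|a| <= 6 * r.
  move: x1' x2' z1' z2'; rewrite /a !ler_norml; move: u1 u3; clear => ? ? /andP[? ?] /andP[? ?] /andP[? ?] /andP[? ?].
  by apply/andP; split; lra.
have hb : `|b| <= 6 * r.
  move: y1' y2' z1' z2'; rewrite /b !ler_norml; move: u2 u3; clear => ? ? /andP[? ?] /andP[? ?] /andP[? ?] /andP[? ?].
  by apply/andP; split; lra.
have sub4 (s t : R) : `|s| <= 2 -> `|t| <= 2 -> `|s - t| <= 4.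
  by move=> hs ht; apply: (normB_le hs ht); clear; lra.
pose D := det2 (psub x z) (psub y z).
have DD : `|D - d| <= 40 * r.
  have E : D - d = (x.1 - z.1) * ((y.2 - z.2) - (p2.2 - p3.2)) + ((x.1 - z.1) - (p1.1 - p3.1)) * (p2.2 - p3.2)
     - ((x.2 - z.2) * ((y.1 - z.1) - (p2.1 - p3.1)) + ((x.2 - z.2) - (p1.2 - p3.2)) * (p2.1 - p3.1)).
    by rewrite /D /d /det2 /psub /=; ring.
  have dif (s t s' t' : R) : `|s - s'| <= r -> `|t - t'| <= r -> `|(s - t) - (s' - t')| <= 2 * r.
    move=> h1 h2; rewrite (_ : _ - _ = (s - s') - (t - t')); last ring.
    by apply: (normB_le h1 h2); clear; lra.
  have p2' (s t : R) : `|s| <= 1 -> `|t| <= 1 -> `|s - t| <= 2.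
    by move=> hs ht; apply: (normB_le hs ht); clear; lra.
  rewrite E; apply: (le_trans (ler_normB _ _)).
  have h1 := normM_le (sub4 _ _ x1b z1b) (dif _ _ _ _ y2 z2).
  have h2 := normM_le (dif _ _ _ _ x1 z1) (p2' _ _ b2 b3).
  have h3 := normM_le (sub4 _ _ x2b z2b) (dif _ _ _ _ y1 z1).
  have h4 := normM_le (dif _ _ _ _ x2 z2) (p2' _ _ a2 a3).
  by apply: le_trans (lerD (ler_normD _ _) (ler_normD _ _)) _; move: h1 h2 h3 h4 r0; clear; lra.
have Dd : `|d| / 2 <= `|D|.
  move: (ler_dist_dist d D) (ler_norm (`|d| - `|D|)) DD rd d0; rewrite (distrC d D); clear; lra.
have Dp : 0 < `|D| by apply: lt_le_trans Dd; rewrite divr_gt0.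
have Dn0 : D != 0 by rewrite -normr_gt0.
have quo (s : R) : `|s| <= 48 * r -> `|s / D| <= e / 20.
  move=> hs; rewrite normrM normfV ler_pdivrMr //; apply: (le_trans hs).
  apply: (@le_trans _ _ (e / 20 * (`|d| / 2))); last by rewrite ler_wpM2l // divr_ge0 // ltW.
  by rewrite (_ : e / 20 * _ = e * `|d| / 40); [move: rE ed0; clear; lra|field].
have c1 : `|(circumcentre x y z).1| <= e / 20.
  apply: quo; apply: (le_trans (ler_normB _ _)).
  have := normM_le ha (sub4 _ _ y2b z2b); have := normM_le hb (sub4 _ _ x2b z2b).
  by rewrite -/a -/b; clear; lra.
have c2 : `|(circumcentre x y z).2| <= e / 20.
  apply: quo; apply: (le_trans (ler_normB _ _)).
  have := normM_le (sub4 _ _ x1b z1b) hb; have := normM_le (sub4 _ _ y1b z1b) ha.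
  by rewrite -/a -/b; clear; lra.
have e20 : e / 20 <= eta by move: eE e1; clear; lra.
split=> //; [exact: le_trans e20|exact: le_trans e20|].
have [_ _ tE] := circumcentre_dist Dn0; set t := circumradius x y z in tE *.
have t0 : 0 <= t by exact: sqrtr_ge0.
have t2 : `|t ^+ 2 - 1| <= e.
  rewrite -tE /sqd; set c := circumcentre x y z in c1 c2 *.
  have -> : (z.1 - c.1) ^+ 2 + (z.2 - c.2) ^+ 2 - 1 = (z.1 ^+ 2 - p3.1 ^+ 2) + (z.2 ^+ 2 - p3.2 ^+ 2)
     - 2 * (z.1 * c.1) - 2 * (z.2 * c.2) + c.1 * c.1 + c.2 * c.2 + (p3.1 ^+ 2 + p3.2 ^+ 2 - 1) by ring.
  rewrite u3 subrr addr0.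
  have := normM_le z1b c1; have := normM_le z2b c2; have := normM_le c1 c1; have := normM_le c2 c2.
  have ee : e / 20 * (e / 20) <= e / 400 by move: e1 e11; clear; nra.
  move: z1' z2'; rewrite !ler_norml => /andP[n1 n2] /andP[n3 n4] /andP[n5 n6] /andP[n7 n8] /andP[n9 n10] /andP[n11 n12].
  by clear -ee re r0 e1 e11 n1 n2 n3 n4 n5 n6 n7 n8 n9 n10 n11 n12; apply/andP; split; lra.
apply: le_trans eE; apply: le_trans t2.
rewrite (_ : t ^+ 2 - 1 = (t - 1) * (t + 1)); last ring.
by rewrite normrM ler_peMr // ger0_norm; move: t0; clear; lra.
Qed.

(** The difference of the arcs times their sum is a difference of squares, and the sum is at least
    [m]. *)
Lemma arc_lip (m l t t' y y' : R) (p0 : P) : 0 < m -> m <= 1 -> l = m ^+ 2 / 32 ->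
  p0.1 ^+ 2 + p0.2 ^+ 2 = 1 -> m <= `|p0.2| -> `|t - 1| <= l -> `|t' - 1| <= l ->
  `|y - p0.1| <= 5 / 2 * l -> `|y' - p0.1| <= 5 / 2 * l ->
  `|arc t y - arc t' y'| <= 4 / m * (`|t - t'| + `|y - y'|).
Proof.
move=> m0 m1 lE u mp tl tl' yl yl'.
have [w0 /andP[a1 a2] _ /andP[t1 t2] y2] := arc_region m0 m1 lE u mp tl yl.
have [w0' /andP[a1' a2'] _ /andP[t1' t2'] y2'] := arc_region m0 m1 lE u mp tl' yl'.
have E : (arc t y - arc t' y') * (arc t y + arc t' y') = (t + t') * (t - t') - (y + y') * (y - y').
  have := arc_sqr w0; have := arc_sqr w0'; rewrite !expr2 => h1 h2.
  rewrite (_ : _ * _ = arc t y * arc t y - arc t' y' * arc t' y'); last ring.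
  by rewrite h1 h2; ring.
have s0 : m <= arc t y + arc t' y' by lra.
have sp : 0 < arc t y + arc t' y' by lra.
rewrite mulrAC ler_pdivlMr //.
apply: (@le_trans _ _ (`|arc t y - arc t' y'| * (arc t y + arc t' y'))); first by rewrite ler_wpM2l.
rewrite -[X in _ * X](gtr0_norm sp) -normrM E.
have h1 : `|(t + t') * (t - t')| <= 4 * `|t - t'|.
  by apply: normM_le => //; rewrite ger0_norm; lra.
have h2 : `|(y + y') * (y - y')| <= 4 * `|y - y'|.
  by apply: normM_le => //; apply: (le_trans (ler_normD _ _)); lra.
by apply: (le_trans (ler_normB _ _)); lra.
Qed.

End Circumcircle.

(** * Lower bound at the starting scale *)

Section Start.
Variable R : realType.
Local Notation P := (R * R)%type.
Local Notation dy := (@dyadic R).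

(** At radius [ts] and at the [v] corresponding to [c.1], the curve of [x] has height exactly
    [c.2 + 1]. Errors [rho] in both parameters move it by at most [8 * rho / m <= eps / 8], which
    the margin [eps / 4] around [b] absorbs. *)
Lemma circ_hit (m l s t ts v b eps rho : R) (p x c : P) :
  0 < m -> m <= 1 -> l = m ^+ 2 / 32 -> p.1 ^+ 2 + p.2 ^+ 2 = 1 -> m <= `|p.2| ->
  s = 1 \/ s = -1 -> s * p.2 = `|p.2| ->
  inbox x p l -> `|c.1| <= l / 8 -> `|c.2| <= l / 8 -> `|ts - 1| <= l / 4 -> 0 <= ts ->
  sqd x c = ts ^+ 2 -> `|t - 1| <= l -> 0 < eps -> 0 <= rho -> rho <= 1 / 64 -> 8 * rho <= m * (eps / 8) ->
  `|t - ts| <= rho -> `|v - (c.1 / l + 2^-1)| <= rho ->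
  c.2 + 1 - 3 / 4 * eps <= b <= c.2 + 1 - eps / 4 ->
  0 < circ s l t x v - b <= eps.
Proof.
move=> m0 m1 lE u mp sE sp /andP[x1 x2] c1 c2 ts1 ts0 xc t1 e0 r0 r64 rm tts vv /andP[b1 b2].
have mm0 : 0 < m ^+ 2 by rewrite exprn_gt0.
have mm1 : m ^+ 2 <= 1 by rewrite exprn_ile1 // ltW.
have m2 : m ^+ 2 <= m by rewrite expr2 ler_piMl // ltW.
have l0 : 0 < l by rewrite lE; lra.
have l1 : l <= 1 / 32 by rewrite lE; lra.
have lm : l <= m / 32 by rewrite lE; lra.
have ss : s * s = 1 by case: sE => ->; ring.
have s1 : `|s| = 1 by case: sE => ->; rewrite ?normrN normr1.
pose d := l * (v - 2^-1) - c.1.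
have dl : `|d| <= l * rho.
  rewrite /d (_ : _ - _ = l * (v - (c.1 / l + 2^-1))); last by field; rewrite gt_eqF.
  by rewrite normrM (gtr0_norm l0) ler_pM2l.
have lr : l * rho <= rho /\ l * rho <= l / 64.
  by split; [rewrite ler_piMl //; move: l1; clear; lra | rewrite ler_pM2l //; move: r64; clear; lra].
have [lr1 lr2] := lr.
have yE : x.1 - l * (v - 2^-1) = (x.1 - c.1) - d by rewrite /d; ring.
clearbody d.
have ys : `|(x.1 - c.1) - p.1| <= 5 / 2 * l.
  rewrite (_ : _ - p.1 = (x.1 - p.1) - c.1); last ring.
  by apply: (normB_le x1 c1); move: l0; clear; lra.
have yd : `|(x.1 - c.1) - d - p.1| <= 5 / 2 * l.
  rewrite (_ : _ - p.1 = (x.1 - p.1) - (c.1 + d)); last ring.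
  apply: (normB_le x1 (_ : _ <= l / 8 + l / 64)); last by move: l0; clear; lra.
  by apply: (le_trans (ler_normD _ _)); move: c1 dl lr2; clear; lra.
have ts1' : `|ts - 1| <= l by move: ts1 l0; clear; lra.
have arcE : arc ts (x.1 - c.1) = s * (x.2 - c.2).
  rewrite /arc -xc /sqd addrAC subrr add0r sqrtr_sqr.
  have -> : x.2 - c.2 = s * (`|p.2| + s * (x.2 - p.2 - c.2)).
    rewrite -sp mulrDr !mulrA ss; ring.
  rewrite normrM s1 mul1r mulrA ss mul1r ger0_norm //.
  have : `|s * (x.2 - p.2 - c.2)| <= l + l / 8.
    by rewrite normrM s1 mul1r; apply: (normB_le x2 c2); clear; lra.
  by rewrite ler_norml; move: mp lm m0; clear => ? ? ? /andP[? ?]; lra.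
have key := @arc_lip R m l ts t (x.1 - c.1) ((x.1 - c.1) - d) p m0 m1 lE u mp ts1' t1 ys yd.
have : `|s * (arc ts (x.1 - c.1) - arc t (x.1 - c.1 - d))| <= eps / 8.
  rewrite normrM s1 mul1r; apply: (le_trans key).
  rewrite (_ : x.1 - c.1 - (x.1 - c.1 - d) = d); last ring.
  rewrite (distrC ts) mulrAC ler_pdivrMr //; move: tts dl lr1 rm; clear; lra.
rewrite ler_norml /circ yE => /andP[h1 h2].
set a := arc t _ in h1 h2 *.
have -> : x.2 - s * a + 1 - b = (c.2 + 1 - b) + s * (arc ts (x.1 - c.1) - a).
  by rewrite mulrBr arcE mulrA ss; ring.
by move: b1 b2 h1 h2 e0; clear => *; apply/andP; split; lra.
Qed.

(** On this window [chi] is at least 3/16. Its sides are [rho] and [eps / 2], and [4 <= M * rho]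
    ensures that the two nodes lost in [count_itv] are at most half of those present. *)
Lemma window_weight (M : nat) (v b rho eps : R) : 3 / 8 <= v <= 5 / 8 -> 3 / 4 <= b <= 5 / 4 ->
  0 < rho -> rho <= 1 / 64 -> 2 * rho <= eps -> eps <= 1 / 2 -> 4 <= M%:R * rho ->
  3 / 128 * (rho * eps) <= \sum_(g : grid M) wt R g *
    ((v <= node R M g.1 < v + rho) && (b - 3 / 4 * eps <= ord2 R g < b - eps / 4))%R%:R.
Proof.
move=> /andP[v1 v2] /andP[b1 b2] r0 r64 re e2 Mr.
have M0 : (0 < M)%N by case: M Mr => //; rewrite mul0r => h; lra.
have Mr0 : 0 < M%:R :> R by rewrite ltr0n.
have M1 : M%:R / M%:R = 1 :> R by rewrite divff // gt_eqF.
have JM : (2 * M)%:R / M%:R = 2 :> R by rewrite natrM mulfK // gt_eqF.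
pose A (i : nat) : R := (v <= node R M i < v + rho)%R%:R.
pose B (j : nat) : R := (b - 3 / 4 * eps <= j%:R / M%:R < b - eps / 4)%R%:R.
have -> : \sum_(g : grid M) wt R g *
    ((v <= node R M g.1 < v + rho) && (b - 3 / 4 * eps <= ord2 R g < b - eps / 4))%R%:R =
   ((\sum_(i < M) chi R M i * A i) / M%:R) * ((\sum_(j < 2 * M) B j) / M%:R).
  rewrite mulrACA big_distrlr /= pair_bigA /= mulr_suml; apply: eq_bigr => g _.
  by rewrite /wt /A /B /ord2 -mulnb natrM; ring.
have hA : 3 / 16 * (rho / 2) <= (\sum_(i < M) chi R M i * A i) / M%:R.
  have := @count_itv R M M v (v + rho) M0
    ltac:(move: v1; clear; lra) ltac:(move: r0; clear; lra) ltac:(rewrite M1; move: v2 r64; clear; lra).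
  rewrite (_ : v + rho - v = rho); last ring.
  set S := \sum_(_ < _) _ => hS.
  have : 3 / 16 * S <= \sum_(i < M) chi R M i * A i.
    rewrite /S mulr_sumr; apply: ler_sum => i _; rewrite /A -/(node R M i).
    case: (boolP (v <= node R M i < v + rho)) => [/andP[n1 n2]|_]; last by rewrite !mulr0.
    by rewrite !mulr1 /chi -/(node R M i); nra.
  move=> h3; rewrite ler_pdivlMr //; apply: le_trans h3; lra.
have hB : eps / 4 <= (\sum_(j < 2 * M) B j) / M%:R.
  have := @count_itv R M (2 * M) (b - 3 / 4 * eps) (b - eps / 4) M0 ltac:(lra) ltac:(lra) ltac:(rewrite JM; lra).
  have -> : b - eps / 4 - (b - 3 / 4 * eps) = eps / 2 by field.
  have : M%:R * (2 * rho) <= M%:R * eps by rewrite ler_pM2l.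
  move=> h1 h2; rewrite ler_pdivlMr //; apply: le_trans h2; lra.
rewrite (_ : 3 / 128 * _ = (3 / 16 * (rho / 2)) * (eps / 4)); last by field.
by apply: ler_pM => //; lra.
Qed.

Lemma triple_expand M mu1 u1 mu2 u2 mu3 u3 k :
  @triple R M mu1 u1 mu2 u2 mu3 u3 k = (dy k)^-1 ^+ 3 *
   \sum_(e1 <- mu1) \sum_(e2 <- mu2) \sum_(e3 <- mu3) e1.1 * e2.1 * e3.1 *
     \sum_(g : grid M) wt R g * ((0 < u1 e1.2 (node R M g.1) - ord2 R g <= dy k)%R%:R *
        (0 < u2 e2.2 (node R M g.1) - ord2 R g <= dy k)%R%:R *
        (0 < u3 e3.2 (node R M g.1) - ord2 R g <= dy k)%R%:R).
Proof.
under eq_bigr do under eq_bigr do under eq_bigr do rewrite mulr_sumr.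
under eq_bigr do under eq_bigr do rewrite exchange_big /=.
under eq_bigr do rewrite exchange_big /=.
rewrite exchange_big /= mulr_sumr; apply: eq_bigr => g _.
rewrite /avgt /avg /mass; set d := (dy k)^-1.
set X := \sum_(e <- mu1) _; set Y := \sum_(e <- mu2) _; set Z := \sum_(e <- mu3) _.
rewrite (_ : wt R g * _ = d ^+ 3 * (wt R g * (X * (Y * Z)))); last by ring.
congr (_ * _); rewrite /X mulr_suml mulr_sumr; apply: eq_bigr => e1 _.
rewrite /Y mulr_suml !mulr_sumr; apply: eq_bigr => e2 _.
rewrite /Z !mulr_sumr; apply: eq_bigr => e3 _.
by ring.
Qed.

End Start.

Section CircleStart.
Variable R : realType.
Local Notation P := (R * R)%type.
Local Notation dy := (@dyadic R).

Lemma ler_sum3 (T : eqType) (s1 s2 s3 : seq T) (f g : T -> T -> T -> R) :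
  (forall a b c, a \in s1 -> b \in s2 -> c \in s3 -> f a b c <= g a b c) ->
  \sum_(a <- s1) \sum_(b <- s2) \sum_(c <- s3) f a b c <=
  \sum_(a <- s1) \sum_(b <- s2) \sum_(c <- s3) g a b c.
Proof.
move=> h; rewrite big_seq [leRHS]big_seq; apply: ler_sum => a aS.
rewrite big_seq [leRHS]big_seq; apply: ler_sum => b bS.
by rewrite big_seq [leRHS]big_seq; apply: ler_sum => c cS; exact: h.
Qed.

Lemma sum3_distr (T : eqType) (s1 s2 s3 : seq T) (f g h : T -> R) :
  (\sum_(a <- s1) f a) * (\sum_(b <- s2) g b) * (\sum_(c <- s3) h c) =
  \sum_(a <- s1) \sum_(b <- s2) \sum_(c <- s3) f a * g b * h c.
Proof.
rewrite -mulrA mulr_suml; apply: eq_bigr => a _.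
rewrite mulr_suml mulr_sumr; apply: eq_bigr => b _.
by rewrite !mulr_sumr; apply: eq_bigr => c _; rewrite mulrA.
Qed.

Definition conf (m s : R) (p : P) :=
  [/\ p.1 ^+ 2 + p.2 ^+ 2 = 1, m <= `|p.2|, s = 1 \/ s = -1 & s * p.2 = `|p.2|].

Definition wmeas (p : P) (r h : R) (mu : seq (R * P)) :=
  [/\ forall e, e \in mu -> 0 <= e.1, on (fun x => inbox x p r) mu & \sum_(e <- mu) e.1 = h].

(* Triples are classified by circumradius into O(2^k) windows; by pigeonhole one window
   carries a fixed proportion of the mass, and every radius in it sees all those triples. *)
Lemma circ_start (m l s1 s2 s3 r h1 h2 h3 : R) (p1 p2 p3 : P) :
  0 < m -> m <= 1 -> l = m ^+ 2 / 32 -> conf m s1 p1 -> conf m s2 p2 -> conf m s3 p3 ->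
  r <= l ->
  (forall x y z, inbox x p1 r -> inbox y p2 r -> inbox z p3 r ->
    [/\ det2 (psub x z) (psub y z) != 0, `|(circumcentre x y z).1| <= l / 8, `|(circumcentre x y z).2| <= l / 8 &
        `|circumradius x y z - 1| <= l / 4]) ->
  0 < h1 -> 0 < h2 -> 0 < h3 ->
  exists2 c0 : R, 0 < c0 & forall k, (0 < k)%N -> exists (L : nat) (T : nat -> R) (rho : R) (M0 : nat),
    0 < rho /\ forall mu1 mu2 mu3, wmeas p1 r h1 mu1 -> wmeas p2 r h2 mu2 -> wmeas p3 r h3 mu3 ->
    forall M, (M0 <= M)%N -> exists2 n, (n < L)%N & forall t, T n < t < T n + rho ->
      `|t - 1| <= l /\ c0 <= triple M mu1 (circ s1 l t) mu2 (circ s2 l t) mu3 (circ s3 l t) k.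
Proof.
move=> m0 m1 lE cf1 cf2 cf3 rl Hc h10 h20 h30.
have mm0 : 0 < m ^+ 2 by rewrite exprn_gt0.
have mm1 : m ^+ 2 <= 1 by rewrite exprn_ile1 // ltW.
have l0 : 0 < l by rewrite lE; move: mm0; clear; lra.
have l1 : l <= 1 / 32 by rewrite lE; move: mm1; clear; lra.
pose H := h1 * h2 * h3; have H0 : 0 < H by rewrite !mulr_gt0.
pose q := m * l / 64.
have q0 : 0 < q by rewrite divr_gt0 ?mulr_gt0 //; clear; lra.
have ml : m * l <= l by rewrite ler_piMl // ltW.
have qm : q <= m / 64 by rewrite /q -ler_pdivlMr ?invr_gt0 //; have : m * l <= m; [rewrite ler_piMr ?(ltW m0) //; move: l1; clear; lra | move: m0; clear => ? ?; lra].
have ql : q <= l / 64 by move: ml; rewrite /q; clear; lra.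
(* The three averages give [eps ^- 3], the window [rho * eps], and the pigeonhole a further [rho].
   With [rho = eps * q] the powers of [eps] cancel, so this bound does not depend on [k], and the
   starting scale can be chosen after it. *)
exists (3 / 128 * (q ^+ 2 * H)); first by rewrite mulr_gt0 // ?mulr_gt0 ?exprn_gt0 //; clear; lra.
move=> k k0; set eps := dy k.
have e0 : 0 < eps by exact: dy_gt0.
have e2 : eps <= 1 / 2.
  by apply: (le_trans (dy_le R k0)); rewrite /dyadic expr1; clear; lra.
pose rho := eps * q.
have r0 : 0 < rho by rewrite mulr_gt0.
have rq : rho <= q by rewrite /rho ler_piMl ?(ltW q0) //; move: e2; clear; lra.
have rl' : rho <= l / 64 by exact: le_trans ql.
have r64 : rho <= 1 / 64 by move: rl' l1; clear; lra.
have re : 2 * rho <= eps.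
  have : rho <= eps * (1 / 2) by rewrite /rho ler_pM2l //; move: ql l1; clear; lra.
  by clear; lra.
have rm : 8 * rho <= m * (eps / 8).
  have : rho <= eps * (m / 64) by rewrite /rho ler_pM2l.
  by clear; lra.
pose T (n : nat) : R := 1 - l / 4 + n%:R * rho.
pose L := (Num.truncn (l / 2 / rho)).+1.
have lr0 : 0 <= l / 2 / rho by rewrite !divr_ge0 ?(ltW l0) ?(ltW r0).
have L1 : rho <= L%:R^-1.
  have Lp : 0 < L%:R :> R by rewrite ltr0n.
  rewrite -[leRHS]mul1r ler_pdivlMr // /L -natr1 mulrDr mulr1.
  have : (Num.truncn (l / 2 / rho))%:R <= l / 2 / rho by rewrite truncn_le.
  rewrite ler_pdivlMr // => h; rewrite mulrC; apply: le_trans (lerD h (lexx _)) _.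
  by move: r64 l1; clear; lra.
exists L, T, rho, (Num.truncn (4 / rho)).+1; split=> //.
move=> mu1 mu2 mu3 [n1 on1 hh1] [n2 on2 hh2] [n3 on3 hh3] M MM.
have Mr : 4 <= M%:R * rho.
  rewrite -ler_pdivrMr //; have h : 0 <= 4 / rho by rewrite divr_ge0 // ltW.
  have /andP[_ /ltW h'] := truncn_itv h; apply: (le_trans h').
  by rewrite ler_nat.
pose cls n (a b c : R * P) : R := (T n <= circumradius a.2 b.2 c.2 < T n + rho)%R%:R.
pose F n := \sum_(a <- mu1) \sum_(b <- mu2) \sum_(c <- mu3) a.1 * b.1 * c.1 * cls n a b c.
have HF : H <= \sum_(n < L) F n.
  rewrite /H -hh1 -hh2 -hh3 sum3_distr /F [leRHS]exchange_big /=.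
  under [leRHS]eq_bigr do rewrite exchange_big /=.
  under [leRHS]eq_bigr do under eq_bigr do rewrite exchange_big /=.
  apply: ler_sum3 => a b c am bm cm.
  rewrite -mulr_sumr -[leLHS]mulr1 ler_wpM2l ?mulr_ge0 ?(n1 _ am) ?(n2 _ bm) ?(n3 _ cm) //.
  have [_ _ _] := Hc _ _ _ (on1 _ am) (on2 _ bm) (on3 _ cm).
  set w := circumradius _ _ _; rewrite ler_norml => /andP[w1 w2].
  have w0 : 0 <= (w - 1 + l / 4) / rho by rewrite divr_ge0 ?(ltW r0) //; move: w1; clear; lra.
  pose N := Num.truncn ((w - 1 + l / 4) / rho).
  have nL : (N < L)%N.
    by rewrite /L ltnS; apply: le_truncn; rewrite ler_pM2r ?invr_gt0 //; move: w2; clear; lra.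
  rewrite (bigD1 (Ordinal nL)) //= -[leLHS]addr0; apply: lerD; last by apply: sumr_ge0 => i _; rewrite ler0n.
  have /andP[] := truncn_itv w0; rewrite -/N ler_pdivlMr // ltr_pdivrMr // -(natr1 N) => v1 v2.
  clearbody N; rewrite /cls -/w /T /=.
  have -> : 1 - l / 4 + N%:R * rho <= w by move: v1; set z := _ * rho; clear; lra.
  have -> : w < 1 - l / 4 + N%:R * rho + rho.
    by move: v2; rewrite mulrDl mul1r; set z := N%:R * rho; clear; lra.
  exact: lexx.
have [n nL Fn] := pigeonhole_sum (ltn0Sn _) HF.
exists n => // t /andP[t1 t2].
have t1' : `|t - 1| <= l.
  have : n%:R * rho <= l / 2.
    rewrite -ler_pdivlMr //; apply: le_trans (_ : (Num.truncn (l / 2 / rho))%:R <= _).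
      by rewrite ler_nat -ltnS.
    by rewrite truncn_le.
  have : 0 <= n%:R * rho by rewrite mulr_ge0 // ltW.
  move: t1 t2 l0 rl'; rewrite /T; set z := n%:R * rho; clear => *.
  by rewrite ler_norml; apply/andP; split; lra.
split=> //; rewrite triple_expand -/eps.
pose W := 3 / 128 * (rho * eps).
have W0 : 0 < W by rewrite !mulr_gt0 //; clear; lra.
apply: (@le_trans _ _ (eps^-1 ^+ 3 * (W * F n))).
  apply: (@le_trans _ _ (eps^-1 ^+ 3 * (W * (H * rho)))).
    rewrite /W /rho le_eqVlt; apply/orP; left; apply/eqP; field.
    by rewrite gt_eqF.
  rewrite ler_pM2l ?exprn_gt0 ?invr_gt0 // ler_pM2l //; apply: le_trans Fn.
  by rewrite ler_pM2l.
rewrite ler_pM2l ?exprn_gt0 ?invr_gt0 //.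
rewrite /F mulr_sumr; under eq_bigr do rewrite mulr_sumr.
under eq_bigr do under eq_bigr do rewrite mulr_sumr.
apply: ler_sum3 => a b c am bm cm.
rewrite mulrCA ler_wpM2l ?mulr_ge0 ?(n1 _ am) ?(n2 _ bm) ?(n3 _ cm) // /cls.
have ind0 (g : grid M) : 0 <= wt R g * ((0 < circ s1 l t a.2 (node R M g.1) - ord2 R g <= eps)%R%:R *
   (0 < circ s2 l t b.2 (node R M g.1) - ord2 R g <= eps)%R%:R *
   (0 < circ s3 l t c.2 (node R M g.1) - ord2 R g <= eps)%R%:R).
  by apply: mulr_ge0; [exact: wt_ge0 | rewrite -!natrM ler0n].
case: (boolP (T n <= circumradius a.2 b.2 c.2 < T n + rho)) => [/andP[w1 w2]|_]; last first.
  by rewrite mulr0 sumr_ge0.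
rewrite mulr1.
have xa := on1 _ am; have xb := on2 _ bm; have xc := on3 _ cm.
have [D0 c1 c2 w3] := Hc _ _ _ xa xb xc.
have [da db dc] := circumcentre_dist D0.
set C := circumcentre a.2 b.2 c.2 in c1 c2 da db dc; set ts := circumradius a.2 b.2 c.2 in w1 w2 w3 da db dc.
have ts0 : 0 <= ts by exact: sqrtr_ge0.
have tts : `|t - ts| <= rho.
  by move: t1 t2 w1 w2; clear => *; rewrite ler_norml; apply/andP; split; lra.
pose v := C.1 / l + 2^-1; pose b0 := C.2 + 1.
have v38 : 3 / 8 <= v <= 5 / 8.
  have : `|C.1 / l| <= 1 / 8.
    rewrite normrM normfV (gtr0_norm l0) ler_pdivrMr //; move: c1; clear; lra.
  by rewrite ler_norml /v; clear => /andP[? ?]; apply/andP; split; lra.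
have b34 : 3 / 4 <= b0 <= 5 / 4.
  by move: c2 l1; rewrite ler_norml /b0; clear => /andP[? ?] ?; apply/andP; split; lra.
apply: (le_trans (window_weight v38 b34 r0 r64 re e2 Mr)).
apply: ler_sum => g _.
case: (boolP (_ && _)) => [/andP[/andP[g1 g2] /andP[g3 g4]]|_]; last by rewrite mulr0.
have vv : `|node R M g.1 - v| <= rho.
  by move: g1 g2 r0; clear => *; rewrite ler_norml; apply/andP; split; lra.
have bb : C.2 + 1 - 3 / 4 * eps <= ord2 R g <= C.2 + 1 - eps / 4 by rewrite g3 ltW.
have up (x p : P) : inbox x p r -> inbox x p l by exact: inbox_le.
have [u1 mp1 sE1 sp1] := cf1; have [u2 mp2 sE2 sp2] := cf2; have [u3 mp3 sE3 sp3] := cf3.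
have hit s p x : conf m s p -> inbox x p r -> sqd x C = ts ^+ 2 ->
    0 < circ s l t x (node R M g.1) - ord2 R g <= eps.
  move=> [u mp sE sp] xp xC.
  exact: (circ_hit m0 m1 lE u mp sE sp (up _ _ xp) c1 c2 w3 ts0 xC t1' e0 (ltW r0) r64 rm tts vv bb).
by rewrite (hit _ _ _ cf1 xa da) (hit _ _ _ cf2 xb db) (hit _ _ _ cf3 xc dc) !mulr1.
Qed.

End CircleStart.

(** * The interval of radii *)

Section Radii.
Variable R : realType.
Local Notation P := (R * R)%type.
Local Notation dy := (@dyadic R).

Lemma inbox_trans (p q x : P) r s : inbox p q r -> inbox q x s -> inbox p x (r + s).
Proof.
move=> /andP[h1 h2] /andP[h3 h4]; apply/andP; split.
  by apply: (le_trans (ler_distD q.1 _ _)); exact: lerD.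
by apply: (le_trans (ler_distD q.2 _ _)); exact: lerD.
Qed.

Lemma compact_square (B : R) : compact [set c : P | `|c.1| <= B /\ `|c.2| <= B].
Proof.
have := compact_setX (@segment_compact R (- B) B) (@segment_compact R (- B) B).
congr compact; apply/seteqP; split=> c /=; rewrite /= !in_itv /= -!ler_norml; by case.
Qed.

Lemma diam1_box (p : P) (r : R) (E : set P) : r <= 1 / 2 -> diam1 (fun x => E x /\ inbox x p r).
Proof.
move=> r2 x y [_ xp] [_ yp]; rewrite inboxC in yp.
by apply: inbox_le (inbox_trans xp yp); lra.
Qed.

Definition near_circle (E : set P) (p1 p2 p3 : P) (r t : R) (n : nat) (x y z c : P) : Prop :=
  [/\ (E x /\ inbox x p1 r), (E y /\ inbox y p2 r) & (E z /\ inbox z p3 r)] /\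
  [/\ (`|c.1| <= 2 /\ `|c.2| <= 2), `|sqd x c - t ^+ 2| <= 5 * dy n,
      `|sqd y c - t ^+ 2| <= 5 * dy n & `|sqd z c - t ^+ 2| <= 5 * dy n].

Lemma sqd_close (x c x' c' : P) (e : R) : e <= 1 -> `|x.1| <= 2 -> `|x.2| <= 2 ->
  `|c.1| <= 2 -> `|c.2| <= 2 -> inbox x x' e -> inbox c c' e ->
  `|sqd x' c' - sqd x c| <= 40 * e.
Proof.
move=> e1 x1 x2 c1 c2 /andP[xx1 xx2] /andP[cc1 cc2].
have h (a b a' b' : R) : `|a| <= 2 -> `|b| <= 2 -> `|a - a'| <= e -> `|b - b'| <= e ->
    `|(a' - b') ^+ 2 - (a - b) ^+ 2| <= 20 * e.
  move=> ha hb ha' hb'.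
  rewrite (_ : _ - _ = ((b - b') - (a - a')) * ((2 * a - 2 * b) - ((a - a') - (b - b')))); last by ring.
  have h1 := normB_le hb' ha' (lexx _).
  have h2 := normB_le ha' hb' (lexx _).
  have ha2 : `|2 * a| <= 4 by rewrite normrM ger0_norm //; move: ha; clear; lra.
  have hb2 : `|2 * b| <= 4 by rewrite normrM ger0_norm //; move: hb; clear; lra.
  have h3 := normB_le ha2 hb2 (lexx _).
  have e0 : 0 <= e by apply: le_trans (normr_ge0 _) ha'.
  have h4 : `|(2 * a - 2 * b) - ((a - a') - (b - b'))| <= 10.
    by apply: (normB_le h3 h2); move: e1; clear; lra.
  by apply: (le_trans (normM_le h1 h4)); clear; lra.
have h1 := h _ _ _ _ x1 c1 xx1 cc1; have h2 := h _ _ _ _ x2 c2 xx2 cc2.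
rewrite /sqd; set A := (x'.1 - _) ^+ 2 in h1 *; set A' := (x.1 - _) ^+ 2 in h1 *.
set B := (x'.2 - _) ^+ 2 in h2 *; set B' := (x.2 - _) ^+ 2 in h2 *.
rewrite (_ : _ - _ = (A - A') + (B - B')); last by ring.
by apply: (le_trans (ler_normD _ _)); move: h1 h2; clear; lra.
Qed.

Lemma near_circle_limit (E : set P) (p1 p2 p3 : P) (r t : R) : compact E -> 0 < r -> r <= 1 ->
  `|p1.1| <= 1 -> `|p1.2| <= 1 -> `|p2.1| <= 1 -> `|p2.2| <= 1 -> `|p3.1| <= 1 -> `|p3.2| <= 1 ->
  (forall n, exists x y z c, near_circle E p1 p2 p3 r t n x y z c) ->
  exists x y z c, [/\ E x, E y & E z] /\
    [/\ inbox x p1 (2 * r), inbox y p2 (2 * r) & inbox z p3 (2 * r)] /\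
    [/\ sqd x c = t ^+ 2, sqd y c = t ^+ 2 & sqd z c = t ^+ 2].
Proof.
move=> cE r0 r1 a1 b1 a2 b2 a3 b3 H.
have dS n : dy n.+1 <= dy n by apply: dy_le.
have nS n x y z c : near_circle E p1 p2 p3 r t n.+1 x y z c -> near_circle E p1 p2 p3 r t n x y z c.
  move=> [? [? h1 h2 h3]]; have d5 : 5 * dy n.+1 <= 5 * dy n by rewrite ler_pM2l.
  by split=> //; split=> //; apply: le_trans d5.
have iS n x y : inbox x y (dy n.+1) -> inbox x y (dy n) by exact: inbox_le.
pose Q1 n x (w : P * P * P) := near_circle E p1 p2 p3 r t n x w.1.1 w.1.2 w.2.
have [||x [Ex Hx]] := @limit_point R E _ Q1 cE.
- by move=> n; have [x [y [z [c h]]]] := H n; exists x, (y, z, c); split=> //; case: h => -[[]].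
- by move=> n p w; exact: nS.
pose Q2 n y (w : P * P) := exists2 x', inbox x' x (dy n) & near_circle E p1 p2 p3 r t n x' y w.1 w.2.
have [||y [Ey Hy]] := @limit_point R E _ Q2 cE.
- move=> n; have [x' [[[y z] c] [xx h]]] := Hx n; exists y, (z, c); split; last by exists x'.
  by case: h => -[_ []].
- by move=> n p w [x' /iS xx h]; exists x' => //; exact: nS.
pose Q3 n z (c : P) := exists x' y', [/\ inbox x' x (dy n), inbox y' y (dy n) &
  near_circle E p1 p2 p3 r t n x' y' z c].
have [||z [Ez Hz]] := @limit_point R E _ Q3 cE.
- move=> n; have [y' [[z c] [yy [x' xx h]]]] := Hy n; exists z, c; split; last by exists x', y'.
  by case: h => -[_ _ []].
- by move=> n p w [x' [y' [/iS xx /iS yy h]]]; exists x', y'; split=> //; exact: nS.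
pose Q4 n c (_ : unit) := exists x' y' z', [/\ inbox x' x (dy n), inbox y' y (dy n),
  inbox z' z (dy n) & near_circle E p1 p2 p3 r t n x' y' z' c].
have [||c [_ Hc]] := @limit_point R _ _ Q4 (@compact_square 2).
- move=> n; have [z' [c [zz [x' [y' [xx yy h]]]]]] := Hz n; exists c, tt.
  by split; [case: h => _ [] | exists x', y', z'].
- by move=> n p w [x' [y' [z' [/iS xx /iS yy /iS zz h]]]]; exists x', y', z'; split=> //; exact: nS.
exists x, y, z, c; split=> //; split.
  have [n hn] := dy_small r0; have [c' [_ [_ [x' [y' [z' [xx yy zz [[[_ h1] [_ h2] [_ h3]] _]]]]]]]] := Hc n.
  rewrite inboxC in xx; rewrite inboxC in yy; rewrite inboxC in zz.
  have k : dy n + r <= 2 * r by lra.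
  by split; apply: inbox_le k _; [exact: inbox_trans h1|exact: inbox_trans h2|exact: inbox_trans h3].
have lim (p q : P) : `|p.1| <= 1 -> `|p.2| <= 1 -> (forall n, exists q' c', [/\ inbox q' q (dy n), inbox c' c (dy n),
    inbox q' p r, (`|c'.1| <= 2 /\ `|c'.2| <= 2) & `|sqd q' c' - t ^+ 2| <= 5 * dy n]) ->
    sqd q c = t ^+ 2.
  (* 45 is 40, for moving both points to their limits, plus 5 from [near_circle]. *)
  move=> pa pb hq; apply/eqP; rewrite -subr_eq0; apply/eqP; apply: (@le0_dy R 45) => n.
  have [q' [c' [qq circumcentre /andP[q1 q2] [c1 c2] h]]] := hq n.
  have q1' : `|q'.1| <= 2.
    by have := ler_normD (q'.1 - p.1) p.1; rewrite subrK; move: q1 pa r1; clear; lra.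
  have q2' : `|q'.2| <= 2.
    by have := ler_normD (q'.2 - p.2) p.2; rewrite subrK; move: q2 pb r1; clear; lra.
  have := sqd_close (dy_le1 R n) q1' q2' c1 c2 qq circumcentre.
  move=> h'; rewrite (_ : _ - _ = (sqd q c - sqd q' c') + (sqd q' c' - t ^+ 2)); last by ring.
  by apply: (le_trans (ler_normD _ _)); move: h h'; clear; lra.
split.
- apply: (lim p1) => // n; have [c' [_ [cc' [x' [y' [z' [xx yy zz [[[_ h1] [_ h2] [_ h3]] [cb k1 k2 k3]]]]]]]]] := Hc n.
  by exists x', c'.
- apply: (lim p2) => // n; have [c' [_ [cc' [x' [y' [z' [xx yy zz [[[_ h1] [_ h2] [_ h3]] [cb k1 k2 k3]]]]]]]]] := Hc n.
  by exists y', c'.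
- apply: (lim p3) => // n; have [c' [_ [cc' [x' [y' [z' [xx yy zz [[[_ h1] [_ h2] [_ h3]] [cb k1 k2 k3]]]]]]]]] := Hc n.
  by exists z', c'.
Qed.

(** Converse of [circ_hit]: if the curve passes above [b] at height [d <= e], the squared distance
    misses [t ^ 2] by [(2 * s * a + d) * d], where the arc [a] is at most 2. *)
Lemma circ_near (m l s t v b e : R) (p x : P) : 0 < m -> m <= 1 -> l = m ^+ 2 / 32 -> conf m s p ->
  inbox x p l -> `|t - 1| <= l -> 0 <= v <= 1 -> e <= 1 -> 0 < circ s l t x v - b <= e ->
  `|sqd x (l * (v - 2^-1), b - 1) - t ^+ 2| <= 5 * e.
Proof.
move=> m0 m1 lE [u mp sE sp] /andP[x1 x2] t1 /andP[v0 v1] e1 /andP[d0 d1].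
have l0 : 0 < l by rewrite lE divr_gt0 ?exprn_gt0.
have ys : `|x.1 - l * (v - 2^-1) - p.1| <= 5 / 2 * l.
  rewrite (_ : _ - p.1 = (x.1 - p.1) - l * (v - 2^-1)); last by ring.
  apply: (normB_le x1 (_ : _ <= l * (1 / 2))); last by move: l0; clear; lra.
  rewrite normrM (gtr0_norm l0) ler_pM2l // ler_norml; move: v0 v1; clear => *.
  by apply/andP; split; lra.
have [w0 /andP[ar1 ar2] _ _ _] := arc_region m0 m1 lE u mp t1 ys.
have aE := arc_sqr w0; have a0 := arc_gt0 w0.
rewrite /sqd /=; move: d0 d1; rewrite /circ.
set y := x.1 - _ in ys aE a0 ar2 *; set a := arc t y in aE a0 ar2 *.
set d := x.2 - s * a + 1 - b => d0 d1.
have -> : x.2 - (b - 1) = s * a + d by rewrite /d; ring.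
have ss : s * s = 1 by case: sE => ->; ring.
have -> : y ^+ 2 + (s * a + d) ^+ 2 - t ^+ 2 = (2 * (s * a) + d) * d.
  rewrite (_ : t ^+ 2 = a ^+ 2 + y ^+ 2); last by rewrite aE subrK.
  have -> : y ^+ 2 + (s * a + d) ^+ 2 - (a ^+ 2 + y ^+ 2) = (s * s - 1) * a ^+ 2 + (2 * (s * a) + d) * d by ring.
  by rewrite ss subrr mul0r add0r.
apply: normM_le; last by rewrite gtr0_norm.
have sa : `|s * a| <= 2 by rewrite normrM (gtr0_norm a0); case: sE => ->; rewrite ?normrN normr1 mul1r.
by move: sa; rewrite !ler_norml; move: d0 d1 e1; clear => ? ? ? /andP[? ?]; apply/andP; split; lra.
Qed.

Lemma conf_sign (m : R) (p : P) : p.1 ^+ 2 + p.2 ^+ 2 = 1 -> m <= `|p.2| -> exists s, conf m s p.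
Proof.
move=> u mp; have [h|h] := leP 0 p.2.
  by exists 1; split=> //; [left|rewrite mul1r ger0_norm].
by exists (-1); split=> //; [right|rewrite mulN1r ltr0_norm].
Qed.

Lemma tail_small (K q c x : R) : 0 <= K -> q < 1 -> 0 <= x -> x < c * (1 - q) / (K + 1) ->
  K * x / (1 - q) < c.
Proof.
move=> K0 q1 x0; have K1 : 0 < K + 1 by lra.
have q' : 0 < 1 - q by lra.
rewrite ltr_pdivlMr // ltr_pdivrMr // => h; apply: le_lt_trans h.
by rewrite mulrDr mulr1 mulrC lerDl.
Qed.

Theorem radii_core (lam : R) (E : set P) (p1 p2 p3 : P) :
  1 / 4 < lam -> lam < 1 / 2 -> 32 * lam ^+ 3 < 1 -> compact E ->
  thick lam E p1 -> thick lam E p2 -> thick lam E p3 ->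
  p1.1 ^+ 2 + p1.2 ^+ 2 = 1 -> p2.1 ^+ 2 + p2.2 ^+ 2 = 1 -> p3.1 ^+ 2 + p3.2 ^+ 2 = 1 ->
  p1.2 != 0 -> p2.2 != 0 -> p3.2 != 0 ->
  det2 (psub p1 p3) (psub p2 p3) != 0 ->
  contains_open_interval (circle_radii E).
Proof.
move=> l4 l2 l3 cE tp1 tp2 tp3 u1 u2 u3 n1 n2 n3 D0.
have lam0 : 0 < lam by lra.
pose m := Num.min 1 (Num.min `|p1.2| (Num.min `|p2.2| `|p3.2|)).
have m0 : 0 < m by rewrite !lt_min ltr01 !normr_gt0 n1 n2 n3.
have m1 : m <= 1 by rewrite ge_min lexx.
have mp1 : m <= `|p1.2| by rewrite !ge_min lexx !orbT.
have mp2 : m <= `|p2.2| by rewrite !ge_min lexx !orbT.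
have mp3 : m <= `|p3.2| by rewrite !ge_min lexx !orbT.
pose l := m ^+ 2 / 32; have lE : l = m ^+ 2 / 32 by [].
have mm0 : 0 < m ^+ 2 by rewrite exprn_gt0.
have mm1 : m ^+ 2 <= 1 by rewrite exprn_ile1 // ltW.
have l0 : 0 < l by rewrite /l; move: mm0; clear; lra.
have l1 : l <= 1 / 32 by rewrite /l; move: mm1; clear; lra.
clearbody m l.
have [s1 c1] := conf_sign u1 mp1; have [s2 c2] := conf_sign u2 mp2; have [s3 c3] := conf_sign u3 mp3.
have l80 : 0 < l / 8 by move: l0; clear; lra.
have [r0 r00 Hr] := circumcentre_near l80 u1 u2 u3 D0.
pose r := Num.min (r0 / 2) l.
have rp : 0 < r by rewrite lt_min l0 andbT; move: r00; clear; lra.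
have rl : r <= l by rewrite ge_min lexx orbT.
have rr0 : 2 * r <= r0.
  have : r <= r0 / 2 by rewrite ge_min lexx.
  by clear; lra.
clearbody r.
have [h1 h10 H1] := thick_measure lam0 l2 tp1 rp.
have [h2 h20 H2] := thick_measure lam0 l2 tp2 rp.
have [h3 h30 H3] := thick_measure lam0 l2 tp3 rp.
have rr1 : r <= r0 by move: rr0 rp; clear; lra.
have [c0 c00 Hstart] := @circ_start R m l s1 s2 s3 r h1 h2 h3 p1 p2 p3 m0 m1 lE c1 c2 c3 rl
  ltac:(move=> x y z hx hy hz; have [q1 q2 q3 q4] := Hr x y z (inbox_le rr1 hx) (inbox_le rr1 hy) (inbox_le rr1 hz);
   split=> //; apply: (le_trans q4); move: l0; clear; lra) h10 h20 h30.
pose kap := l / 32; pose A := 24 * (2 / m) ^+ 5.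
have kap0 : 0 < kap by rewrite /kap; move: l0; clear; lra.
have B1 : 1 <= (2 / m) ^+ 5 by apply: exprn_ege1; rewrite ler_pdivlMr //; move: m1; clear; lra.
have kapA : kap <= A by rewrite /kap /A; move: B1 l1; clear; lra.
have [K [q [K0 q0 q1 Hstep]]] := @triple_step R lam 9 kap A l4 l2 ltac:(by []) kap0 kapA l3.
have qq : 0 < 1 - q by move: q1; clear; lra.
have eps0 : 0 < c0 * (1 - q) / (K + 1) by rewrite divr_gt0 ?mulr_gt0 //; move: K0; clear; lra.
(* The starting scale makes the tail of all later changes smaller than [c0]. The intervals of radii
   are fixed with it, before [N] and the measures. *)
have [k1 hk1] := pow_small (ltW q0) q1 eps0.
pose k0 := k1.+1.
have hk0 := tail_small K0 q1 (exprn_ge0 k0 (ltW q0)) (hk1 k0 (leqnSn _)).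
have [L [T [rho [M0 [rho0 Hs]]]]] := Hstart k0 isT.
pose X p := fun x => E x /\ inbox x p r.
have cv (p : P) s t : conf m s p -> `|t - 1| <= l -> curves kap A (- s) (X p) (circ s l t).
  move=> [u mp sE sp] t1; apply: (curves_sub _ (circle_curves m0 m1 lE u mp t1 sE sp)).
  by move=> x [_]; exact: inbox_le.
have main n : exists2 i, (i < L)%N & forall t, T i < t < T i + rho ->
    `|t - 1| <= l /\ exists x y z c, near_circle E p1 p2 p3 r t n x y z c.
  pose N := (k0 + n)%N.
  have [mu1 [f1 o1 w1]] := H1 N; have [mu2 [f2 o2 w2]] := H2 N; have [mu3 [f3 o3 w3]] := H3 N.
  have wm p h mu : frostman lam 9 N mu -> on (X p) mu -> \sum_(e <- mu) e.1 = h -> wmeas p r h mu.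
    by move=> [f _] o w; split=> // e /o [].
  have [i iL Hi] := Hs mu1 mu2 mu3 (wm _ _ _ f1 o1 w1) (wm _ _ _ f2 o2 w2) (wm _ _ _ f3 o3 w3) (8 ^ N + M0)%N (leq_addl _ _).
  exists i => // t /Hi [t1 tri]; split=> //.
  set M := (8 ^ N + M0)%N in tri.
  have gd p s mu : conf m s p -> frostman lam 9 N mu -> on (X p) mu -> good lam 9 kap A N mu (X p) (- s) (circ s l t).
    move=> cf f o; split=> //; [by apply: diam1_box; move: rl l1; clear; lra|exact: cv|].
    by case: cf => _ _ [->|->] _; [right|left; rewrite opprK].
  have g1 := gd _ _ _ c1 f1 o1; have g2 := gd _ _ _ c2 f2 o2; have g3 := gd _ _ _ c3 f3 o3.
  have := @telescope_pos R (triple M mu1 (circ s1 l t) mu2 (circ s2 l t) mu3 (circ s3 l t)) K q c0 k0 n K0 q0 q1.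
  move=> /(_ _ tri hk0) pos'.
  have pos : 0 < triple M mu1 (circ s1 l t) mu2 (circ s2 l t) mu3 (circ s3 l t) N.
    apply: pos' => k /andP[k0k kN]; apply: (Hstep N M _ _ _ _ _ _ _ _ _ _ _ _ g1 g2 g3) => //.
      by rewrite leq_addr.
    exact: leq_trans k0k.
  have [g gpos] : exists g : grid M, 0 < avgt mu1 (circ s1 l t) N g * avgt mu2 (circ s2 l t) N g * avgt mu3 (circ s3 l t) N g.
    apply: contrapT => no; move: pos; rewrite /triple ltNge => /negP; apply.
    apply: sumr_le0 => g _; apply: mulr_ge0_le0; first exact: wt_ge0.
    by rewrite leNgt; apply/negP => h; apply: no; exists g.
  have [e01 _] := f1; have [e02 _] := f2; have [e03 _] := f3.
  have d0 := dy_gt0 R N.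
  have av mu u : (forall e, e \in mu -> 0 <= e.1) -> 0 <= avgt mu u N g by move=> h; exact: avg_ge0.
  have pos1 mu u : 0 < avgt mu u N g -> exists2 e, e \in mu & 0 < u e.2 (node R M g.1) - ord2 R g <= dy N.
    by rewrite /avgt /avg pmulr_rgt0 ?invr_gt0 // => /mass_gt0.
  have [e1 e1M h1'] : exists2 e, e \in mu1 & 0 < circ s1 l t e.2 (node R M g.1) - ord2 R g <= dy N.
    apply: pos1; rewrite lt_neqAle av // andbT; apply/eqP => z.
    by move: gpos; rewrite -z !mul0r ltxx.
  have [e2 e2M h2'] : exists2 e, e \in mu2 & 0 < circ s2 l t e.2 (node R M g.1) - ord2 R g <= dy N.
    apply: pos1; rewrite lt_neqAle av // andbT; apply/eqP => z.
    by move: gpos; rewrite -z mulr0 mul0r ltxx.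
  have [e3 e3M h3'] : exists2 e, e \in mu3 & 0 < circ s3 l t e.2 (node R M g.1) - ord2 R g <= dy N.
    apply: pos1; rewrite lt_neqAle av // andbT; apply/eqP => z.
    by move: gpos; rewrite -z mulr0 ltxx.
  have [E1 i1] := o1 _ e1M; have [E2 i2] := o2 _ e2M; have [E3 i3] := o3 _ e3M.
  pose v := node R M g.1; pose b := ord2 R g.
  have vb : 0 <= v <= 1 by apply: node_bound; exact: ltnW.
  have bb : 0 <= b <= 2.
    rewrite /b /ord2 divr_ge0 //= ler_pdivrMr; last by rewrite ltr0n /M addn_gt0 expn_gt0.
    by rewrite -natrM ler_nat; exact: ltnW.
  have dN : 5 * dy N <= 5 * dy n by rewrite ler_pM2l // dy_le // leq_addl.
  have nc (s : R) p x : conf m s p -> inbox x p r -> 0 < circ s l t x v - b <= dy N ->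
     `|sqd x (l * (v - 2^-1), b - 1) - t ^+ 2| <= 5 * dy n.
    move=> cf ix h; apply: le_trans dN; apply: (circ_near m0 m1 lE cf (inbox_le rl ix) t1 vb (dy_le1 _ _) h).
  exists e1.2, e2.2, e3.2, (l * (v - 2^-1), b - 1); split; first by split.
  split; [|exact: nc c1 _ _|exact: nc c2 _ _|exact: nc c3 _ _].
  move: vb bb l0 l1; clear => /andP[? ?] /andP[? ?] ? ? /=; split; last by rewrite ler_norml; apply/andP; split; lra.
  have h : `|l * (v - 2^-1)| <= 1 / 32 * 1; last by apply: (le_trans h); lra.
  by apply: normM_le; [rewrite gtr0_norm|rewrite ler_norml; apply/andP; split; lra].
pose Q n i := forall t, T i < t < T i + rho -> `|t - 1| <= l /\ exists x y z c, near_circle E p1 p2 p3 r t n x y z c.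
have [|i iL Hi] := @pigeonhole_level L Q _ main.
  move=> n i h t /h [t1 [x [y [z [c [k1' [k2' k3' k4' k5']]]]]]]; split=> //; exists x, y, z, c; split=> //.
  have d5 : 5 * dy n.+1 <= 5 * dy n by rewrite ler_pM2l // dy_le.
  by split=> //; exact: le_trans d5.
exists (T i), (T i + rho); split; first by rewrite ltrDl.
move=> t /= tI.
have [t1 _] := Hi 0%N t tI.
have unit (p : P) : p.1 ^+ 2 + p.2 ^+ 2 = 1 -> `|p.1| <= 1 /\ `|p.2| <= 1.
  move=> u; have q1' := sqr_ge0 p.1; have q2' := sqr_ge0 p.2.
  by split; rewrite -(@ler_pXn2r _ 2) ?nnegrE // expr1n real_normK ?num_real //; move: u q1' q2'; clear; lra.
have [a1 b1] := unit _ u1; have [a2 b2] := unit _ u2; have [a3 b3] := unit _ u3.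
have r1 : r <= 1 by move: rl l1; clear; lra.
have [|x [y [z [c [[Ex Ey Ez] [[ix iy iz] [dx dy' dz]]]]]]] :=
  @near_circle_limit E p1 p2 p3 r t cE rp r1 a1 b1 a2 b2 a3 b3.
  by move=> n; have [] := Hi n t tI.
(* The limit points remain in boxes of radius [2 * r <= r0], where triples are not collinear. *)
have [D _ _ _] := Hr x y z (inbox_le rr0 ix) (inbox_le rr0 iy) (inbox_le rr0 iz).
have t0 : 0 <= t by move: t1 l1; rewrite ler_norml; clear => /andP[? ?] ?; lra.
have ed (p : P) : sqd p c = t ^+ 2 -> Defs.edist c p = t.
  move=> h; rewrite /Defs.edist -[RHS](ger0_norm t0) -sqrtr_sqr -h /sqd.
  by rewrite -(sqrrN (c.1 - p.1)) -(sqrrN (c.2 - p.2)) !opprB.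
by exists x, y, z; split=> //; exists c; split; exact: ed.
Qed.

End Radii.

(** * Areas *)

Section Area.
Variable R : realType.
Local Notation P := (R * R)%type.
Local Notation dy := (@dyadic R).

(** The line dual to [p]: its height at [slope y] is [det2 y p / y.1], so [det2 y p = t] means that
    it passes through [(slope y, t / y.1)]. The shift by 1/2 puts the relevant slopes in the middle
    of [0, 1], where [chi] is not small. *)
Definition lineu (p : P) (v : R) : R := p.2 - (v - 2^-1) * p.1.
Definition slope (y : P) : R := y.2 / y.1 + 2^-1.

Definition pairsum (mu nu : seq (R * P)) (t : R) (k : nat) : R :=
  \sum_(f <- nu) f.1 * avg mu lineu k (slope f.2) (t / f.2.1).

Definition boxX (x : P) := inbox x (0, 1) (1 / 16).
Definition boxY (y : P) := inbox y (1, 0) (1 / 16).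

Lemma boxXE x : boxX x -> [/\ - (1 / 16) <= x.1, x.1 <= 1 / 16, 15 / 16 <= x.2 & x.2 <= 17 / 16].
Proof.
by rewrite /boxX /inbox /= subr0 !ler_norml => /andP[/andP[? ?] /andP[? ?]]; split; lra.
Qed.

Lemma boxYE y : boxY y -> [/\ 15 / 16 <= y.1, y.1 <= 17 / 16, - (1 / 16) <= y.2 & y.2 <= 1 / 16].
Proof.
by rewrite /boxY /inbox /= subr0 !ler_norml => /andP[/andP[? ?] /andP[? ?]]; split; lra.
Qed.

Lemma slope_bound y : boxY y -> 2 / 5 <= slope y <= 3 / 5.
Proof.
move=> /boxYE [y1 y2 y3 y4]; have y0 : 0 < y.1 by lra.
have : - (1 / 15) <= y.2 / y.1 <= 1 / 15.
  by rewrite (ler_pdivlMr _ _ y0) (ler_pdivrMr _ _ y0); apply/andP; split; lra.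
by rewrite /slope => /andP[? ?]; apply/andP; split; lra.
Qed.

Lemma line_curves : curves 1 2 (-1) boxX lineu.
Proof.
split.
- move=> p v /boxXE [p1 p2 p3 p4] /andP[v0 v2]; rewrite /lineu.
  by apply/andP; split; nra.
- move=> p q v _ _ /andP[v0 v2]; rewrite /lineu.
  rewrite (_ : _ - _ - _ = - ((v - 2^-1) * (p.1 - q.1))); last by ring.
  by rewrite normrN normrM ler_wpM2r // ler_norml; apply/andP; split; lra.
- move=> p q v t _ _ qp v0 t0 _; rewrite /lineu.
  rewrite (_ : -1 * _ = (p.1 - q.1) * t); last by ring.
  have h : 0 <= (p.1 - q.1) * t by rewrite mulr_ge0 // subr_ge0.
  by rewrite mul1r lexx /= -mulrA; lra.
- move=> p q v t _ _ v0 t0 _; rewrite /lineu (_ : _ - _ + _ = 0); last by ring.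
  by rewrite normr0; positivity.
Qed.

Lemma line_lip (p : P) (v v' : R) : boxX p -> `|lineu p v - lineu p v'| <= `|v - v'|.
Proof.
move=> /boxXE [p1 p2 _ _]; rewrite /lineu (_ : _ - _ = (v' - v) * p.1); last by ring.
rewrite normrM distrC ler_piMr // ler_norml; apply/andP; split; lra.
Qed.

Lemma eta_lip (d y y' h : R) : `|y - y'| <= h ->
  `|eta d y - eta d y'| <= (`|y| <= h)%R%:R + 2 * (`|y - d| <= h)%R%:R + (`|y - 2 * d| <= h)%R%:R.
Proof.
have st (c z z' : R) : `|z - z'| <= h -> `|(c < z)%R%:R - (c < z')%R%:R| <= (`|z - c| <= h)%R%:R :> R.
  move=> zz; have [h1|h1] := leP `|z - c| h.
    by case: (c < z); case: (c < z'); rewrite ?subrr ?subr0 ?sub0r ?normrN ?normr0 ?normr1.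
  have : (c < z) = (c < z').
    move: h1 zz; rewrite ler_norml ltr_normr => /orP[h1|h1] /andP[h2 h3].
      have -> : c < z by move: h1 h2 h3; clear; have := normr_ge0; lra.
      apply/esym; lra.
    have -> : (c < z) = false by apply/negbTE; rewrite -leNgt; lra.
    by apply/esym/negbTE; rewrite -leNgt; lra.
  by move=> ->; rewrite subrr normr0.
move=> yy; have := st 0 y y' yy; rewrite subr0; have := st d y y' yy; have := st (2 * d) y y' yy.
rewrite /eta; set a := (0 < y)%R%:R; set a' := (0 < y')%R%:R; set b := (d < y)%R%:R; set b' := (d < y')%R%:R.
set c := (2 * d < y)%R%:R; set c' := (2 * d < y')%R%:R => h1 h2 h3.
rewrite (_ : _ - _ = (a - a') - 2 * (b - b') + (c - c')); last by ring.
have h2' : `|2 * (b - b')| <= 2 * (`|y - d| <= h)%R%:R by rewrite normrM ger0_norm // ler_pM2l.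
apply: (le_trans (ler_normD _ _)); apply: lerD => //.
by apply: (le_trans (ler_normB _ _)); exact: lerD.
Qed.

(** [eta] jumps at three values. Moving [(v, b)] by [dy m] affects only the lines within [2 * dy m]
    of a jump, which form three strips counted with weights 1 + 2 + 1. *)
Lemma haar_lip (lam C : R) : 1 / 4 < lam -> lam < 1 / 2 -> 0 <= C ->
  exists K, 0 <= K /\ forall N mu X k m v v' b b', frostman lam C N mu ->
  on X mu -> diam1 X -> (forall x, X x -> boxX x) -> (m <= N)%N -> 0 <= v <= 1 ->
  `|v - v'| <= dy m -> `|b - b'| <= dy m ->
  `|haar mu lineu k v b - haar mu lineu k v' b'| <= K * (2 * lam) ^+ m.
Proof.
move=> l4 l2 C0.
have [K [K0 hK]] := @strip_mass R lam C 2 2 ltac:(lra) ltac:(lra) C0 ltac:(lra) ltac:(lra).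
exists (4 * K); split; first by positivity.
move=> N mu X k m v v' b b' hf oX dX XX mN v01 vv bb.
have [e0 _] := hf; have [_ H0 _ _] := line_curves.
have st c : mass mu (fun p => `|lineu p v - c| <= 2 * dy m) <= K * (2 * lam) ^+ m.
  apply: (hK N mu X) => // p q /XX Xp /XX Xq; apply: H0 => //.
  by case/andP: v01 => ? ?; apply/andP; split; lra.
have h1 := st b; have h2 := st (b + dy k.+1); have h3 := st (b + 2 * dy k.+1).
apply: (@le_trans _ _ (mass mu (fun p => `|lineu p v - b| <= 2 * dy m) +
  2 * mass mu (fun p => `|lineu p v - (b + dy k.+1)| <= 2 * dy m) +
  mass mu (fun p => `|lineu p v - (b + 2 * dy k.+1)| <= 2 * dy m))); last by lra.
rewrite /haar /mass -sumrB mulr_sumr -!big_split /=.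
apply: (le_trans (ler_norm_sum _ _ _)); rewrite big_seq [leRHS]big_seq; apply: ler_sum => e eM.
rewrite -mulrBr normrM (ger0_norm (e0 e eM)).
have := @eta_lip (dy k.+1) (lineu e.2 v - b) (lineu e.2 v' - b') (2 * dy m).
have -> : lineu e.2 v - b - (lineu e.2 v' - b') = (lineu e.2 v - lineu e.2 v') - (b - b') by ring.
have LL := line_lip v v' (XX _ (oX _ eM)).
have d2 : dy m + dy m <= 2 * dy m by lra.
move=> /(_ (normB_le (le_trans LL vv) bb d2)) h.
have -> : lineu e.2 v - (b + dy k.+1) = lineu e.2 v - b - dy k.+1 by ring.
have -> : lineu e.2 v - (b + 2 * dy k.+1) = lineu e.2 v - b - 2 * dy k.+1 by ring.
apply: (le_trans (ler_wpM2l (e0 e eM) h)).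
by rewrite !mulrDr mulrCA.
Qed.

(* The dual map y -> (slope, intercept) has a Lipschitz inverse, so it preserves the
   Frostman condition. *)
Lemma dual_mass (lam C : R) : 1 / 4 < lam -> lam < 1 / 2 -> 0 <= C ->
  exists K, 0 <= K /\ forall N nu Y t m v b, frostman lam C N nu -> on Y nu ->
  diam1 Y -> (forall y, Y y -> boxY y) -> 1 / 2 <= t <= 3 / 2 -> (m <= N)%N ->
  mass nu (fun y => (`|slope y - v| <= dy m) && (`|t / y.1 - b| <= dy m)) <= K * lam ^+ m.
Proof.
move=> l4 l2 C0.
have [K [K0 hK]] := @scale_box R lam C 8 ltac:(lra) ltac:(lra) C0.
exists K; split=> // N nu Y t m v b hf oY dY YY /andP[t1 t2] mN.
have [e0 _] := hf; have d0 := dy_gt0 R m.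
set A := fun y => _.
have [/hasP[e eM Ae]|/hasPn no] := boolP (has (fun e => A e.2) nu); last first.
  rewrite /mass big_seq big1; first by rewrite mulr_ge0 // exprn_ge0 //; lra.
  by move=> e /no/negPf ->; rewrite mulr0.
apply: le_trans (hK N nu Y hf oY dY m e.2 mN).
apply: mass_le => // f fM Af.
have [y1 y2 y3 y4] := boxYE (YY _ (oY _ eM)); have [z1 z2 z3 z4] := boxYE (YY _ (oY _ fM)).
move: Ae Af; rewrite /A => /andP[a1 a2] /andP[b1 b2].
set y := e.2 in y1 y2 y3 y4 a1 a2 *; set z := f.2 in z1 z2 z3 z4 b1 b2 *.
have y0 : 0 < y.1 by move: y1; clear; lra.
have z0 : 0 < z.1 by move: z1; clear; lra.
have vv : `|slope z - slope y| <= 2 * dy m.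
  rewrite (_ : _ - _ = (slope z - v) - (slope y - v)); last by ring.
  by apply: (normB_le b1 a1); clear; lra.
have bb : `|t / z.1 - t / y.1| <= 2 * dy m.
  rewrite (_ : _ - _ = (t / z.1 - b) - (t / y.1 - b)); last by ring.
  by apply: (normB_le b2 a2); clear; lra.
have t0 : 0 < t by move: t1; clear; lra.
have w1 : `|z.1 - y.1| <= 6 * dy m.
  rewrite (_ : z.1 - y.1 = - (z.1 * y.1 / t) * (t / z.1 - t / y.1)); last first.
    by field; rewrite !gt_eqF.
  apply: (@le_trans _ _ (3 * (2 * dy m))); last by lra.
  apply: normM_le => //; rewrite normrN ger0_norm; last by rewrite !(mulr_ge0, invr_ge0) // ltW.
  by rewrite ler_pdivrMr //; move: y1 y2 z1 z2 t1; clear; nra.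
have w2 : `|z.2 - y.2| <= 8 * dy m.
  rewrite (_ : z.2 - y.2 = z.1 * (slope z - slope y) + (y.2 / y.1) * (z.1 - y.1)); last first.
    by rewrite /slope; field; rewrite !gt_eqF.
  have s1 : `|y.2 / y.1| <= 1 / 15.
    rewrite normrM normfV (gtr0_norm y0) ler_pdivrMr // ler_norml.
    by move: y1 y3 y4; clear => *; apply/andP; split; lra.
  have z17 : `|z.1| <= 17 / 16 by rewrite gtr0_norm.
  apply: (le_trans (ler_normD _ _)).
  by have := normM_le z17 vv; have := normM_le s1 w1; move: d0; clear; lra.
by rewrite /inbox w2 andbT; move: w1 d0; clear; lra.
Qed.

(** The Haar coefficient at the point dual to [y] is replaced by its mean over the grid nodes in a
    square of side [dy m] at that point; [haar_lip] bounds the error, the first term. What remains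
    is the sum of [G g * h g] with [G] at most a multiple of [(4 * lam) ^ m] times the grid weight:
    mass [lam ^ m] over area [4 ^- m]. Cauchy-Schwarz against the weight [G], then [haar_l2], give
    the second term. *)
Lemma pair_step (lam C : R) : 1 / 4 < lam -> lam < 1 / 2 -> 0 <= C ->
  exists K, 0 <= K /\ forall N M mu X nu Y t k m, frostman lam C N mu ->
  frostman lam C N nu -> on X mu -> on Y nu -> diam1 X -> diam1 Y ->
  (forall x, X x -> boxX x) -> (forall y, Y y -> boxY y) -> 1 / 2 <= t <= 3 / 2 ->
  (0 < k <= N)%N -> (3 <= m <= N)%N -> (8 ^ k <= M)%N -> 4 <= M%:R * dy m ->
  `|pairsum mu nu t k.+1 - pairsum mu nu t k| <=
    K * ((dy k)^-1 * (2 * lam) ^+ m + Num.sqrt ((4 * lam) ^+ m * (2 * lam) ^+ k)).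
Proof.
move=> l4 l2 C0.
have [K1 [K10 hK1]] := haar_lip l4 l2 C0; have [K2 [K20 hK2]] := dual_mass l4 l2 C0.
have [K3 [K30 hK3]] := @haar_l2 R lam C 1 2 l4 ltac:(lra) C0 ltac:(lra) ltac:(lra).
pose K4 := C * (64 / 3 * K2) * K3.
have K40 : 0 <= K4 by rewrite /K4; positivity; lra.
exists (C * K1 + Num.sqrt K4); split; first by rewrite addr_ge0 ?sqrtr_ge0 // mulr_ge0.
move=> N M mu X nu Y t k m fmu fnu oX oY dX dY XX YY t12 /andP[k0 kN] /andP[m3 mN] kM Mm.
have [e0 _] := fmu; have [f0 _] := fnu.
have d0 := dy_gt0 R m; have dk0 := dy_gt0 R k.
have V0 : 0 <= \sum_(f <- nu) f.1 by rewrite big_seq sumr_ge0.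
have VC := total_le fnu oY dY C0.
have dm : dy m <= 1 / 8.
  by apply: (le_trans (dy_le R m3)); rewrite /dyadic !exprS expr0; clear; lra.
have M0 : (0 < M)%N by apply: leq_trans kM; rewrite expn_gt0.
have Mr : 0 < M%:R :> R by rewrite ltr0n.
have M1 : M%:R / M%:R = 1 :> R by rewrite divff // gt_eqF.
have JM : (2 * M)%:R / M%:R = 2 :> R by rewrite natrM mulfK // gt_eqF.
have lm0 : 0 <= (4 * lam) ^+ m by rewrite exprn_ge0 //; move: l4; clear; lra.
have Q0 : 0 <= 64 / 3 * K2 * (4 * lam) ^+ m by rewrite !mulr_ge0.
have /andP[t1 t2] := t12.
have tb y : boxY y -> 1 / 4 <= t / y.1 <= 7 / 4.
  move=> /boxYE [y1 y2 _ _]; have y0 : 0 < y.1 by move: y1; clear; lra.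
  by rewrite (ler_pdivlMr _ _ y0) (ler_pdivrMr _ _ y0); move: y1 y2 t1 t2; clear => *; apply/andP; split; lra.
pose I (y : P) (g : grid M) : R := ((slope y <= node R M g.1 < slope y + dy m) &&
   (t / y.1 <= ord2 R g < t / y.1 + dy m))%R%:R.
have I0 y g : 0 <= I y g by rewrite /I ler0n.
pose n y := \sum_(g : grid M) I y g.
(* Each side of the square holds at least [M * dy m - 2] nodes, which is no less than [B] because
   [4 <= M * dy m]. *)
pose B := M%:R * dy m / 2.
have B0 : 0 < B by rewrite /B divr_gt0 // mulr_gt0.
have nB y : boxY y -> B ^+ 2 <= n y.
  move=> by'; have /andP[s1 s2] := slope_bound by'; have /andP[b1 b2] := tb y by'.
  have -> : n y = (\sum_(i < M) (slope y <= i%:R / M%:R < slope y + dy m)%R%:R) *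
     (\sum_(j < 2 * M) (t / y.1 <= j%:R / M%:R < t / y.1 + dy m)%R%:R).
    rewrite big_distrlr /= pair_bigA /=; apply: eq_bigr => g _.
    by rewrite /I -natrM mulnb.
  have h1 := @count_itv R M M (slope y) (slope y + dy m) M0
    ltac:(move: s1; clear; lra) ltac:(move: d0; clear; lra) ltac:(rewrite M1; move: s2 dm; clear; lra).
  have h2 := @count_itv R M (2 * M) (t / y.1) (t / y.1 + dy m) M0
    ltac:(move: b1; clear; lra) ltac:(move: d0; clear; lra) ltac:(rewrite JM; move: b2 dm; clear; lra).
  rewrite expr2; apply: ler_pM; rewrite ?(ltW B0) //.
    apply: le_trans h1; rewrite (_ : slope y + dy m - slope y = dy m); last by ring.
    by rewrite /B; move: Mm; clear; lra.
  apply: le_trans h2; rewrite (_ : t / y.1 + dy m - t / y.1 = dy m); last by ring.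
  by rewrite /B; move: Mm; clear; lra.
have n0 y : boxY y -> 0 < n y by move=> /nB; apply: lt_le_trans; rewrite exprn_gt0.
have bY f : f \in nu -> boxY f.2 by move=> /oY /YY.
pose h (g : grid M) := haart mu lineu k g.
pose G g := \sum_(f <- nu) f.1 * (I f.2 g / n f.2).
have G0 g : 0 <= G g.
  rewrite /G big_seq sumr_ge0 // => f fM; rewrite mulr_ge0 ?f0 // divr_ge0 //.
  by rewrite ltW // n0 // bY.
have GS : \sum_g G g = \sum_(f <- nu) f.1.
  rewrite /G exchange_big /= big_seq [RHS]big_seq; apply: eq_bigr => f fM.
  by rewrite -mulr_sumr -mulr_suml -/(n f.2) divff ?mulr1 // gt_eqF // n0 // bY.
(* [G g] is at most the [K2 * lam ^ m] of [dual_mass] divided by [B ^ 2]. Wherever [G] is nonzero,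
   [chi] is at least 3/16, so the constant is 4 * 16 / 3. *)
have GW g : G g <= 64 / 3 * K2 * (4 * lam) ^+ m * wt R g.
  have [I1|I1] := pselect (exists2 f, f \in nu & I f.2 g != 0); last first.
    rewrite /G big_seq big1 => [|f fM].
      by rewrite mulr_ge0 ?wt_ge0.
    have [->|ne] := eqVneq (I f.2 g) 0; first by rewrite mul0r mulr0.
    by case: I1; exists f.
  have w3 : 3 / 16 / M%:R / M%:R <= wt R g.
    rewrite /wt !ler_pM2r ?invr_gt0 //; case: I1 => f fM.
    rewrite /I pnatr_eq0 eqb0 negbK => /andP[/andP[g1 g2] _].
    have /andP[s1 s2] := slope_bound (bY f fM).
    rewrite /chi -/(node R M g.1); move: g1 g2 s1 s2 dm; clear; set z := node _ _ _ => *.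
    by nra.
  apply: (@le_trans _ _ (mass nu (fun y => (`|slope y - node R M g.1| <= dy m) &&
       (`|t / y.1 - ord2 R g| <= dy m)) / B ^+ 2)).
    rewrite /G /mass mulr_suml big_seq [leRHS]big_seq; apply: ler_sum => f fM.
    rewrite -mulrA ler_wpM2l ?f0 //; apply: ler_pM => //.
    - by rewrite invr_ge0 ltW // n0 // bY.
    - rewrite /I; case: (boolP (_ && _)) => [/andP[/andP[g1 g2] /andP[g3 g4]]|_]; last by rewrite ler0n.
      rewrite !ler_norml; move: g1 g2 g3 g4 d0; clear => *.
      have -> : (- dy m <= slope f.2 - node R M g.1 <= dy m) by apply/andP; split; lra.
      by have -> : (- dy m <= t / f.2.1 - ord2 R g <= dy m) by apply/andP; split; lra.
    - by rewrite lef_pV2 ?posrE ?exprn_gt0 // ?n0 ?nB // bY.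
  apply: (@le_trans _ _ (K2 * lam ^+ m / B ^+ 2)).
    rewrite ler_pM2r ?invr_gt0 ?exprn_gt0 //.
    exact: (hK2 N nu Y).
  have -> : K2 * lam ^+ m / B ^+ 2 = 64 / 3 * K2 * (4 * lam) ^+ m * (3 / 16 / M%:R / M%:R).
    rewrite [(4 * lam) ^+ m]exprMn /B; have := dy4 R m; set d := dy m in d0 *; set q := 4 ^+ m => qd.
    have -> : q = d ^- 2.
      by apply: (mulIf (expf_neq0 2 (lt0r_neq0 d0))); rewrite qd mulVf // expf_neq0 // gt_eqF.
    by field; rewrite !gt_eqF.
  by rewrite ler_wpM2l.
have -> : pairsum mu nu t k.+1 - pairsum mu nu t k =
   (dy k)^-1 * \sum_(f <- nu) f.1 * haar mu lineu k (slope f.2) (t / f.2.1).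
  rewrite /pairsum -sumrB mulr_sumr; apply: eq_bigr => f _.
  by rewrite -mulrBr -opprB avg_haar; ring.
have -> : \sum_(f <- nu) f.1 * haar mu lineu k (slope f.2) (t / f.2.1) =
  \sum_(f <- nu) f.1 * (\sum_g I f.2 g / n f.2 * (haar mu lineu k (slope f.2) (t / f.2.1) - h g)) +
  \sum_g G g * h g.
  have -> : \sum_g G g * h g = \sum_(f <- nu) f.1 * \sum_g I f.2 g / n f.2 * h g.
    under [RHS]eq_bigr do rewrite mulr_sumr.
    rewrite [RHS]exchange_big /=; apply: eq_bigr => g _.
    by rewrite /G mulr_suml; apply: eq_bigr => f _; rewrite -[LHS]mulrA.
  rewrite -big_split /= big_seq [RHS]big_seq; apply: eq_bigr => f fM.
  rewrite -mulrDr; congr (_ * _); rewrite -big_split /=.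
  under eq_bigr do rewrite -mulrDr subrK.
  by rewrite -mulr_suml -mulr_suml -/(n f.2) divff ?mul1r // gt_eqF // n0 // bY.
rewrite normrM gtr0_norm ?invr_gt0 //.
have E1 : `|\sum_(f <- nu) f.1 * (\sum_g I f.2 g / n f.2 * (haar mu lineu k (slope f.2) (t / f.2.1) - h g))|
    <= C * (K1 * (2 * lam) ^+ m).
  apply: (le_trans (ler_norm_sum _ _ _)).
  apply: (@le_trans _ _ (\sum_(f <- nu) f.1 * (K1 * (2 * lam) ^+ m))); last first.
    by rewrite -mulr_suml ler_wpM2r // mulr_ge0 // exprn_ge0 //; move: l4; clear; lra.
  rewrite big_seq [leRHS]big_seq; apply: ler_sum => f fM.
  rewrite normrM (ger0_norm (f0 f fM)) ler_wpM2l ?f0 //.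
  have nf := n0 _ (bY f fM).
  apply: (le_trans (ler_norm_sum _ _ _)).
  apply: (@le_trans _ _ (\sum_g I f.2 g / n f.2 * (K1 * (2 * lam) ^+ m))); last first.
    by rewrite -mulr_suml -mulr_suml -/(n f.2) divff ?mul1r // gt_eqF.
  apply: ler_sum => g _; rewrite normrM ger0_norm; last by rewrite divr_ge0 // ltW.
  rewrite /I; case: (boolP (_ && _)) => [/andP[/andP[g1 g2] /andP[g3 g4]]|_]; last by rewrite !mul0r.
  rewrite ler_wpM2l ?divr_ge0 // ?(ltW nf) //.
  rewrite /h /haart; apply: (hK1 N mu X) => //.
  - by have /andP[s1 s2] := slope_bound (bY f fM); move: s1 s2; clear => *; apply/andP; split; lra.
  - by rewrite ler_norml; move: g1 g2 d0; clear => *; apply/andP; split; lra.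
  - by rewrite ler_norml; move: g3 g4 d0; clear => *; apply/andP; split; lra.
have E2 : `|\sum_g G g * h g| <= Num.sqrt (K4 * ((4 * lam) ^+ m * (lam / 2) ^+ k)).
  have cs (h' : grid M -> R) : nrm2 G h' <= 64 / 3 * K2 * (4 * lam) ^+ m * nrm2 (wt R (M := M)) h'.
    by rewrite /nrm2 mulr_sumr; apply: ler_sum => g _; rewrite [leRHS]mulrA ler_wpM2r // sqr_ge0.
  have hb : nrm2 (wt R (M := M)) h <= K3 * (lam / 2) ^+ k.
    apply: (hK3 N mu X (-1) lineu k M) => //; last by rewrite k0.
      by apply: curves_sub line_curves.
    by right.
  have nG1 : nrm2 G (fun=> 1) <= C.
    by rewrite /nrm2; under eq_bigr do rewrite expr1n mulr1; rewrite GS.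
  have one (h' : grid M -> R) : nrm2 (wt R (M := M)) h' = nrm2 (wt R (M := M)) h ->
     \sum_g G g * h' g <= Num.sqrt (K4 * ((4 * lam) ^+ m * (lam / 2) ^+ k)).
    move=> hh; have := cauchy_schwarz G0 (fun=> 1) h'.
    under eq_bigr do rewrite mul1r.
    move=> /le_trans; apply; rewrite -sqrtrM ?nrm2_ge0 // ler_wsqrtr //.
    rewrite /K4 -!(mulrA C); apply: ler_pM => //; rewrite ?nrm2_ge0 //.
    apply: (le_trans (cs h')); rewrite hh.
    rewrite [leRHS](_ : _ = 64 / 3 * K2 * (4 * lam) ^+ m * (K3 * (lam / 2) ^+ k)); last by ring.
    by rewrite ler_wpM2l.
  rewrite ler_norml; apply/andP; split; last exact: one.
  rewrite lerNl -sumrN; under eq_bigr do rewrite -mulrN.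
  by apply: one; apply: eq_bigr => g _; rewrite sqrrN.
apply: (@le_trans _ _ ((dy k)^-1 * (C * (K1 * (2 * lam) ^+ m) + Num.sqrt (K4 * ((4 * lam) ^+ m * (lam / 2) ^+ k))))).
  by rewrite ler_pM2l ?invr_gt0 //; apply: (le_trans (ler_normD _ _)); exact: lerD.
have -> : Num.sqrt (K4 * ((4 * lam) ^+ m * (lam / 2) ^+ k)) =
   Num.sqrt K4 * dy k * Num.sqrt ((4 * lam) ^+ m * (2 * lam) ^+ k).
  rewrite -[dy k in RHS](ger0_norm (ltW dk0)) -sqrtr_sqr -!sqrtrM //; last first.
    by rewrite mulr_ge0 ?sqr_ge0.
  congr Num.sqrt; rewrite -mulrA; congr (_ * _); rewrite mulrCA; congr (_ * _).
  rewrite /dyadic -exprM mulnC exprM -exprMn; congr (_ ^+ _); by field.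
set S := Num.sqrt ((4 * lam) ^+ m * _); have S0 : 0 <= S by exact: sqrtr_ge0.
have D0 : 0 <= (dy k)^-1 * (2 * lam) ^+ m.
  by rewrite mulr_ge0 ?exprn_ge0 ?invr_ge0 ?(ltW dk0) //; move: l4; clear; lra.
have -> : (dy k)^-1 * (C * (K1 * (2 * lam) ^+ m) + Num.sqrt K4 * dy k * S) =
   C * K1 * ((dy k)^-1 * (2 * lam) ^+ m) + Num.sqrt K4 * S by field; rewrite gt_eqF.
have h1 : 0 <= C * K1 * S by rewrite !mulr_ge0.
have h2 : 0 <= Num.sqrt K4 * ((dy k)^-1 * (2 * lam) ^+ m) by rewrite mulr_ge0 ?sqrtr_ge0.
move: h1 h2; set D := (dy k)^-1 * _; set q := Num.sqrt K4 => h1 h2.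
rewrite [leRHS](_ : _ = C * K1 * D + C * K1 * S + q * D + q * S); last by ring.
by move: h1 h2; clear; lra.
Qed.

End Area.

(** * The interval of areas *)

Section AreaCore.
Variable R : realType.
Local Notation P := (R * R)%type.
Local Notation dy := (@dyadic R).

(* The widths [m = 5 j] of the averaging window and the scales [k = 3 j] balance both error
   terms of [pair_step] exactly when [32 lam^3 < 1], i.e. in dimension above 5/3. *)
Lemma pair_chain (lam C : R) : 1 / 4 < lam -> lam < 1 / 2 -> 32 * lam ^+ 3 < 1 -> 0 <= C ->
  exists K q, [/\ 0 <= K, 0 < q & q < 1] /\ forall N M mu X nu Y t j, frostman lam C N mu ->
  frostman lam C N nu -> on X mu -> on Y nu -> diam1 X -> diam1 Y ->
  (forall x, X x -> boxX x) -> (forall y, Y y -> boxY y) -> 1 / 2 <= t <= 3 / 2 ->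
  (0 < j)%N -> (5 * j <= N)%N -> (8 ^ N <= M)%N -> 4 <= M%:R * dy N ->
  `|pairsum mu nu t (3 * j.+1) - pairsum mu nu t (3 * j)| <= K * q ^+ j.
Proof.
move=> l4 l2 l3 C0.
have [K [K0 hK]] := pair_step l4 l2 C0.
(* Since 32 / 27 > 1, the hypothesis forces [lam < 1 / 3], hence [8 * lam ^ 2 < 1]. Both ratios are
   products of that with [32 * lam ^ 3]: [q1 ^ 2 = (32 * lam ^ 3) ^ 2 * (8 * lam ^ 2)] and
   [q2 = (32 * lam ^ 3) * (8 * lam ^ 2)]. *)
have l13 : lam < 1 / 3 by rewrite ltNge; apply/negP => h; move: h l3; clear; nra.
pose q1 := Num.sqrt ((4 * lam) ^+ 5 * (2 * lam) ^+ 3); pose q2 := 8 * (2 * lam) ^+ 5.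
have a0 : 0 < 4 * lam by move: l4; clear; lra.
have b0 : 0 < 2 * lam by move: l4; clear; lra.
have b1 : 2 * lam <= 1 by move: l2; clear; lra.
have l0 : 0 < lam by move: l4; clear; lra.
have l30 : 0 < 32 * lam ^+ 3 by rewrite mulr_gt0 ?exprn_gt0 //; clear; lra.
have e8 : 8 * lam ^+ 2 < 1 by move: l13 l0; clear; nra.
have e80 : 0 < 8 * lam ^+ 2 by rewrite mulr_gt0 ?exprn_gt0 //; clear; lra.
have q1l : (4 * lam) ^+ 5 * (2 * lam) ^+ 3 < 1.
  have -> : (4 * lam) ^+ 5 * (2 * lam) ^+ 3 = (32 * lam ^+ 3) ^+ 2 * (8 * lam ^+ 2) by ring.
  by apply: mulr_ilt1 => //; rewrite ?sqr_ge0 ?(ltW e80) // exprn_ilt1 // ltW.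
have q10 : 0 < (4 * lam) ^+ 5 * (2 * lam) ^+ 3 by rewrite mulr_gt0 ?exprn_gt0.
have q2l : q2 < 1.
  have -> : q2 = (32 * lam ^+ 3) * (8 * lam ^+ 2) by rewrite /q2; ring.
  by apply: mulr_ilt1 => //; exact: ltW.
have q20 : 0 < q2 by rewrite mulr_gt0 ?exprn_gt0 //; clear; lra.
have q1' : q1 < 1 by rewrite -[ltRHS]sqrtr1 ltr_sqrt.
(* Three unit steps, each bounded by [K * (4 + 1) * q ^ j]; the 4 bounds [2 ^ i] for [i < 3]. *)
exists (15 * K), (Num.max q1 q2); split.
  by rewrite gt_max q1' q2l lt_max q20 orbT mulr_ge0.
move=> N M mu X nu Y t j fmu fnu oX oY dX dY XX YY t12 j0 jN NM Mm.
set q := Num.max q1 q2.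
have q1q : q1 <= q by rewrite le_max lexx.
have q2q : q2 <= q by rewrite le_max lexx orbT.
have st i : (i < 3)%N -> `|pairsum mu nu t (3 * j + i).+1 - pairsum mu nu t (3 * j + i)| <= K * (5 * q ^+ j).
  move=> i3; have kN : (3 * j + i <= N)%N by move: i3 j0 jN; clear; lia.
  have k0 : (0 < 3 * j + i)%N by move: j0; clear; lia.
  have m3 : (3 <= 5 * j)%N by move: j0; clear; lia.
  apply: (le_trans (hK N M mu X nu Y t (3 * j + i)%N (5 * j)%N fmu fnu oX oY dX dY XX YY t12 _ _ _ _)).
  - by rewrite k0 kN.
  - by rewrite m3 jN.
  - by apply: leq_trans NM; rewrite leq_exp2l.
  - by apply: (le_trans Mm); rewrite ler_wpM2l ?ler0n // dy_le.
  rewrite ler_wpM2l //.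
  have h1 : (dy (3 * j + i))^-1 * (2 * lam) ^+ (5 * j) <= 4 * q ^+ j.
    have -> : (dy (3 * j + i))^-1 = 8 ^+ j * 2 ^+ i.
      by rewrite /dyadic -exprVn invrK exprD exprM (_ : 2 ^+ 3 = 8); [|ring].
    have -> : 8 ^+ j * 2 ^+ i * (2 * lam) ^+ (5 * j) = 2 ^+ i * q2 ^+ j.
      by rewrite [q2 ^+ j]exprMn -exprM; ring.
    apply: ler_pM; rewrite ?exprn_ge0 ?(ltW q20) //; last by apply: lerXn2r; rewrite ?nnegrE ?(ltW q20) //; exact: le_trans (ltW q20) q2q.
    case: i i3 {kN k0} => [|[|[|]]] // _; rewrite ?expr0 ?expr1 ?expr2; clear; lra.
  have h2 : Num.sqrt ((4 * lam) ^+ (5 * j) * (2 * lam) ^+ (3 * j + i)) <= q ^+ j.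
    apply: (@le_trans _ _ (q1 ^+ j)); last by apply: lerXn2r; rewrite ?nnegrE ?sqrtr_ge0 //; exact: le_trans (sqrtr_ge0 _) q1q.
    have -> : q1 ^+ j = Num.sqrt (((4 * lam) ^+ 5 * (2 * lam) ^+ 3) ^+ j).
      apply/esym/eqP; rewrite -(@eqrXn2 _ 2) ?sqrtr_ge0 ?exprn_ge0 ?sqrtr_ge0 //.
      by rewrite sqr_sqrtr ?exprn_ge0 ?(ltW q10) // -exprM mulnC exprM sqr_sqrtr // ltW.
    apply: ler_wsqrtr; rewrite [leRHS]exprMn -!exprM exprD [leLHS]mulrA ler_piMr //.
      by rewrite mulr_ge0 ?exprn_ge0 // ltW.
    by rewrite exprn_ile1 // ltW.
  by move: h1 h2; clear; lra.
have := st 0%N isT; have := st 1%N isT; have := st 2%N isT.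
rewrite addn0 addn1 addn2 mulnS (_ : (3 + 3 * j)%N = (3 * j).+3); last by rewrite addnC addn3.
set A := pairsum _ _ _ _; set B := pairsum _ _ _ _; set D := pairsum _ _ _ (3 * j).+1; set F := pairsum _ _ _ (3 * j).
move=> h1 h2 h3; rewrite (_ : A - F = (A - B) + ((B - D) + (D - F))); last by ring.
apply: (le_trans (ler_normD _ _)); apply: (le_trans (lerD h1 (ler_normD _ _))).
by move: h2 h3; clear; lra.
Qed.

Lemma det_box (x y : P) : boxX x -> boxY y -> 3 / 4 <= det2 y x <= 5 / 4.
Proof.
move=> /boxXE [x1 x2 x3 x4] /boxYE [y1 y2 y3 y4]; rewrite /det2.
have h1 : `|y.2 * x.1| <= 1 / 16 * (1 / 16).
  by apply: normM_le; rewrite ler_norml; apply/andP; split; lra.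
have h2 : `|(y.1 - 1) * (x.2 - 1)| <= 1 / 16 * (1 / 16).
  by apply: normM_le; rewrite ler_norml; apply/andP; split; lra.
have -> : y.1 * x.2 = (y.1 - 1) * (x.2 - 1) + y.1 + x.2 - 1 by ring.
move: h1 h2; rewrite !ler_norml => /andP[? ?] /andP[? ?]; apply/andP; split; lra.
Qed.

Lemma lineu_det (x y : P) t : boxY y -> lineu x (slope y) - t / y.1 = (det2 y x - t) / y.1.
Proof.
move=> /boxYE [y1 _ _ _]; have y0 : y.1 != 0 by rewrite gt_eqF //; lra.
by rewrite /lineu /slope /det2; field.
Qed.

(* Same pigeonholing as for circles, on the value of [det2 y x]. *)
Lemma pair_start (h1 h2 : R) : 0 < h1 -> 0 < h2 ->
  forall k, (0 < k)%N -> exists (L : nat) (T : nat -> R) (rho : R), 0 < rho /\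
  forall mu nu, (forall e, e \in mu -> 0 <= e.1) -> (forall e, e \in nu -> 0 <= e.1) ->
  on (@boxX R) mu -> on (@boxY R) nu -> \sum_(e <- mu) e.1 = h1 -> \sum_(e <- nu) e.1 = h2 ->
  exists2 n, (n < L)%N & forall t, T n < t < T n + rho ->
    1 / 2 <= t <= 3 / 2 /\ h1 * h2 / 4 <= pairsum mu nu t k.
Proof.
move=> h10 h20 k k0; set eps := dy k.
have e0 : 0 < eps by exact: dy_gt0.
have e2 : eps <= 1 / 2.
  by apply: (le_trans (dy_le R k0)); rewrite /dyadic expr1; clear; lra.
(* For [t] in [(T n, T n + rho)] and a pair of class [n], [det2 y x - t] lies in [(0, 2 * rho)].
   Division by [y.1 >= 15 / 16] keeps it below [eps]. *)
pose rho := eps / 4.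
have r0 : 0 < rho by rewrite /rho; move: e0; clear; lra.
have r8 : rho <= 1 / 8 by rewrite /rho; move: e2; clear; lra.
pose T (n : nat) : R := 3 / 4 - rho + n%:R * rho.
pose L := (Num.truncn (1 / 2 / rho)).+1.
have lr0 : 0 <= 1 / 2 / rho by rewrite divr_ge0 ?(ltW r0) //; clear; lra.
have L1 : rho <= L%:R^-1.
  have Lp : 0 < L%:R :> R by rewrite ltr0n.
  rewrite -[leRHS]mul1r ler_pdivlMr // /L -natr1 mulrDr mulr1.
  have : (Num.truncn (1 / 2 / rho))%:R <= 1 / 2 / rho by rewrite truncn_le.
  rewrite ler_pdivlMr // => h; rewrite mulrC; apply: le_trans (lerD h (lexx _)) _.
  by move: r8; clear; lra.
exists L, T, rho; split=> //.
move=> mu nu n1 n2 on1 on2 hh1 hh2.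
pose cls n (a b : R * P) : R := (T n + rho <= det2 b.2 a.2 < T n + rho + rho)%R%:R.
pose F n := \sum_(b <- nu) \sum_(a <- mu) b.1 * a.1 * cls n a b.
have HF : h1 * h2 <= \sum_(n < L) F n.
  rewrite -hh1 -hh2 mulrC mulr_suml /F [leRHS]exchange_big /=.
  rewrite big_seq [leRHS]big_seq; apply: ler_sum => b bm.
  rewrite mulr_sumr [leRHS]exchange_big /= big_seq [leRHS]big_seq; apply: ler_sum => a am.
  rewrite -mulr_sumr -[leLHS]mulr1 ler_wpM2l ?mulr_ge0 ?(n1 _ am) ?(n2 _ bm) //.
  have /andP[] := det_box (on1 _ am) (on2 _ bm).
  set w := det2 _ _ => w1 w2.
  have w0 : 0 <= (w - 3 / 4) / rho by rewrite divr_ge0 ?(ltW r0) // subr_ge0.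
  pose N := Num.truncn ((w - 3 / 4) / rho).
  have nL : (N < L)%N.
    by rewrite /L ltnS; apply: le_truncn; rewrite ler_pM2r ?invr_gt0 //; move: w2; clear; lra.
  rewrite (bigD1 (Ordinal nL)) //= -[leLHS]addr0; apply: lerD; last by apply: sumr_ge0 => i _; rewrite ler0n.
  have /andP[] := truncn_itv w0; rewrite -/N ler_pdivlMr // ltr_pdivrMr // -(natr1 N) => v1 v2.
  clearbody N; rewrite /cls -/w /T /=.
  have -> : 3 / 4 - rho + N%:R * rho + rho <= w by move: v1; set z := N%:R * rho; clear; lra.
  have -> : w < 3 / 4 - rho + N%:R * rho + rho + rho.
    by move: v2; rewrite [ltRHS]mulrDl mul1r; set z := N%:R * rho; clear; lra.
  exact: lexx.
have [n nL Fn] := pigeonhole_sum (ltn0Sn _) HF.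
exists n => // t /andP[t1 t2].
have t1' : 1 / 2 <= t <= 3 / 2.
  have : n%:R * rho <= 1 / 2.
    rewrite -ler_pdivlMr //; apply: le_trans (_ : (Num.truncn (1 / 2 / rho))%:R <= _).
      by rewrite ler_nat -ltnS.
    by rewrite truncn_le.
  have : 0 <= n%:R * rho by rewrite mulr_ge0 // ltW.
  move: t1 t2 r8; rewrite /T; set z := n%:R * rho; clear => *.
  by apply/andP; split; lra.
split=> //.
apply: (@le_trans _ _ (eps^-1 * F n)).
  apply: (@le_trans _ _ (eps^-1 * (h1 * h2 * rho))).
    by rewrite /rho le_eqVlt; apply/orP; left; apply/eqP; field; rewrite gt_eqF.
  rewrite ler_pM2l ?invr_gt0 //; apply: le_trans Fn.
  by rewrite ler_pM2l // mulr_gt0.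
rewrite /F /pairsum mulr_sumr big_seq [leRHS]big_seq; apply: ler_sum => b bm.
rewrite /avg -/eps /mass [leRHS]mulrCA ler_wpM2l ?invr_ge0 ?(ltW e0) //.
rewrite mulr_sumr big_seq [leRHS]big_seq; apply: ler_sum => a am.
rewrite mulrA ler_wpM2l ?mulr_ge0 ?(n1 _ am) ?(n2 _ bm) // /cls.
case: (boolP (_ <= det2 _ _ < _)) => [/andP[w1 w2]|_]; last by rewrite ler0n.
rewrite lineu_det; last exact: on2 bm.
have [y1 _ _ _] := boxYE (on2 _ bm); have y0 : 0 < b.2.1 by move: y1; clear; lra.
have -> : 0 < (det2 b.2 a.2 - t) / b.2.1 by rewrite divr_gt0 // subr_gt0 (lt_le_trans t2).
have -> : (det2 b.2 a.2 - t) / b.2.1 <= eps.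
  rewrite ler_pdivrMr //.
  have : eps * (15 / 16) <= eps * b.2.1 by rewrite ler_pM2l.
  by move: w2 t1 e0; rewrite /rho; clear; lra.
exact: lexx.
Qed.

Lemma det_close (x y x' y' : P) d : d <= 1 -> boxX x -> boxY y -> inbox x x' d -> inbox y y' d ->
  `|det2 y' x' - det2 y x| <= 10 * d.
Proof.
move=> d1 /boxXE [x1 x2 x3 x4] /boxYE [y1 y2 y3 y4] /andP[a1 a2] /andP[b1 b2].
have d0 : 0 <= d by exact: le_trans (normr_ge0 _) a1.
have h (a b a' b' : R) : `|a| <= 2 -> `|b| <= 2 -> `|a - a'| <= d -> `|b - b'| <= d ->
    `|a' * b' - a * b| <= 5 * d.
  move=> ha hb aa bb.
  rewrite (_ : _ - _ = (a - a') * (b - b') - (b * (a - a') + a * (b - b'))); last by ring.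
  have k1 := normM_le (le_trans aa d1) bb; have k2 := normM_le hb aa; have k3 := normM_le ha bb.
  apply: (normB_le k1 (le_trans (ler_normD _ _) (lerD k2 k3))).
  by clear; lra.
rewrite /det2 (_ : _ - _ = (y'.1 * x'.2 - y.1 * x.2) - (y'.2 * x'.1 - y.2 * x.1)); last by ring.
have n2 (z : R) : -1 <= z <= 2 -> `|z| <= 2.
  by rewrite ler_norml; clear => /andP[? ?]; apply/andP; split; lra.
apply: (normB_le (h _ _ _ _ _ _ b1 a2) (h _ _ _ _ _ _ b2 a1)); try by apply: n2; move: x1 x2 x3 x4 y1 y2 y3 y4; clear => *; apply/andP; split; lra.
by clear; lra.
Qed.

Lemma det_limit (E : set P) (t : R) : compact E ->
  (forall n, exists x y, [/\ E x /\ boxX x, E y /\ boxY y & `|det2 y x - t| <= 2 * dy n]) ->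
  exists x y, [/\ E x, E y & det2 y x = t].
Proof.
move=> cE H.
have dS n : 2 * dy n.+1 <= 2 * dy n by rewrite ler_pM2l // dy_le.
pose Q1 n x y := [/\ E x /\ boxX x, E y /\ boxY y & `|det2 y x - t| <= 2 * dy n].
have [||x [Ex Hx]] := @limit_point R E _ Q1 cE.
- by move=> n; have [x [y h]] := H n; exists x, y; split=> //; case: h => -[].
- by move=> n p w [h1 h2 h3]; split=> //; exact: le_trans (dS n).
pose Q2 n y (_ : unit) := exists2 x', inbox x' x (dy n) & Q1 n x' y.
have [||y [Ey Hy]] := @limit_point R E _ Q2 cE.
- by move=> n; have [x' [y [xx h]]] := Hx n; exists y, tt; split; [case: h => _ []|exists x'].
- move=> n p w [x' xx [h1 h2 h3]]; exists x'; first by apply: inbox_le xx; exact: dy_le.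
  by split=> //; exact: le_trans (dS n).
exists x, y; split=> //; apply/eqP; rewrite -subr_eq0; apply/eqP; apply: (@le0_dy R 12) => n.
have [y' [_ [yy [x' xx [[_ bx] [_ by'] h]]]]] := Hy n.
have := det_close (dy_le1 R n) bx by' xx yy => h'.
rewrite (_ : _ - _ = (det2 y x - det2 y' x') + (det2 y' x' - t)); last by ring.
by apply: (le_trans (ler_normD _ _)); move: h h'; clear; lra.
Qed.

Theorem area_core (lam : R) (E : set P) :
  1 / 4 < lam -> lam < 1 / 2 -> 32 * lam ^+ 3 < 1 -> compact E ->
  E (0, 0) -> thick lam E (0, 1) -> thick lam E (1, 0) ->
  contains_open_interval (triangle_areas E).
Proof.
move=> l4 l2 l3 cE E0 tx ty.
have lam0 : 0 < lam by move: l4; clear; lra.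
have r0 : 0 < 1 / 16 :> R by clear; lra.
have [h1 h10 H1] := thick_measure lam0 l2 tx r0.
have [h2 h20 H2] := thick_measure lam0 l2 ty r0.
have [K [q [[K0 q0 q1] Hstep]]] := @pair_chain lam 9 l4 l2 l3 ltac:(by []).
pose c0 := h1 * h2 / 4; have c00 : 0 < c0 by rewrite divr_gt0 ?mulr_gt0.
have eps0 : 0 < c0 * (1 - q) / (K + 1).
  by rewrite divr_gt0 ?mulr_gt0 //; move: K0 q1; clear; lra.
have [k1 hk1] := pow_small (ltW q0) q1 eps0.
pose k0 := k1.+1.
have hk0 := tail_small K0 q1 (exprn_ge0 k0 (ltW q0)) (hk1 k0 (leqnSn _)).
have [L [T [rho [rho0 Hs]]]] := pair_start h10 h20 (ltn0Sn _ : (0 < 3 * k0)%N).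
have rh : 1 / 16 <= 1 / 2 :> R by clear; lra.
have main n : exists2 i, (i < L)%N & forall t, T i < t < T i + rho ->
    exists x y, [/\ E x /\ boxX x, E y /\ boxY y & `|det2 y x - t| <= 2 * dy n].
  (* The factor 5 lets [pair_chain] run up to [j = k0 + n], its windows having level [5 * j]. *)
  pose N := (5 * (k0 + n))%N.
  have [mu [f1 o1 w1]] := H1 N; have [nu [f2 o2 w2]] := H2 N.
  have o1' : on (@boxX R) mu by move=> e /o1 [].
  have o2' : on (@boxY R) nu by move=> e /o2 [].
  have [e1 _] := f1; have [e2 _] := f2.
  have [i iL Hi] := Hs mu nu e1 e2 o1' o2' w1 w2.
  exists i => // t /Hi [t12 st].
  pose M := (8 ^ N + Num.bound (4 / dy N))%N.
  have NM : (8 ^ N <= M)%N by exact: leq_addr.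
  have d0 := dy_gt0 R N.
  have Mm : 4 <= M%:R * dy N.
    rewrite -ler_pdivrMr //; apply: (@le_trans _ _ (Num.bound (4 / dy N))%:R); last by rewrite ler_nat leq_addl.
    by rewrite ltW // archi_boundP // divr_ge0 // ltW.
  clearbody M.
  have := @telescope_pos R (fun j => pairsum mu nu t (3 * j)) K q c0 k0 n K0 q0 q1.
  move=> pos'.
  have {pos'} : 0 < pairsum mu nu t (3 * (k0 + n)).
    apply: pos' => [j /andP[j1 j2]||] //.
    apply: (Hstep N M mu _ nu _ t j f1 f2 o1 o2 (diam1_box rh) (diam1_box rh)) => //.
    - by move=> x [].
    - by move=> x [].
    - exact: leq_trans j1.
    - by rewrite leq_mul2l ltnW.
  set k := (3 * _)%N; rewrite /pairsum => pos.
  have [b bm bpos] : exists2 b, b \in nu & 0 < avg mu (@lineu R) k (slope b.2) (t / b.2.1).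
    apply: contrapT => no; move: pos; rewrite ltNge => /negP; apply.
    rewrite big_seq; apply: sumr_le0 => b bm; apply: mulr_ge0_le0; first exact: e2.
    by rewrite leNgt; apply/negP => h; apply: no; exists b.
  have dk := dy_gt0 R k.
  have [a am] : exists2 a, a \in mu & 0 < lineu a.2 (slope b.2) - t / b.2.1 <= dy k.
    by move: bpos; rewrite /avg pmulr_rgt0 ?invr_gt0 // => /mass_gt0.
  rewrite lineu_det; last exact: o2'.
  have [y1 y2 _ _] := boxYE (o2' _ bm); have y0 : 0 < b.2.1 by move: y1; clear; lra.
  have kn : dy k <= dy n by apply: dy_le; rewrite /k; clear; lia.
  rewrite pmulr_lgt0 ?invr_gt0 // ler_pdivrMr // => /andP[d1 d2].
  exists a.2, b.2; split; [exact: o1|exact: o2|].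
  rewrite gtr0_norm //; apply: (le_trans d2); apply: (le_trans (ler_wpM2l (ltW dk) y2)).
  by move: kn dk; clear; lra.
pose Q n i := forall t, T i < t < T i + rho ->
  exists x y, [/\ E x /\ boxX x, E y /\ boxY y & `|det2 y x - t| <= 2 * dy n].
have [|i iL Hi] := @pigeonhole_level L Q _ main.
  move=> n i h t /h [x [y [h3 h4 h5]]]; exists x, y; split=> //.
  by apply: (le_trans h5); rewrite ler_pM2l // dy_le.
exists (T i / 2), ((T i + rho) / 2); split; first by rewrite ltr_pM2r ?invr_gt0 // ltrDl.
move=> s /= /andP[s1 s2].
have tI : T i < 2 * s < T i + rho by move: s1 s2; clear => *; apply/andP; split; lra.
have [x [y [Ex Ey dE]]] := det_limit cE (fun n => Hi n _ tI).
(* At scale 2 the error [2 * dy 2] is 1/2, while the determinant is at least 3/4, so [2 * s] is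
   positive. *)
have [x0 [y0 [[_ bx0] [_ by0] h0]]] := Hi 2%N _ tI.
have d2 : dy 2 = 1 / 4 by rewrite /dyadic expr2; field.
have s0 : 0 <= s.
  by move: h0; rewrite d2 ler_norml; have /andP[] := det_box bx0 by0; clear => ? ? /andP[? ?]; lra.
exists x, y, (0, 0); split=> //.
rewrite /det2 /psub /= !subr0 (_ : _ - _ = - (2 * s)); last by rewrite -dE /det2; ring.
by rewrite normrN ger0_norm ?mulr_ge0 // mulrA mulVf ?mul1r.
Qed.

End AreaCore.

(** * Normalisation *)

Section Affine.
Variable R : realType.
Local Notation P := (R * R)%type.

Definition aff (a b c d e f : R) (p : P) : P := (a * p.1 + b * p.2 + e, c * p.1 + d * p.2 + f).

Definition affi (a b c d e f : R) : P -> P :=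
  let D := a * d - b * c in
  aff (d / D) (- b / D) (- c / D) (a / D) ((b * f - d * e) / D) ((c * e - a * f) / D).

Lemma affK a b c d e f p : a * d - b * c != 0 -> affi a b c d e f (aff a b c d e f p) = p.
Proof. by case: p => x y D0; rewrite /affi /aff /=; congr pair; field. Qed.

Lemma affiK a b c d e f p : a * d - b * c != 0 -> aff a b c d e f (affi a b c d e f p) = p.
Proof. by case: p => x y D0; rewrite /affi /aff /=; congr pair; field. Qed.

Lemma aff_inbox a b c d e f : exists2 K, 0 < K & forall (p q : P) (r : R), 0 <= r ->
  inbox p q r -> inbox (aff a b c d e f p) (aff a b c d e f q) (K * r).
Proof.
exists (`|a| + `|b| + (`|c| + `|d|) + 1); first by rewrite ltr_wpDl // !addr_ge0.
move=> p q r r0 /andP[h1 h2].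
have h x y : `|x * (p.1 - q.1) + y * (p.2 - q.2)| <= (`|x| + `|y|) * r.
  apply: (le_trans (ler_normD _ _)); rewrite mulrDl !normrM.
  by apply: lerD; rewrite ler_wpM2l.
have n1 : 0 <= (`|a| + `|b|) * r by rewrite mulr_ge0 // addr_ge0.
have n2 : 0 <= (`|c| + `|d|) * r by rewrite mulr_ge0 // addr_ge0.
rewrite /inbox /aff /= [leRHS]mulrDl [(_ + (`|c| + _)) * r]mulrDl mul1r.
apply/andP; split.
  rewrite (_ : _ - _ = a * (p.1 - q.1) + b * (p.2 - q.2)); last by ring.
  by apply: (le_trans (h a b)); lra.
rewrite (_ : _ - _ = c * (p.1 - q.1) + d * (p.2 - q.2)); last by ring.
by apply: (le_trans (h c d)); rewrite !mulrDl; lra.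
Qed.

Lemma aff_compact a b c d e f (E : set P) : compact E -> compact (aff a b c d e f @` E).
Proof.
apply: continuous_compact; apply: continuous_subspaceT => p.
have h x y z : (fun q : P => x * q.1 + y * q.2 + z) @ p --> x * p.1 + y * p.2 + z.
  apply: cvgD; last exact: cvg_cst.
  by apply: cvgD; apply: cvgM; [exact: cvg_cst|exact: cvg_fst|exact: cvg_cst|exact: cvg_snd].
exact: (cvg_pair (h a b e) (h c d f)).
Qed.

Lemma det2_aff a b c d e f (x y z : P) :
  det2 (psub (aff a b c d e f x) (aff a b c d e f z)) (psub (aff a b c d e f y) (aff a b c d e f z)) =
  (a * d - b * c) * det2 (psub x z) (psub y z).
Proof. by rewrite /det2 /psub /aff /=; ring. Qed.

Lemma aff_thick lam a b c d e f (E : set P) p : 0 < lam -> lam < 1 / 2 ->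
  a * d - b * c != 0 -> thick lam E p -> thick lam (aff a b c d e f @` E) (aff a b c d e f p).
Proof.
move=> l0 l1 D0 tp; have [K K0 hK] := aff_inbox a b c d e f.
have [L _ hL] : exists2 L, 0 < L & forall (p q : P) (r : R), 0 <= r -> inbox p q r ->
    inbox (affi a b c d e f p) (affi a b c d e f q) (L * r) by exact: aff_inbox.
by apply: (thick_image l0 l1 _ hL K0 hK tp) => q; exact: affK.
Qed.

Lemma triangle_areas_aff a b c d e f (E : set P) : a * d - b * c != 0 ->
  contains_open_interval (triangle_areas (aff a b c d e f @` E)) ->
  contains_open_interval (triangle_areas E).
Proof.
move=> D0 [s [t [st h]]]; have N0 : 0 < `|a * d - b * c| by rewrite normr_gt0.
exists (s / `|a * d - b * c|), (t / `|a * d - b * c|); split; first by rewrite ltr_pM2r ?invr_gt0.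
move=> u /= /andP[]; rewrite ltr_pdivrMr // ltr_pdivlMr // => u1 u2.
have /h [_ [_ [_ [[x Ex <-] [y Ey <-] [z Ez <-]]]]] : s < u * `|a * d - b * c| < t by apply/andP.
rewrite det2_aff normrM mulrCA mulrC => /(mulfI (lt0r_neq0 N0)) ->.
by exists x, y, z.
Qed.

Lemma area_interval lam (E : set P) : 1 / 4 < lam -> lam < 1 / 2 -> 32 * lam ^+ 3 < 1 -> compact E ->
  (exists x y z, [/\ E x, E y & E z] /\ [/\ thick lam E x, thick lam E y & thick lam E z] /\
     det2 (psub x z) (psub y z) != 0) ->
  contains_open_interval (triangle_areas E).
Proof.
move=> l4 l2 l3 cE [x [y [z [[Ex Ey Ez] [[tx ty tz] D0]]]]].
have l0 : 0 < lam by lra.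
pose D := (y.1 - z.1) * (x.2 - z.2) - (x.1 - z.1) * (y.2 - z.2).
have D0' : D != 0.
  by rewrite (_ : D = - det2 (psub x z) (psub y z)) ?oppr_eq0 // /D /det2 /psub /=; ring.
(* The inverse of the affine map with columns [y - z] and [x - z] and translation [z]. *)
pose G := affi (y.1 - z.1) (x.1 - z.1) (y.2 - z.2) (x.2 - z.2) z.1 z.2.
have g0 : G z = (0, 0).
  by rewrite /G /affi -/D /aff /=; congr pair; field.
have g1 : G x = (0, 1).
  by rewrite /G /affi -/D /aff /=; congr pair; move: D0'; rewrite /D => D0'; field.
have g2 : G y = (1, 0).
  by rewrite /G /affi -/D /aff /=; congr pair; move: D0'; rewrite /D => D0'; field.
have I0 : (x.2 - z.2) / D * ((y.1 - z.1) / D) - - (x.1 - z.1) / D * (- (y.2 - z.2) / D) != 0.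
  rewrite (_ : _ - _ = D^-1); first by rewrite invr_eq0.
  by move: D0'; rewrite /D => D0'; field.
apply: (triangle_areas_aff (e := ((x.1 - z.1) * z.2 - (x.2 - z.2) * z.1) / D)
  (f := ((y.2 - z.2) * z.1 - (y.1 - z.1) * z.2) / D) I0).
apply: (area_core l4 l2 l3 (aff_compact cE)).
- by exists z => //; exact: g0.
- by rewrite -g1; exact: aff_thick.
- by rewrite -g2; exact: aff_thick.
Qed.

Lemma sqd_aff (u v e f r : R) (p q : P) : u ^+ 2 + v ^+ 2 = 1 -> r != 0 ->
  sqd (aff (u / r) (- v / r) (v / r) (u / r) e f p) (aff (u / r) (- v / r) (v / r) (u / r) e f q) =
  sqd p q / r ^+ 2.
Proof.
move=> uv r0; rewrite -[RHS]mul1r -uv /sqd /aff /=; field; exact: r0.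
Qed.

Lemma edist_sqd (p q : P) : Defs.edist p q = Num.sqrt (sqd p q).
Proof. by []. Qed.

Lemma sim_det (u v r : R) : u ^+ 2 + v ^+ 2 = 1 -> r != 0 ->
  u / r * (u / r) - - v / r * (v / r) = r ^- 2.
Proof. by move=> uv r0; rewrite -[RHS]mul1r -uv; field; exact: r0. Qed.

Lemma circle_radii_sim (u v e f r : R) (E : set P) : u ^+ 2 + v ^+ 2 = 1 -> 0 < r ->
  contains_open_interval (circle_radii (aff (u / r) (- v / r) (v / r) (u / r) e f @` E)) ->
  contains_open_interval (circle_radii E).
Proof.
move=> uv r0 [s [t [st h]]]; have rn := lt0r_neq0 r0.
have D0 : u / r * (u / r) - - v / r * (v / r) != 0.
  by rewrite sim_det // invr_eq0 expf_neq0.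
exists (s * r), (t * r); split; first by rewrite ltr_pM2r.
move=> w /= /andP[]; rewrite -(ltr_pdivlMr _ _ r0) -(ltr_pdivrMr _ _ r0) => w1 w2.
have /h [_ [_ [_ [[x Ex <-] [y Ey <-] [z Ez <-]]]]] : s < w / r < t by apply/andP.
rewrite det2_aff mulf_eq0 negb_or => /andP[_ dn] [c].
rewrite -(affiK e f c D0); set c' := affi _ _ _ _ _ _ c => -[h1 h2 h3].
have ed (p : P) : Defs.edist (aff (u / r) (- v / r) (v / r) (u / r) e f c')
    (aff (u / r) (- v / r) (v / r) (u / r) e f p) = w / r -> Defs.edist c' p = w.
  rewrite !edist_sqd sqd_aff // sqrtrM ?sqd_ge0 // sqrtrV ?sqr_ge0 // sqrtr_sqr gtr0_norm //.
  by apply: mulIf; rewrite invr_eq0.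
by exists x, y, z; split=> //; exists c'; split; exact: ed.
Qed.

(* A slope steeper than all those of the three given vectors. *)
Lemma rotation_avoids (x y z : P) : x != 0 -> y != 0 -> z != 0 ->
  exists u v : R, u ^+ 2 + v ^+ 2 = 1 /\
    [/\ v * x.1 + u * x.2 != 0, v * y.1 + u * y.2 != 0 & v * z.1 + u * z.2 != 0].
Proof.
move=> x0 y0 z0.
pose m := 1 + `|x.2 / x.1| + `|y.2 / y.1| + `|z.2 / z.1|.
pose s := Num.sqrt (1 + m ^+ 2).
have m1 : 0 < 1 + m ^+ 2 by rewrite ltr_pwDl ?sqr_ge0.
have s0 : 0 < s by rewrite sqrtr_gt0.
have ss : s ^+ 2 = 1 + m ^+ 2 by rewrite sqr_sqrtr // ltW.
have key (p : P) : p != 0 -> `|p.2 / p.1| < m -> m / s * p.1 + s^-1 * p.2 != 0.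
  case: p => a b /= p0 pm; rewrite (_ : _ + _ = (m * a + b) / s); last by field; rewrite gt_eqF.
  rewrite mulf_neq0 ?invr_eq0 ?(gt_eqF s0) //; apply/eqP => h.
  have [a0|a0] := eqVneq a 0.
    by move: h p0; rewrite a0 mulr0 add0r => ->; rewrite eqxx.
  move: pm; rewrite (_ : b = - (m * a)); last by rewrite -[RHS]addr0 -h addKr.
  by rewrite mulNr mulfK // normrN ltNge ler_norm.
exists s^-1, (m / s); split.
  rewrite exprVn expr_div_n -[X in X + _]mul1r -mulrDl -ss divff //.
  by rewrite expf_neq0 // gt_eqF.
have := normr_ge0 (x.2 / x.1); have := normr_ge0 (y.2 / y.1); have := normr_ge0 (z.2 / z.1).
by move=> h1 h2 h3; split; apply: key => //; rewrite /m; move: h1 h2 h3; clear; lra.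
Qed.

(** A similarity takes the circumcircle of three thick points to the unit circle. Its rotation keeps
    the three images off the horizontal axis, where the curves of [circ] would have vertical
    tangents. *)
Lemma radius_interval lam (E : set P) : 1 / 4 < lam -> lam < 1 / 2 -> 32 * lam ^+ 3 < 1 -> compact E ->
  (exists x y z, [/\ thick lam E x, thick lam E y & thick lam E z] /\
     det2 (psub x z) (psub y z) != 0) ->
  contains_open_interval (circle_radii E).
Proof.
move=> l4 l2 l3 cE [x [y [z [[tx ty tz] D0]]]].
have l0 : 0 < lam by lra.
have [dx dy' dz] := circumcentre_dist D0; set c := circumcentre x y z in dx dy' dz; set r := circumradius x y z in dx dy' dz.
have r00 : 0 <= r by exact: sqrtr_ge0.
clearbody c r.
have r0 : 0 < r.
  rewrite lt_neqAle r00 andbT eq_sym; apply/eqP => h.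
  have q0 (p : P) : sqd p c = r ^+ 2 -> p = c.
    rewrite h expr0n /sqd => /eqP; rewrite paddr_eq0 ?sqr_ge0 // !sqrf_eq0 !subr_eq0 => /andP[/eqP p1 /eqP p2].
    by apply: injective_projections.
  by move: D0; rewrite (q0 x dx) (q0 y dy') /det2 mulrC subrr eqxx.
have rn := lt0r_neq0 r0.
have pn (p : P) : sqd p c = r ^+ 2 -> psub p c != 0.
  move=> h; apply/eqP => -[p1 p2]; move: h; rewrite /sqd p1 p2 !expr0n addr0 => /esym/eqP.
  by rewrite expf_eq0 /= (negPf rn).
have [u [v [uv [n1 n2 n3]]]] := rotation_avoids (pn x dx) (pn y dy') (pn z dz).
pose e := - (u * c.1 - v * c.2) / r; pose f := - (v * c.1 + u * c.2) / r.
pose G := aff (u / r) (- v / r) (v / r) (u / r) e f.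
have I0 : u / r * (u / r) - - v / r * (v / r) != 0 by rewrite sim_det // invr_eq0 expf_neq0.
have Gc : G c = (0, 0) by rewrite /G /aff /e /f; congr pair; field.
have un (p : P) : sqd p c = r ^+ 2 -> (G p).1 ^+ 2 + (G p).2 ^+ 2 = 1.
  move=> h; have := sqd_aff e f p c uv rn; rewrite h divff ?expf_neq0 //.
  by rewrite -/(G c) Gc /sqd !subr0.
have nz (p : P) : v * (psub p c).1 + u * (psub p c).2 != 0 -> (G p).2 != 0.
  have -> : (G p).2 = (v * (psub p c).1 + u * (psub p c).2) / r by rewrite /G /aff /f /=; field.
  by move=> h; rewrite mulf_neq0 // invr_eq0.
apply: (circle_radii_sim uv r0 (e := e) (f := f)).
apply: (radii_core l4 l2 l3 (aff_compact cE) (aff_thick e f l0 l2 I0 tx)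
  (aff_thick e f l0 l2 I0 ty) (aff_thick e f l0 l2 I0 tz) (un _ dx) (un _ dy') (un _ dz)
  (nz _ n1) (nz _ n2) (nz _ n3)).
by rewrite det2_aff mulf_neq0.
Qed.

End Affine.

Unset Implicit Arguments.

Theorem theorem1p1 (R : realType) (E : set (R * R)) :
  compact E ->
  ((5 / 3 : R)%:E < hausdorff_dim E)%E ->
  contains_open_interval (triangle_areas E) /\
  contains_open_interval (circle_radii E).
Proof.
move=> cE /dim_pos_content [lam [l4 l2 l3 fE]].
have l0 : 0 < lam by lra.
have [x [y [z [hE [ht hD]]]]] := thick_triangle l0 l2 cE fE.
split; last by apply: radius_interval l4 l2 l3 cE _; exists x, y, z.
by apply: area_interval l4 l2 l3 cE _; exists x, y, z.
Qed.
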